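(* Let $f$ be a mixing piecewise expanding $C^3$ unimodal map and let $X\in C^2(f(I))$ satisfy $X(a)=0$. For every $\varphi\in C^0([a,b])$ the series $$-\sum_{j=1}^\infty\int\mathcal L_1^j\bigl((X\rho_{reg})'\bigr)(x)\,\varphi(x)\,dx$$ converges. If $\mathcal J(f,X)\ne0$, then there exists $\varphi\in C^\infty([a,b])$ such that, on the one hand, both of the series $$-\sum_{j=1}^{\infty}\varphi(c_j)\sum_{k=1}^{\min(j,M_f)}\frac{s_1X(c_k)}{(f^{k-1})'(c_1)}\qquad\text{and}\qquad-\sum_{j=1}^\infty\int\mathcal L_1^j(X'\rho_{sal})(x)\,\varphi(x)\,dx$$ diverge, and, on the other hand, the series $$-\sum_{j=1}^\infty\Bigl(\varphi(c_j)\sum_{k=1}^{\min(j,M_f)}\frac{s_1X(c_k)}{(f^{k-1})'(c_1)}+\int\mathcal L_1^j(X'\rho_{sal})(x)\,\varphi(x)\,dx\Bigr)$$ diverges.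
   Context: Fix $I=[a,b]$, $a<c<b$, $I_+=[a,c]$, $I_-=[c,b]$. For $r\ge1$, a piecewise expanding $C^r$ unimodal map is a continuous $f:I\to I$, strictly increasing on $I_+$, strictly decreasing on $I_-$, with $f(a)=f(b)=a$, such that for $\sigma=\pm$ the map $f|_{I_\sigma}$ extends to a $C^r$ map on a neighbourhood of $I_\sigma$ and $\inf|f'|_{I_\sigma}|>1$. Put $c_k=f^k(c)$. $f$ is mixing if it is topologically mixing on $[f^2(c),f(c)]$. $(f^j)'(x)=\prod_{i<j}f'(f^i(x))$. If $c$ is periodic of minimal period $n_1$ set $N_f=M_f=n_1$. If $c$ is not periodic but some iterate is, let $n_0$ be minimal with $c_{n_0}$ periodic, $n_1$ the minimal period of $c_{n_0}$, and set $N_f=n_0+n_1-1$, $M_f=\infty$. Otherwise $N_f=M_f=\infty$. $\rho_0$ denotes the density (extended by $0$ to $\mathbb R$) of the unique absolutely continuous $f$-invariant probability measure; it has bounded variation. Let $H_u(x)=-1$ for $x<u$, $0$ for $x>u$, $H_u(u)=-1/2$. Then $\rho_0=\rho_{sal}+\rho_{reg}$ with $\rho_{reg}$ continuous and $\rho_{sal}=\sum_{n=1}^{N_f}s_nH_{c_n}$, $s_n=\lim_{y\downarrow c_n}\rho_0(y)-\lim_{x\uparrow c_n}\rho_0(x)$. It is known that $\rho_{reg}'$ (a.e. derivative) has bounded variation. $\mathcal J(f,X)=\sum_{n=1}^{N_f}s_nX(c_n)$. Note $f(I)=[a,c_1]$; $X$ and $X'$ are set to be $0$ outside $[a,c_1]$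 in the products $X'\rho_{sal}$, $(X\rho_{reg})'$. $\mathcal L_1$ is the Perron–Frobenius operator $\mathcal L_1\varphi(x)=\sum_{f(y)=x}\varphi(y)/|f'(y)|$ acting on functions of bounded variation supported in $[a,b]$ (modulo countable sets). Since $f$ is mixing, $\mathcal L_1$ has simple eigenvalue $1$ (eigenvector $\rho_0$, dual eigenvector Lebesgue measure) and the rest of its spectrum lies in a disc of radius $<1$. *)

(* Defs.v *)
From mathcomp Require Import all_boot all_order all_algebra.
From mathcomp Require Import all_classical all_reals all_analysis.

Set Implicit Arguments.
Unset Strict Implicit.
Unset Printing Implicit Defensive.

Import Order.TTheory GRing.Theory Num.Theory.
Import numFieldNormedType.Exports.

Local Open Scope classical_set_scope.
Local Open Scope ring_scope.

(* Derivative at x of the restriction of g to A: one-sided at an endpoint of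
   an interval A. *)
Definition deriv_in (R : realType) (A : set R) (g : R -> R) (x : R) : R :=
  lim ((g y - g x) / (y - x) @[y --> within A x^']).

Definition Cr_on_open (R : realType) (r : nat) (U : set R) (g : R -> R) : Prop :=
  (forall k, (k <= r)%N -> forall x, U x -> {for x, continuous (derive1n k g)}) /\
  (forall k, (k < r)%N -> forall x, U x -> derivable (derive1n k g) x 1).

(* The restriction of f to A extends to a C^r map on a neighbourhood of A. *)
Definition Cr_ext (R : realType) (r : nat) (A : set R) (f : R -> R) : Prop :=
  exists (U : set R) (g : R -> R),
    [/\ open U, A `<=` U, (forall x, A x -> g x = f x) & Cr_on_open r U g].

Definition Cinfty_ext (R : realType) (A : set R) (f : R -> R) : Prop :=
  exists (U : set R) (g : R -> R),
    [/\ open U, A `<=` U, (forall x, A x -> g x = f x) &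
        forall r, Cr_on_open r U g].

(* Only the values of f on [a, b] are constrained or used. *)
Record unimodal (R : realType) (r : nat) (a b c : R) (f : R -> R) : Prop := {
  uni_ac : a < c;
  uni_cb : c < b;
  uni_maps : forall x, `[a, b]%classic x -> `[a, b]%classic (f x);
  uni_cont : {within `[a, b], continuous f};
  uni_incr : {in `[a, c] &, {homo f : x y / x < y}};
  uni_decr : {in `[c, b] &, {homo f : x y / x < y >-> y < x}};
  uni_fa : f a = a;
  uni_fb : f b = a;
  uni_Cr_left : Cr_ext r `[a, c] f;
  uni_Cr_right : Cr_ext r `[c, b] f;
  uni_exp_left :
    1 < inf [set `|deriv_in `[a, c] f x| | x in `[a, c]%classic];
  uni_exp_right :
    1 < inf [set `|deriv_in `[c, b] f x| | x in `[c, b]%classic]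
}.

Definition top_mixing_on (R : realType) (J : set R) (f : R -> R) : Prop :=
  forall U V : set R, open U -> open V ->
    U `&` J !=set0 -> V `&` J !=set0 ->
    exists n0 : nat, forall n, (n0 <= n)%N ->
      (iter n f @` (U `&` J)) `&` (V `&` J) !=set0.

Definition mixing (R : realType) (c : R) (f : R -> R) : Prop :=
  top_mixing_on `[f (f c), f c] f.

(* f'(x), one-sided at a and b; meaningless at c. *)
Definition dmap (R : realType) (a b : R) (f : R -> R) (x : R) : R :=
  deriv_in `[a, b] f x.

Definition diter (R : realType) (a b : R) (f : R -> R) (j : nat) (x : R) : R :=
  \prod_(i < j) dmap a b f (iter i f x).

(* Elements of {0, 1, 2, ...} U {oo} are coded in option nat, None being oo. *)
Definition least (P : nat -> Prop) : option nat :=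
  if pselect (exists n, `[< P n >]) is left h then Some (ex_minn h) else None.

Definition min_period (T : Type) (f : T -> T) (x : T) : option nat :=
  least (fun n => (0 < n)%N /\ iter n f x = x).

Definition N_of (T : Type) (f : T -> T) (c : T) : option nat :=
  if least (fun n => min_period f (iter n f c) <> None) is Some n0 then
    if min_period f (iter n0 f c) is Some n1 then
      Some (if n0 is 0 then n1 else (n0 + n1).-1)
    else None
  else None.

Definition M_of (T : Type) (f : T -> T) (c : T) : option nat := min_period f c.

Definition le_onat (n : nat) (N : option nat) : bool :=
  if N is Some m then (n <= m)%N else true.

Definition min_onat (n : nat) (N : option nat) : nat :=
  if N is Some m then minn n m else n.

(* sum_{n=1}^{N} u n, for N possibly infinite *)
Definition sum_upto (R : realType) (N : option nat) (u : nat -> R) : R :=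
  limn (fun m => \sum_(1 <= n < m.+1 | le_onat n N) u n).

Definition Hstep (R : realType) (u x : R) : R :=
  if x < u then -1 else if u < x then 0 else - 2^-1.

(* rho, vanishing off [a, b], is a density of bounded variation of an
   f-invariant probability measure on [a, b]. *)
Record acim_density (R : realType) (a b : R) (f : R -> R) (rho : R -> R) : Prop := {
  acim_bv : bounded_variation a b rho;
  acim_ge0 : forall x, 0 <= rho x;
  acim_supp : forall x, ~ `[a, b]%classic x -> rho x = 0;
  acim_mass : (\int[lebesgue_measure]_(x in `[a, b]) (rho x)%:E = 1)%E;
  acim_inv : forall A : set R, measurable A ->
    (\int[lebesgue_measure]_(x in `[a, b] `&` f @^-1` A) (rho x)%:E =
     \int[lebesgue_measure]_(x in `[a, b] `&` A) (rho x)%:E)%E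
}.

Definition jump (R : realType) (rho : R -> R) (u : R) : R :=
  lim (rho y @[y --> u^'+]) - lim (rho x @[x --> u^'-]).

Definition s_coef (R : realType) (f : R -> R) (c : R) (rho : R -> R) (n : nat) : R :=
  jump rho (iter n f c).

Definition rho_sal (R : realType) (f : R -> R) (c : R) (rho : R -> R) (x : R) : R :=
  sum_upto (N_of f c) (fun n => s_coef f c rho n * Hstep (iter n f c) x).

(* rho and rho_reg as in the decomposition rho = rho_sal + rho_reg with
   rho_reg continuous. The equality holds at every point, which selects the
   representative of rho having the mean of its one-sided limits at each c_n;
   both functions are then uniquely determined by f. *)
Record decomposed_density (R : realType) (a b c : R) (f : R -> R)
    (rho rho_reg : R -> R) : Prop := {
  dd_acim : acim_density a b f rho;
  dd_cont : continuous rho_reg;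
  dd_decomp : forall x, rho x = rho_sal f c rho x + rho_reg x
}.

Definition J_of (R : realType) (f : R -> R) (c : R) (rho X : R -> R) : R :=
  sum_upto (N_of f c) (fun n => s_coef f c rho n * X (iter n f c)).

(* X' rho_sal, with X' = 0 outside [a, f c] *)
Definition dX_rho_sal (R : realType) (a c : R) (f rho X : R -> R) (x : R) : R :=
  if x \in `[a, f c] then deriv_in `[a, f c] X x * rho_sal f c rho x else 0.

(* (X rho_reg)', with X = 0 outside [a, f c]; a two-sided derivative, which
   may fail to exist on a null set *)
Definition d_X_rho_reg (R : realType) (a c : R) (f rho_reg X : R -> R) : R -> R :=
  derive1 (fun x => (if x \in `[a, f c] then X x else 0) * rho_reg x).

(* The value at f c involves dmap a b f c and is meaningless: functions are
   taken modulo countable sets. *)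
Definition L1 (R : realType) (a b : R) (f phi : R -> R) (x : R) : R :=
  \sum_(y \in `[a, b] `&` f @^-1` [set x]) (phi y / `|dmap a b f y|).

Definition L1_pairing (R : realType) (a b : R) (f psi phi : R -> R) (j : nat) : R :=
  \int[lebesgue_measure]_(x in `[a, b]) (iter j (L1 a b f) psi x * phi x).

Definition orbit_term (R : realType) (a b c : R) (f rho X phi : R -> R) (j : nat) : R :=
  phi (iter j f c) *
  \sum_(1 <= k < (min_onat j (M_of f c)).+1)
     (s_coef f c rho 1 * X (iter k f c) / diter a b f k.-1 (f c)).

(* convergence of the series - sum_{j >= 1} u j *)
Definition neg_series_cvg (R : realType) (u : nat -> R) : Prop :=
  cvgn (fun n => - \sum_(1 <= j < n.+1) u j).

(* Main.v *)
(* For [psi] of bounded variation and mean zero, a Lasota-Yorke inequality and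
   the covering property given by mixing make the L^1 norm of [L^j psi] decay
   exponentially.

   Formally differentiating [rho = L rho] leads to a contracting equation whose
   solution [DD] has bounded variation; [rho_reg] and the primitive of [DD] have
   a difference satisfying a homogeneous contracting equation, so
   [rho_reg' = DD].  As [X rho_reg] vanishes at both ends of [[a, f c]], its
   derivative has mean zero, and the first series converges.

   The jumps of [rho] satisfy the transfer relation along the critical orbit,
   so the inner orbit sums tend to [J], while [X' rho_sal] has integral [- J],
   so that [L^j (X' rho_sal)] tends to [- J rho].  Take an accumulation point [p]
   of the critical orbit and [phi x = 1 + (x - p)^2].  Then [phi (c_j)] comes
   arbitrarily close to [1], whereas the integral of [phi rho] exceeds [1]; hence
   in none of the three series does the general term tend to [0]. *)

Require Import Defs.
From mathcomp Require Import all_boot all_order all_algebra.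
From mathcomp Require Import all_classical all_reals all_analysis.
From mathcomp Require Import measurable_realfun zify ring lra.

Set Implicit Arguments.
Unset Strict Implicit.
Unset Printing Implicit Defensive.

Import Order.TTheory GRing.Theory Num.Theory.
Import numFieldNormedType.Exports.

Local Open Scope classical_set_scope.
Local Open Scope ring_scope.

(* [lra] reads the whole context and compares atoms up to unfolding of local
   definitions; pruning first makes it much faster. *)
Ltac linear := solve
  [ repeat match goal with
    | x := _ |- _ => clearbody x
    | H : forall x, _ |- _ => clear H
    end; lra
  | lra ].

(** * Primitives and bounded variation *)

(** A priori [rho_reg] is a continuous function of bounded variation whose almost everywhere
    derivative might miss a singular part. The equation is therefore written for increments over
    [[x, y]], where [Omega] plays the role of a Stieltjes integral of [1 / |f'|]; uniqueness comes
    from contraction of the variation, which also sees singular parts. The additional factor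
    [1 / |f'|] gained by differentiating makes the new operator contract in L^1 as well as in
    variation, so a Neumann series solves the equation.

    The expansion constant may lie between [1] and [2], so the loss caused by cutting at branch ends
    cannot be absorbed at every step; this dictates the form of the Lasota-Yorke inequality.

    Exceptional sets are kept countable, and differentiability is replaced by second-order estimates
    on short intervals, which survive for functions of bounded variation.

    The test function has to be at least [1], for the first divergence, and to exceed [1] away from
    [p]: since [rho] is a bounded density, its mass cannot sit near [p], whence the strict
    inequality. *)

Section Subdivision.
Context {R : realType}.
Implicit Types (F psi Phi Psi : R -> R).

(** Increments of [Phi] are subadditive in absolute value and those of [Psi] additive, so an
    estimate on intervals of length at most [e] spreads by induction on the number of steps. *)
Lemma subdivision Phi Psi u t e : 0 < e ->
  (forall x y, u <= x -> x <= y -> y <= t -> y - x <= e ->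
     `|Phi y - Phi x| <= Psi y - Psi x) ->
  u <= t -> `|Phi t - Phi u| <= Psi t - Psi u.
Proof.
move=> e0 H ut.
have K n : forall x y, u <= x -> x <= y -> y <= t -> y - x <= n%:R * e ->
    `|Phi y - Phi x| <= Psi y - Psi x.
  elim: n => [|n IH] x y ux xy yt.
    by rewrite mul0r => yx; apply: H => //; linear.
  rewrite -natr1 mulrDl mul1r => yx.
  (* Peel off a last piece of length at most [e]; the maximum covers the case where [[x, y]] is
     already that short. *)
  pose z := Num.max x (y - e).
  have [xz yez zy] : [/\ x <= z, y - e <= z & z <= y].
    by rewrite /z !le_max ge_max !lexx xy orbT /=; split => //; linear.
  have zx : z - x <= n%:R * e.
    rewrite lerBlDr ge_max; apply/andP; split; last linear.
    by rewrite lerDr mulr_ge0// ltW.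
  have h1 := IH x z ux xz (le_trans zy yt) zx.
  have h2 : `|Phi y - Phi z| <= Psi y - Psi z by apply: H => //; linear.
  have -> : Phi y - Phi x = (Phi y - Phi z) + (Phi z - Phi x) by ring.
  by rewrite (le_trans (ler_normD _ _))//; linear.
pose n := (Num.truncn ((t - u) / e)).+1.
apply: (K n) => //; rewrite -ler_pdivrMr// ltW//.
by apply: truncnS_gt.
Qed.

(** Over a mesh [e] the increments add up to at most [e * (Psi t - Psi u)], and [e] is arbitrary.
    This replaces the principle that a zero derivative implies constancy; the changes of variables
    and integrations by parts below rest on it. *)
Lemma subdivision_quadratic Phi Psi u t :
  (forall x y, u <= x -> x <= y -> y <= t ->
     `|Phi y - Phi x| <= (y - x) * (Psi y - Psi x)) ->
  u <= t -> Phi t = Phi u.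
Proof.
move=> H ut; apply/eqP; rewrite -subr_eq0 -normr_le0.
have key e : 0 < e -> `|Phi t - Phi u| <= e * (Psi t - Psi u).
  move=> e0; rewrite mulrBr.
  apply: (@subdivision Phi (fun x => e * Psi x) u t e) => // x y ux xy yt yxe.
  rewrite -mulrBr (le_trans (H x y ux xy yt))//.
  (* For [x < y] the hypothesis itself forces [Psi x <= Psi y]. *)
  have [->|nxy] := eqVneq x y; first by rewrite !subrr !mulr0.
  have yx0 : 0 < y - x by rewrite subr_gt0 lt_neqAle nxy.
  rewrite ler_wpM2r// -(pmulr_rge0 _ yx0).
  exact: le_trans (normr_ge0 _) (H x y ux xy yt).
have [P0|P0] := leP (Psi t - Psi u) 0.
  by rewrite (le_trans (key 1 ltr01))// mul1r.
apply/ler_addgt0Pl => e e0; rewrite addr0.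
rewrite (le_trans (key (e / (Psi t - Psi u)) _)) ?divr_gt0//.
by rewrite divfK// gt_eqF.
Qed.

End Subdivision.

Section Primitive.
Context {R : realType}.
Notation mu := (@lebesgue_measure R).
Implicit Types (F psi : R -> R).

(** Boundedness on the whole line keeps the class closed under products and compositions and gives
    integrability on every bounded interval. *)
Definition nice psi :=
  measurable_fun [set: R] psi /\ exists M, forall x, `|psi x| <= M.

Lemma nice_bound psi : nice psi -> exists2 M, 0 < M & forall x, `|psi x| <= M.
Proof.
move=> [_ [M hM]]; exists (`|M| + 1); first by rewrite ltr_wpDl.
by move=> x; rewrite (le_trans (hM x))// (le_trans (ler_norm _))// lerDl.
Qed.

Lemma nice_cst k : nice (cst k).
Proof. by split; [exact: measurable_cst|exists `|k|]. Qed.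

Lemma niceD p q : nice p -> nice q -> nice (fun x => p x + q x).
Proof.
move=> [mp [M hM]] [mq [N hN]]; split; first exact: measurable_funD.
by exists (M + N) => x; rewrite (le_trans (ler_normD _ _))// lerD.
Qed.

Lemma niceM p q : nice p -> nice q -> nice (fun x => p x * q x).
Proof.
move=> [mp [M hM]] [mq [N hN]]; split; first exact: measurable_funM.
by exists (M * N) => x; rewrite normrM ler_pM.
Qed.

Lemma niceZ k p : nice p -> nice (fun x => k * p x).
Proof. by move=> np; apply: niceM => //; exact: nice_cst. Qed.

Lemma niceN p : nice p -> nice (fun x => - p x).
Proof.
move=> [mp [M hM]]; split; first exact: measurableT_comp.
by exists M => x; rewrite normrN.
Qed.

Lemma niceB p q : nice p -> nice q -> nice (fun x => p x - q x).
Proof. by move=> np nq; apply: niceD => //; exact: niceN. Qed.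

Lemma nice_norm p : nice p -> nice (fun x => `|p x|).
Proof.
move=> [mp [M hM]]; split; first exact: measurableT_comp.
by exists M => x; rewrite normr_id.
Qed.

Lemma nice_comp p g : nice p -> measurable_fun [set: R] g ->
  nice (fun x => p (g x)).
Proof.
move=> [mp [M hM]] mg; split; first exact: measurableT_comp.
by exists M => x.
Qed.

Lemma nice_indic (A : set R) : measurable A -> nice (fun x => \1_A x).
Proof.
move=> mA; split; first exact: measurable_indic.
by exists 1 => x; rewrite indicE; case: (x \in A); rewrite ?normr1 ?normr0.
Qed.

Lemma nice_integrable psi (a b : R) (x y : bool) : nice psi ->
  mu.-integrable [set` Interval (BSide x a) (BSide y b)] (EFin \o psi).
Proof.
move=> [mp [M hM]]; apply: measurable_bounded_integrable => //.
- rewrite /= lebesgue_measure_itv/=; case: ifP => // _.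
  by rewrite -EFinD ltry.
- exact: measurable_funS mp.
- by exists M; split; rewrite ?num_real// => N MN z _ /=; rewrite (le_trans (hM z))// ltW.
Qed.

(* Vanishes for [t <= a], where the interval is empty. *)
Definition prim (a : R) psi t : R := \int[mu]_(x in `[a, t[) psi x.

Lemma prim_base a psi : prim a psi a = 0.
Proof. by rewrite /prim set_itvco0 Rintegral_set0. Qed.

Lemma primE a psi u t : nice psi -> a <= u -> u <= t ->
  prim a psi t - prim a psi u = \int[mu]_(x in `]u, t[) psi x.
Proof.
move=> np au ut; rewrite /prim (@itv_bndbnd_setU _ _ _ (BLeft u)) ?bnd_simp//.
rewrite Rintegral_setU//.
- by rewrite addrC addKr Rintegral_itv_obnd_cbnd//; exact: nice_integrable.
- rewrite -itv_bndbnd_setU ?bnd_simp//; exact: nice_integrable.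
- apply/disj_setPS => x [] /=; rewrite !in_itv/= => /andP[_ xu] /andP[ux _].
  by move: (lt_le_trans xu ux); rewrite ltxx.
Qed.

Lemma prim_le a p q u t : nice p -> nice q -> a <= u -> u <= t ->
  (forall x, u < x -> x < t -> p x <= q x) ->
  prim a p t - prim a p u <= prim a q t - prim a q u.
Proof.
move=> np nq au ut H; rewrite !primE//; apply: le_Rintegral => //.
- exact: nice_integrable.
- exact: nice_integrable.
- by move=> x /=; rewrite in_itv/= => /andP[]; exact: H.
Qed.

Lemma prim_eq a p q u t : nice p -> nice q -> a <= u -> u <= t ->
  (forall x, u < x -> x < t -> p x = q x) ->
  prim a p t - prim a p u = prim a q t - prim a q u.
Proof.
by move=> np nq au ut H; apply/eqP; rewrite eq_le !prim_le// => x ux xt;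
  rewrite H.
Qed.

Lemma prim_cst a k u t : a <= u -> u <= t ->
  prim a (cst k) t - prim a (cst k) u = k * (t - u).
Proof.
move=> au ut; rewrite primE//; last exact: nice_cst.
rewrite Rintegral_cst//= lebesgue_measure_itv/= lte_fin.
by move: ut; rewrite le_eqVlt => /orP[/eqP->|->//]; rewrite ltxx subrr.
Qed.

Lemma primD a p q t : nice p -> nice q ->
  prim a (fun x => p x + q x) t = prim a p t + prim a q t.
Proof. by move=> np nq; rewrite /prim RintegralD//; exact: nice_integrable. Qed.

Lemma primZ a k p t : nice p -> prim a (fun x => k * p x) t = k * prim a p t.
Proof. by move=> np; rewrite /prim RintegralZl//; exact: nice_integrable. Qed.

Lemma primB a p q t : nice p -> nice q ->
  prim a (fun x => p x - q x) t = prim a p t - prim a q t.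
Proof. by move=> np nq; rewrite /prim RintegralB//; exact: nice_integrable. Qed.

Lemma prim_norm a p u t : nice p -> a <= u -> u <= t ->
  `|prim a p t - prim a p u| <=
    prim a (fun x => `|p x|) t - prim a (fun x => `|p x|) u.
Proof.
move=> np au ut; rewrite !primE//; last exact: nice_norm.
by apply: le_normr_Rintegral => //; exact: nice_integrable.
Qed.

Lemma prim_lip a p u t M : nice p -> a <= u -> u <= t ->
  (forall x, u < x -> x < t -> `|p x| <= M) ->
  `|prim a p t - prim a p u| <= M * (t - u).
Proof.
move=> np au ut H; rewrite (le_trans (prim_norm np au ut))//.
rewrite -(@prim_cst a M)//; apply: prim_le => //; first exact: nice_norm.
exact: nice_cst.
Qed.

(** When [k] is a value of [p] inside the interval, the error is oscillation times length: the
    second-order form that [subdivision_quadratic] asks for. *)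
Lemma prim_near a p u t k e : nice p -> a <= u -> u <= t ->
  (forall x, u < x -> x < t -> `|p x - k| <= e) ->
  `|prim a p t - prim a p u - k * (t - u)| <= e * (t - u).
Proof.
move=> np au ut H; rewrite -(@prim_cst a k)//.
have -> : prim a p t - prim a p u - (prim a (cst k) t - prim a (cst k) u) =
  prim a (fun x => p x - cst k x) t - prim a (fun x => p x - cst k x) u.
  by rewrite !primB//; [ring|exact: nice_cst..].
by apply: prim_lip => //; apply: niceB => //; exact: nice_cst.
Qed.

Lemma prim_ge0 a p u t : nice p -> a <= u -> u <= t ->
  (forall x, u < x -> x < t -> 0 <= p x) -> prim a p u <= prim a p t.
Proof.
move=> np au ut H; rewrite -subr_ge0 primE//.
by apply: Rintegral_ge0 => x /=; rewrite in_itv/= => /andP[]; exact: H.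
Qed.

Lemma prim_out a p t : t <= a -> prim a p t = 0.
Proof.
by move=> ta; rewrite /prim set_itv_ge ?Rintegral_set0// bnd_simp -leNgt.
Qed.

Lemma prim_homo a p : nice p -> (forall x, 0 <= p x) ->
  {homo prim a p : x y / x <= y}.
Proof.
move=> np p0 x y xy; have [ax|xa] := leP a x; first exact: prim_ge0.
rewrite (prim_out _ (ltW xa)); exact: Rintegral_ge0.
Qed.

(** The endpoints are unordered because a decreasing branch exchanges them. *)
Lemma prim_near_sym a p x y k e : nice p -> a <= x -> a <= y ->
  (forall z, Num.min x y < z -> z < Num.max x y -> `|p z - k| <= e) ->
  `|prim a p y - prim a p x - k * (y - x)| <= e * `|y - x|.
Proof.
move=> np ax ay; have [xy|/ltW yx] := leP x y => H.
  by rewrite (ger0_norm (x := y - x)) ?subr_ge0//; apply: prim_near.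
rewrite [`|y - x|]distrC (ger0_norm (x := x - y)) ?subr_ge0// distrC.
have -> : k * (y - x) - (prim a p y - prim a p x) =
  prim a p x - prim a p y - k * (x - y) by ring.
by apply: prim_near.
Qed.

Lemma nice_cut p x y : nice p -> nice (fun z => if x < z < y then p z else 0).
Proof.
move=> np; have -> : (fun z => if x < z < y then p z else 0) =
    (fun z => \1_`]x, y[%classic z * p z).
  apply/funext => z; rewrite indicE; have -> : (z \in `]x, y[%classic) = (x < z < y).
    by apply/idP/idP; rewrite inE/= in_itv.
  by case: ifP => _; rewrite ?mul1r ?mul0r.
by apply: niceM => //; apply: nice_indic.
Qed.

End Primitive.

(** * Functions of bounded variation on the line *)

Section BoundedVariation.
Context {R : realType}.
Implicit Types (F psi : R -> R).

(* A nondecreasing control [F] replaces the variation function of [psi]. *)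
Definition gctrl psi F := forall x y, x <= y -> `|psi y - psi x| <= F y - F x.

(** This bounds the variation over the whole line: for a function cut off to an interval, the jumps
    at both ends count. *)
Definition varle psi (V : R) :=
  exists2 F, gctrl psi F & forall x y, F y - F x <= V.

Lemma gctrl_homo psi F : gctrl psi F -> {homo F : x y / x <= y}.
Proof.
move=> H x y xy; rewrite -subr_ge0; exact: le_trans (normr_ge0 _) (H _ _ xy).
Qed.

Lemma varle_osc psi V x y : varle psi V -> `|psi y - psi x| <= V.
Proof.
move=> [F cF bF]; have [xy|/ltW yx] := leP x y; first exact: le_trans (cF _ _ xy) _.
by rewrite distrC (le_trans (cF _ _ yx)).
Qed.

Lemma varle_ge0 psi V : varle psi V -> 0 <= V.
Proof. by move=> /(varle_osc 0 0); rewrite subrr normr0. Qed.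

Lemma varleW psi V W : V <= W -> varle psi V -> varle psi W.
Proof. by move=> VW [F cF bF]; exists F => // x y; rewrite (le_trans _ VW). Qed.

Lemma varle_nice psi V : varle psi V -> nice psi.
Proof.
move=> vp; split; last first.
  exists (`|psi 0| + V) => x; have -> : psi x = psi 0 + (psi x - psi 0) by ring.
  by rewrite (le_trans (ler_normD _ _))// lerD2l varle_osc.
case: vp => F cF _; have hF := gctrl_homo cF.
(* Jordan decomposition: [F] and [F - psi] are both nondecreasing. *)
have -> : psi = (fun x => F x - (F x - psi x)) by apply/funext => x; ring.
apply: measurable_funB; apply: nondecreasing_measurable => // x y xy.
have := cF _ _ xy; rewrite ler_norml; linear.
Qed.

Lemma varleD psi chi V W : varle psi V -> varle chi W ->
  varle (fun x => psi x + chi x) (V + W).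
Proof.
move=> [F cF bF] [G cG bG]; exists (fun x => F x + G x) => [x y xy|x y].
  have -> : psi y + chi y - (psi x + chi x) = (psi y - psi x) + (chi y - chi x).
    by ring.
  rewrite (le_trans (ler_normD _ _))//; have := cF _ _ xy; have := cG _ _ xy; linear.
by have := bF x y; have := bG x y; linear.
Qed.

Lemma varleZ psi V k : varle psi V -> varle (fun x => k * psi x) (`|k| * V).
Proof.
move=> [F cF bF]; exists (fun x => `|k| * F x) => [x y xy|x y].
  by rewrite -!mulrBr normrM ler_wpM2l//; exact: cF.
by rewrite -mulrBr ler_wpM2l.
Qed.

Lemma varle_norm psi V : varle psi V -> varle (fun x => `|psi x|) V.
Proof.
move=> [F cF bF]; exists F => // x y xy.
by rewrite (le_trans (ler_dist_dist _ _))// cF.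
Qed.

Lemma varleM psi chi V W M N : (forall x, `|psi x| <= M) ->
  (forall x, `|chi x| <= N) -> varle psi V -> varle chi W ->
  varle (fun x => psi x * chi x) (N * V + M * W).
Proof.
move=> hM hN [F cF bF] [G cG bG].
have M0 : 0 <= M by exact: le_trans (normr_ge0 _) (hM 0).
have N0 : 0 <= N by exact: le_trans (normr_ge0 _) (hN 0).
exists (fun x => N * F x + M * G x) => [x y xy|x y].
  have -> : psi y * chi y - psi x * chi x =
    chi y * (psi y - psi x) + psi x * (chi y - chi x) by ring.
  have -> : N * F y + M * G y - (N * F x + M * G x) =
    N * (F y - F x) + M * (G y - G x) by ring.
  by rewrite (le_trans (ler_normD _ _))// !normrM lerD// ler_pM//; [exact: cF|exact: cG].
have -> : N * F y + M * G y - (N * F x + M * G x) =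
  N * (F y - F x) + M * (G y - G x) by ring.
by rewrite lerD// ler_wpM2l.
Qed.

Definition clamp (p q x : R) : R := Num.max p (Num.min x q).

Lemma clamp_homo p q : {homo clamp p q : x y / x <= y}.
Proof. by move=> x y xy; rewrite /clamp; exact: (le_max2 (lexx _) (le_min2 xy (lexx _))). Qed.

Lemma clamp_in p q x : p <= q -> p <= clamp p q x <= q.
Proof. by move=> pq; rewrite /clamp le_max lexx ge_max pq ge_min lexx orbT. Qed.

Lemma clamp_id p q x : p <= x -> x <= q -> clamp p q x = x.
Proof. by move=> px xq; rewrite /clamp (min_idPl xq) (max_idPr px). Qed.

Lemma clamp_l p q x : p <= q -> x <= p -> clamp p q x = p.
Proof. by move=> pq xp; rewrite /clamp; apply/max_idPl; rewrite ge_min xp. Qed.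

Lemma clamp_r p q x : p <= q -> q <= x -> clamp p q x = q.
Proof. by move=> pq qx; rewrite /clamp (min_idPr qx) (max_idPr pq). Qed.

Lemma varle_cut al be psi F (M : R) : al < be -> 0 <= M ->
  {homo F : x y / x <= y} ->
  (forall x, ~~ (al < x < be) -> psi x = 0) ->
  (forall x, `|psi x| <= M) ->
  (forall x y, al < x -> x <= y -> y < be -> `|psi y - psi x| <= F y - F x) ->
  varle psi (F be - F al + 2 * M).
Proof.
move=> ab M0 hF out hM cF.
(* The control is frozen outside [[al, be]] and receives two jumps of height [M], one just after
   [al] and one at [be], because [psi] vanishes at both points. *)
pose st (p : bool) : R := if p then 1 else 0.
exists (fun x => F (clamp al be x) + M * st (al < x) + M * st (be <= x)) => [x y xy|x y].
  have hc : F (clamp al be x) <= F (clamp al be y) by exact/hF/clamp_homo.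
  have [xa|ax] := leP x al.
    rewrite (out x) ?ltNge ?xa// subr0.
    have [xb|bx] := ltP x be; last by have := lt_le_trans ab bx; rewrite ltNge xa.
    rewrite /st.
    have [ya|ay] := leP y al.
      have -> : (be <= y) = false by apply/negbTE; rewrite -ltNge (le_lt_trans ya).
      by rewrite (out y) ?ltNge ?ya// normr0 /=; linear.
    by rewrite /=; have := hM y; case: ifP => _; linear.
  have ay := lt_le_trans ax xy.
  rewrite /st ay.
  have [yb|by_] := ltP y be.
    have xb := le_lt_trans xy yb.
    rewrite (lt_geF xb); have := cF _ _ ax xy yb.
    by rewrite /= (clamp_id (ltW ax) (ltW xb)) (clamp_id (ltW ay) (ltW yb)); linear.
  rewrite (out y); last by apply/negP => /andP[_]; rewrite ltNge by_.
  rewrite sub0r normrN /=.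
  have [xb|bx] := ltP x be; first by have := hM x; linear.
  by rewrite (out x) ?ltNge ?bx ?andbF// normr0 /=; linear.
have hb z : F al <= F (clamp al be z) <= F be.
  by have /andP[? ?] := @clamp_in al be z (ltW ab); rewrite !hF.
have hs (p : bool) : 0 <= st p <= 1 by case: p; rewrite /st ?lexx ler01.
have := hb x; have := hb y.
have k1 p : 0 <= M * st p <= M.
  have /andP[? ?] := hs p; rewrite mulr_ge0//=.
  by rewrite -[leRHS]mulr1 ler_wpM2l.
have := k1 (al < x); have := k1 (al < y); have := k1 (be <= x); have := k1 (be <= y).
linear.
Qed.

Lemma varle_cutoff al be psi V M : al < be ->
  (forall x, `|psi x| <= M) -> varle psi V ->
  varle (fun x => if al < x < be then psi x else 0) (V + 2 * M).
Proof.
move=> ab hM [F cF bF].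
have M0 : 0 <= M by exact: le_trans (normr_ge0 _) (hM 0).
apply: (@varleW _ (F be - F al + 2 * M)); first by rewrite lerD2r.
apply: varle_cut => //.
- exact: gctrl_homo cF.
- by move=> x /negbTE ->.
- by move=> x; case: ifP => _ //; rewrite normr0.
- move=> x y ax xy yb; rewrite ax (lt_le_trans ax xy) yb (le_lt_trans xy yb) /=.
  exact: cF.
Qed.

Lemma homo_lim_right F x : {homo F : x y / x <= y} -> cvg (F y @[y --> x^'+]).
Proof.
move=> hF; apply: nondecreasing_at_right_is_cvgr.
  by near=> z => u v _ _; exact: hF.
near=> z; exists (F x) => _ /= [u + <-]; rewrite in_itv/= => /andP[xu _].
exact/hF/ltW.
Unshelve. all: by end_near. Qed.

Lemma homo_lim_left F x : {homo F : x y / x <= y} -> cvg (F y @[y --> x^'-]).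
Proof.
move=> hF; apply: nondecreasing_at_left_is_cvgr.
  by near=> z => u v _ _; exact: hF.
near=> z; exists (F x) => _ /= [u + <-]; rewrite in_itv/= => /andP[_ xu].
exact/hF/ltW.
Unshelve. all: by end_near. Qed.

Lemma varle_lim_right psi V x : varle psi V -> cvg (psi y @[y --> x^'+]).
Proof.
move=> [F cF _]; have hF := gctrl_homo cF.
have -> : psi = (fun x => F x - (F x - psi x)) by apply/funext => y; ring.
apply: is_cvgB; apply: homo_lim_right => // u v uv.
have := cF _ _ uv; rewrite ler_norml; linear.
Qed.

Lemma varle_lim_left psi V x : varle psi V -> cvg (psi y @[y --> x^'-]).
Proof.
move=> [F cF _]; have hF := gctrl_homo cF.
have -> : psi = (fun x => F x - (F x - psi x)) by apply/funext => y; ring.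
apply: is_cvgB; apply: homo_lim_left => // u v uv.
have := cF _ _ uv; rewrite ler_norml; linear.
Qed.

Lemma homo_continuous F x : {homo F : x y / x <= y} -> ~ discontinuity F x ->
  {for x, continuous F}.
Proof.
move=> hF nd; have cl : cvg (F y @[y --> x^'-]) by exact: homo_lim_left.
have cr : cvg (F y @[y --> x^'+]) by exact: homo_lim_right.
have lr : lim (F y @[y --> x^'-]) = lim (F y @[y --> x^'+]).
  by apply/eqP; apply: contrapT => /negP h; apply: nd; split.
have l1 : lim (F y @[y --> x^'-]) <= F x.
  apply: limr_le => //; near=> y; apply: hF; near: y; exact: nbhs_left_le.
have l2 : F x <= lim (F y @[y --> x^'+]).
  apply: limr_ge => //; near=> y; apply: hF; near: y; exact: nbhs_right_ge.
have e1 : lim (F y @[y --> x^'-]) = F x by apply/eqP; rewrite eq_le l1 lr l2.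
apply/left_right_continuousP; split.
  by rewrite -[X in _ --> X]e1.
by rewrite -[X in _ --> X]e1 lr.
Unshelve. all: by end_near. Qed.

(** [psi] is continuous wherever its control is, and a monotone control has countably many jumps on
    each bounded interval. *)
Lemma varle_countable_discontinuity psi V : varle psi V ->
  countable [set x | ~ {for x, continuous psi}].
Proof.
move=> [F cF _]; have hF := gctrl_homo cF.
apply: (@sub_countable _ _ _
  (\bigcup_(n in [set: nat]) [set x | x \in (`]-n%:R, n%:R[ : interval R) /\ discontinuity F x])).
  apply: subset_card_le => x /= nc.
  exists (Num.truncn `|x|).+1 => //=; split.
    by rewrite in_itv/= -ltr_norml truncnS_gt.
  apply: contrapT => nd; apply: nc; have := homo_continuous hF nd.
  move=> /cvgrPdist_le cFx; apply/cvgrPdist_le => e e0.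
  near=> y; have Fy : `|F x - F y| <= e by near: y; exact: cFx.
  have [xy|/ltW yx] := leP x y.
    rewrite distrC (le_trans (cF _ _ xy))// (le_trans (ler_norm _))//.
    by rewrite distrC.
  by rewrite (le_trans (cF _ _ yx))// (le_trans (ler_norm _)).
apply: bigcup_countable => // n _; apply: discontinuity_countable.
by move=> x y _ _; exact: hF.
Unshelve. all: by end_near. Qed.

End BoundedVariation.

(** * Transfer operators *)

Section Branch.
Context {R : realType}.
Implicit Types (F psi chi : R -> R).

(* [f] maps [[al, be]] onto [[a, d]] monotonically, with orientation [s] and
   inverse [g] (extended to the whole line); [v] is [1 / |f'|]. *)
Record branch (a d : R) (f : R -> R) (al be s : R) (v g : R -> R)
    (l r K : R) : Prop := Branch {
  br_lt : al < be;
  br_a : a <= al;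
  br_s : s = 1 \/ s = -1;
  br_l : 0 < l;
  br_r : r < 1;
  br_v : forall y, al < y -> y < be -> l <= v y <= r;
  br_mvt : forall u t, al <= u -> u < t -> t <= be ->
    exists2 xi, u < xi < t & s * (f t - f u) * v xi = t - u;
  br_lip : forall x y, al < x -> x <= y -> y < be -> `|v y - v x| <= K * (y - x);
  br_g : forall x, al <= g x <= be;
  br_gf : forall t, al <= t -> t <= be -> g (f t) = t;
  br_fg : forall x, a <= x -> x <= d -> f (g x) = x;
  br_gmono : forall x y, x <= y -> s * g x <= s * g y;
  br_f : forall t, al <= t -> t <= be -> a <= f t <= d;
  br_fal : f al = a \/ f al = d;
  br_fbe : f be = a \/ f be = d
}.

Context {a d al be s l r K : R} {f v g : R -> R}.
Hypothesis B : branch a d f al be s v g l r K.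

Lemma br_ss : s * s = 1.
Proof. by case: (br_s B) => ->; ring. Qed.

Lemma br_ns : `|s| = 1.
Proof. by case: (br_s B) => ->; rewrite ?normrN normr1. Qed.

Lemma br_r0 : 0 < r.
Proof.
have al_be := br_lt B; have /andP[h1 h2] : l <= v ((al + be) / 2) <= r.
  by apply: (br_v B); linear.
by have := br_l B; linear.
Qed.

Lemma br_K0 : 0 <= K.
Proof.
have ab := br_lt B.
have := @br_lip _ _ _ _ _ _ _ _ _ _ _ B ((2 * al + be) / 3) ((al + be) / 2).
have h (p q r' : Prop) : p -> (p -> q) -> q by move=> ? ?; auto.
move=> H; have {}H := H ltac:(linear) ltac:(linear) ltac:(linear).
have := le_trans (normr_ge0 _) H.
by rewrite pmulr_lge0//; linear.
Qed.

Lemma br_in x : a < x -> x < d -> al < g x < be.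
Proof.
move=> ax xd; have /andP[g1 g2] := br_g B x.
have fx := br_fg B (ltW ax) (ltW xd).
rewrite !lt_neqAle g1 g2 !andbT; apply/andP; split; apply/eqP => e.
  by case: (br_fal B); rewrite e fx => xx; move: ax xd; rewrite xx ltxx.
by case: (br_fbe B); rewrite -e fx => xx; move: ax xd; rewrite xx ltxx.
Qed.

Lemma br_expand u t : al <= u -> u <= t -> t <= be ->
  t - u <= r * (s * (f t - f u)) /\ l * (s * (f t - f u)) <= t - u.
Proof.
move=> alu; rewrite le_eqVlt => /orP[/eqP->|ut] tbe.
  by rewrite !subrr !mulr0.
have [xi /andP[uxi xit] e] := br_mvt B alu ut tbe.
have /andP[v1 v2] := br_v B (le_lt_trans alu uxi) (lt_le_trans xit tbe).
have l0 := br_l B; have v0 : 0 < v xi by linear.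
have D0 : 0 <= s * (f t - f u).
  by rewrite -(pmulr_lge0 _ v0) e subr_ge0 ltW.
by rewrite -e; split; [rewrite [leLHS]mulrC|rewrite [leRHS]mulrC]; rewrite ler_wpM2r.
Qed.

Lemma br_f_norm u t : al <= u -> u <= t -> t <= be ->
  `|f t - f u| = s * (f t - f u).
Proof.
move=> alu ut tbe; have [h1 h2] := br_expand alu ut tbe.
have D0 : 0 <= s * (f t - f u).
  by rewrite -(pmulr_rge0 _ br_r0); linear.
by rewrite -(ger0_norm D0) normrM br_ns mul1r.
Qed.

Lemma br_glip x y : a <= x -> x <= y -> y <= d ->
  `|g y - g x| <= r * (y - x).
Proof.
move=> ax xy yd; have := br_gmono B xy.
have fx := br_fg B ax (le_trans xy yd); have fy := br_fg B (le_trans ax xy) yd.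
have /andP[gx1 gx2] := br_g B x; have /andP[gy1 gy2] := br_g B y.
case: (br_s B) => se; rewrite se ?mul1r ?mulN1r ?lerN2 => gxy.
  have [h _] := br_expand gx1 gxy gy2.
  by rewrite fx fy se mul1r in h; rewrite ger0_norm ?subr_ge0.
have [h _] := br_expand gy1 gxy gx2.
rewrite fx fy se in h; rewrite distrC ger0_norm ?subr_ge0//.
by rewrite (le_trans h)// mulN1r opprB.
Qed.

Lemma br_gstrict x y : a <= x -> x < y -> y <= d -> s * g x < s * g y.
Proof.
move=> ax xy yd; rewrite lt_neqAle (br_gmono B) ?ltW// andbT.
apply/eqP => /(congr1 ( *%R s)); rewrite !mulrA br_ss !mul1r => e.
have := br_fg B ax (ltW (lt_le_trans xy yd)).
rewrite e (br_fg B (le_trans ax (ltW xy)) yd) => xx.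
by move: xy; rewrite xx ltxx.
Qed.

Lemma br_g_measurable : measurable_fun [set: R] g.
Proof.
have -> : g = (fun x => s * (s * g x)) by apply/funext => x; rewrite mulrA br_ss mul1r.
apply: measurable_funM => //; apply: nondecreasing_measurable => // x y.
exact: (br_gmono B).
Qed.

(** The contribution of one branch to a transfer operator, the weight being part of [chi]. The ends
    [a] and [d] are dropped, which is harmless modulo countable sets. *)
Definition transfer chi x := if a < x < d then chi (g x) else 0.

Lemma transfer_nice chi : nice chi -> nice (transfer chi).
Proof.
move=> nc; apply: (@nice_cut _ (fun x => chi (g x))).
by apply: nice_comp => //; exact: br_g_measurable.
Qed.

(** Change of variables [x = f z] on one branch. On a short interval both integrals are compared
    with the value of [chi] at the midpoint times a length, and the mean value property of [f] links
    the two lengths; all errors are of second order. *)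
Lemma transfer_prim chi V u t : nice v -> varle chi V ->
  al <= u -> u <= t -> t <= be ->
  prim a (transfer (fun y => v y * chi y)) (f t) -
  prim a (transfer (fun y => v y * chi y)) (f u) =
  s * (prim a chi t - prim a chi u).
Proof.
move=> nv vc; have nc := varle_nice vc; case: vc => F cF _.
have nT : nice (transfer (fun y => v y * chi y)).
  by apply: transfer_nice; apply: niceM.
have [M M0 hM] := nice_bound nc; have hF := gctrl_homo cF.
move=> alu ut tbe.
have l0 := br_l B; have r0 := br_r0; have K0 := br_K0.
set T := transfer _ in nT *.
pose Phi x := prim a T (f x) - s * prim a chi x.
suff -> : prim a T (f t) - prim a T (f u) =
  Phi t - Phi u + s * (prim a chi t - prim a chi u).
  (* The multiple of [F] pays for the oscillation of [chi] under both integrals. The linear term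
     pays for the oscillation of [v], once under the integral and once in the mean value
     property. *)
  rewrite (@subdivision_quadratic _ Phi
    (fun x => (1 + r / l) * F x + 2 * (M * K / l) * x) u t) //.
    by rewrite subrr add0r.
  move=> x y ux; rewrite le_eqVlt => /orP[/eqP->|xy] yt.
    by rewrite !subrr normr0 mul0r.
  have ax : a <= x by rewrite (le_trans (br_a B))// (le_trans alu).
  have alx := le_trans alu ux; have ybe := le_trans yt tbe.
  (* An interior point, since [v] is controlled on the open domain of the branch. *)
  pose m := (x + y) / 2.
  have [xm my] : x < m /\ m < y by rewrite /m; split; linear.
  pose k := chi m.
  have near z : x < z -> z < y -> `|chi z - k| <= F y - F x.
    move=> xz zy; have [mz|/ltW zm] := leP m z.
      rewrite (le_trans (cF _ _ mz))// lerB// hF ?ltW//.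
    by rewrite distrC (le_trans (cF _ _ zm))// lerB// hF ?ltW.
  have h1 : `|prim a chi y - prim a chi x - k * (y - x)| <= (F y - F x) * (y - x).
    by apply: prim_near => //; exact: ltW.
  have /andP[fx1 fx2] := br_f B alx (ltW (lt_le_trans xy ybe)).
  have /andP[fy1 fy2] := br_f B (le_trans alx (ltW xy)) ybe.
  have nfE := br_f_norm alx (ltW xy) ybe.
  have dF0 : 0 <= F y - F x by rewrite subr_ge0 hF// ltW.
  have yx0 : 0 <= y - x by linear.
  have alm := le_lt_trans alx xm; have mbe := lt_le_trans my ybe.
  have /andP[vm1 vm2] := br_v B alm mbe.
  have h2 : `|prim a T (f y) - prim a T (f x) - (v m * k) * (f y - f x)| <=
      (r * (F y - F x) + M * (K * (y - x))) * `|f y - f x|.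
    apply: prim_near_sym => // z; rewrite gt_min lt_max => z1 z2.
    have [az zd] : a < z /\ z < d.
      by split; [case/orP: z1 => h; exact: le_lt_trans h
                |case/orP: z2 => h; exact: lt_le_trans h _].
    rewrite /T /transfer az zd /=.
    have /andP[gz1 gz2] : x < g z < y.
      have fgz := br_fg B (ltW az) (ltW zd).
      have /andP[ga gb] := br_g B z.
      have gx := br_gf B alx (ltW (lt_le_trans xy ybe)).
      have gy := br_gf B (le_trans alx (ltW xy)) ybe.
      case: (br_s B) => se.
        have fxy : f x <= f y.
          by have := normr_ge0 (f y - f x); rewrite nfE se mul1r subr_ge0.
        have {}z1 : f x < z by case/orP: z1 => // h; exact: le_lt_trans h.
        have {}z2 : z < f y by case/orP: z2 => // h; exact: lt_le_trans h _.
        have := br_gstrict fx1 z1 (ltW zd); have := br_gstrict (ltW az) z2 fy2.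
        by rewrite gx gy se !mul1r => -> ->.
      have fxy : f y <= f x.
        by have := normr_ge0 (f y - f x); rewrite nfE se mulN1r opprB subr_ge0.
      have {}z1 : f y < z by case/orP: z1 => // h; exact: le_lt_trans h.
      have {}z2 : z < f x by case/orP: z2 => // h; exact: lt_le_trans h _.
      have := br_gstrict fy1 z1 (ltW zd); have := br_gstrict (ltW az) z2 fx2.
      by rewrite gx gy se !mulN1r !ltrN2 => -> ->.
    have -> : v (g z) * chi (g z) - v m * k =
      v (g z) * (chi (g z) - k) + k * (v (g z) - v m) by ring.
    have algz := le_lt_trans alx gz1; have gzbe := lt_le_trans gz2 ybe.
    have /andP[vg1 vg2] := br_v B algz gzbe.
    rewrite (le_trans (ler_normD _ _))// !normrM lerD//.
      apply: ler_pM => //; last exact: near.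
      by rewrite ger0_norm//; linear.
    apply: ler_pM => //; first exact: hM.
    have [gm|/ltW mg] := leP (g z) m.
      rewrite distrC (le_trans (br_lip B algz gm mbe))// ler_wpM2l//; linear.
    by rewrite (le_trans (br_lip B alm mg gzbe))// ler_wpM2l//; linear.
  have [e1 e2] := br_expand alx (ltW xy) ybe.
  rewrite -nfE in e1 e2.
  have nf2 : `|f y - f x| <= (y - x) / l by rewrite ler_pdivlMr// mulrC.
  have h3 : `|v m * k * (s * (f y - f x)) - k * (y - x)| <= M * (K * (y - x)) * ((y - x) / l).
    have [xi /andP[x1 x2] e] := br_mvt B alx xy ybe.
    have -> : v m * k * (s * (f y - f x)) - k * (y - x) =
       k * (v m - v xi) * (s * (f y - f x)) by rewrite -e; ring.
    rewrite !normrM br_ns mul1r; apply: ler_pM => //.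
    apply: ler_pM => //; first exact: hM.
    have alxi := le_lt_trans alx x1; have xibe := lt_le_trans x2 ybe.
    have [gm|/ltW mg] := leP xi m.
      rewrite (le_trans (br_lip B alxi gm mbe))// ler_wpM2l//; linear.
    by rewrite distrC (le_trans (br_lip B alm mg xibe))// ler_wpM2l//; linear.
  have -> : Phi y - Phi x =
    (prim a T (f y) - prim a T (f x) - v m * k * (f y - f x)) -
    s * (prim a chi y - prim a chi x - k * (y - x)) +
    s * (v m * k * (s * (f y - f x)) - k * (y - x)).
    have e3 : s * (v m * k * (s * (f y - f x))) = v m * k * (f y - f x).
      by rewrite -[RHS]mul1r -br_ss; ring.
    by rewrite [s * (v m * k * _ - _)]mulrBr e3 /Phi; ring.
  rewrite (le_trans (ler_normD _ _))//.
  rewrite (le_trans (lerD (ler_normB _ _) (lexx _)))//.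
  rewrite !(normrM s) br_ns !mul1r.
  have h2' : (r * (F y - F x) + M * (K * (y - x))) * `|f y - f x| <=
      (r * (F y - F x) + M * (K * (y - x))) * ((y - x) / l).
    rewrite ler_wpM2l// addr_ge0 ?mulr_ge0//; linear.
  have -> : (y - x) * ((1 + r / l) * F y + 2 * (M * K / l) * y -
      ((1 + r / l) * F x + 2 * (M * K / l) * x)) =
    (r * (F y - F x) + M * (K * (y - x))) * ((y - x) / l) +
    (F y - F x) * (y - x) + M * (K * (y - x)) * ((y - x) / l) by ring.
  by rewrite !lerD// (le_trans h2).
rewrite /Phi; ring.
Qed.

End Branch.

(** * Variation of a weighted function along one branch *)

Section BranchVariation.
Context {R : realType}.
Implicit Types (F psi chi w : R -> R).

Lemma sup_le_average a al be psi F x : a <= al -> al < be -> nice psi ->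
  {homo F : x y / x <= y} ->
  (forall x y, al < x -> x <= y -> y < be -> `|psi y - psi x| <= F y - F x) ->
  al < x < be ->
  `|psi x| <= (F be - F al) + (be - al)^-1 *
     (prim a (fun y => `|psi y|) be - prim a (fun y => `|psi y|) al).
Proof.
move=> aal ab np hF cF /andP[ax xb].
have near z : al < z -> z < be -> `| `|psi z| - `|psi x| | <= F be - F al.
  move=> az zb; rewrite (le_trans (ler_dist_dist _ _))//.
  have [xz|/ltW zx] := leP x z.
    rewrite (le_trans (cF _ _ ax xz zb))// lerB// hF// ltW//.
  by rewrite distrC (le_trans (cF _ _ az zx xb))// lerB// hF// ltW.
have := @prim_near _ a _ al be _ _ (nice_norm np) aal (ltW ab) near.
set D := prim a _ be - _ => H.
have ba : 0 < be - al by rewrite subr_gt0.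
have -> : F be - F al + (be - al)^-1 * D = ((F be - F al) * (be - al) + D) / (be - al).
  by rewrite mulrDl mulfK ?gt_eqF// [_^-1 * D]mulrC.
rewrite ler_pdivlMr//; move: H; rewrite ler_norml => /andP[+ _]; linear.
Qed.

Lemma prim_abs_mul a psi F u t : a <= u -> u <= t -> nice psi ->
  (forall z, u < z -> z < t -> `|psi z - psi u| <= F t - F u) ->
  (t - u) * `|psi u| <= (prim a (fun y => `|psi y|) t - prim a (fun y => `|psi y|) u)
    + (t - u) * (F t - F u).
Proof.
move=> au ut np H.
have near z : u < z -> z < t -> `| `|psi z| - `|psi u| | <= F t - F u.
  by move=> h1 h2; rewrite (le_trans (ler_dist_dist _ _))// H.
have := @prim_near _ a _ u t _ _ (nice_norm np) au ut near.
by rewrite ler_norml => /andP[+ _]; linear.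
Qed.

(* The variation of [w] is paid for by the integral of [psi]: on short
   intervals [psi] is almost constant. *)
Lemma weighted_variation a w W L kap psi F u t : 0 <= L -> W < kap -> a <= u ->
  u <= t -> nice psi -> {homo F : x y / x <= y} ->
  (forall y, `|w y| <= W) ->
  (forall x y, u <= x -> x <= y -> y <= t -> `|w y - w x| <= L * (y - x)) ->
  (forall x y, u <= x -> x <= y -> y <= t -> `|psi y - psi x| <= F y - F x) ->
  `|w t * psi t - w u * psi u| <= (kap * F t + L * prim a (fun y => `|psi y|) t)
    - (kap * F u + L * prim a (fun y => `|psi y|) u).
Proof.
move=> L0 Wk au ut np hF wW wL cF.
have W0 : 0 <= W by exact: le_trans (normr_ge0 _) (wW 0).
(* On pieces of length [e] the second-order term [L * (y - x) * (F y - F x)] fits into the room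
   between [W] and [kap]; the [1] keeps the denominator positive. *)
pose e := (kap - W) / (L + 1).
have e0 : 0 < e by rewrite divr_gt0// ?subr_gt0//; linear.
apply: (@subdivision _ (fun y => w y * psi y)
  (fun y => kap * F y + L * prim a (fun z => `|psi z|) y) u t e) => //.
move=> x y ux xy yt yxe.
have ax := le_trans au ux.
have -> : w y * psi y - w x * psi x = w y * (psi y - psi x) + (w y - w x) * psi x by ring.
have h0 : 0 <= F y - F x by rewrite subr_ge0 hF.
have h1 : `|w y * (psi y - psi x)| <= W * (F y - F x).
  by rewrite normrM ler_pM//; exact: cF.
have h2 : `|(w y - w x) * psi x| <= L * ((y - x) * `|psi x|).
  by rewrite normrM mulrA ler_wpM2r//; exact: wL.
have h3 : (y - x) * `|psi x| <= (prim a (fun y => `|psi y|) y -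
    prim a (fun y => `|psi y|) x) + (y - x) * (F y - F x).
  apply: prim_abs_mul => // z xz zy.
  by rewrite (le_trans (cF _ _ ux (ltW xz) (le_trans (ltW zy) yt)))// lerB// hF// ltW.
have h4 : L * (y - x) * (F y - F x) <= (kap - W) * (F y - F x).
  apply: ler_wpM2r => //; rewrite (le_trans (ler_wpM2l L0 yxe))// /e mulrCA ler_piMr//.
    by rewrite subr_ge0 ltW.
  rewrite ler_pdivrMr; linear.
have h5 := ler_wpM2l L0 h3.
rewrite (le_trans (ler_normD _ _))//; linear.
Qed.

End BranchVariation.

Section BranchOperator.
Context {R : realType}.
Implicit Types (F psi chi w : R -> R).
Context {a d al be s l r K : R} {f v g : R -> R}.
Hypothesis B : branch a d f al be s v g l r K.

Lemma br_orient : s = 1 /\ f al = a /\ f be = d \/ s = -1 /\ f al = d /\ f be = a.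
Proof.
have ab := br_lt B; have [h _] := br_expand B (lexx _) (ltW ab) (lexx _).
have D0 : 0 < s * (f be - f al) by rewrite -(pmulr_rgt0 _ (br_r0 B)); linear.
have /andP[al1 al2] := br_f B (lexx _) (ltW ab).
have /andP[be1 be2] := br_f B (ltW ab) (lexx _).
by case: (br_s B) D0 => ->; case: (br_fal B) => e1; case: (br_fbe B) => e2;
  rewrite e1 e2 in al1 al2 be1 be2 *; [linear|left|linear|linear|linear|linear|right|linear].
Qed.

Lemma br_ad : a < d.
Proof.
have ab := br_lt B; have [h _] := br_expand B (lexx _) (ltW ab) (lexx _).
have D0 : 0 < s * (f be - f al) by rewrite -(pmulr_rgt0 _ (br_r0 B)); linear.
by case: br_orient => -[e1 [e2 e3]]; move: D0; rewrite e1 e2 e3; linear.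
Qed.

Lemma transfer_total b chi V : d <= b -> nice v -> varle chi V ->
  prim a (@transfer _ a d g (fun y => v y * chi y)) b =
  prim a chi be - prim a chi al.
Proof.
move=> db nv vc; have ad := br_ad; have ab := br_lt B.
have nT : nice (@transfer _ a d g (fun y => v y * chi y)).
  by apply: (transfer_nice B); apply: niceM => //; exact: varle_nice vc.
have H := transfer_prim B nv vc (lexx _) (ltW ab) (lexx _).
have e : prim a (@transfer _ a d g (fun y => v y * chi y)) b =
    prim a (@transfer _ a d g (fun y => v y * chi y)) d.
  apply/eqP; rewrite -subr_eq0; apply/eqP.
  rewrite (@prim_eq _ a _ (cst 0) d b)//; first by rewrite prim_cst ?mul0r// ltW.
  - exact: nice_cst.
  - exact: ltW.
  - by move=> x dx xb; rewrite /transfer (ltNge x d) (ltW dx) andbF.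
rewrite e; case: br_orient => -[e1 [e2 e3]]; move: H; rewrite e1 e2 e3 prim_base; linear.
Qed.

Lemma br_gle x y : a <= x -> x <= y -> y <= d ->
  (s = 1 /\ g x <= g y) \/ (s = -1 /\ g y <= g x).
Proof.
move=> ax xy yd; have := br_gmono B xy; case: (br_s B) => se; rewrite se.
  by rewrite !mul1r; left.
by rewrite !mulN1r lerN2; right.
Qed.

(** One Lasota-Yorke step without cutting: the image of a piece lives on a single interval, and the
    control there is the old one transported by [g]. The sign [s] keeps [G] nondecreasing on the
    decreasing branch. *)
Lemma transfer_piece w W L kap psi F al' be' :
  al <= al' -> al' < be' -> be' <= be ->
  0 <= L -> 0 <= kap -> W < kap -> nice psi -> {homo F : x y / x <= y} ->
  (forall y, `|w y| <= W) ->
  (forall x y, al < x -> x <= y -> y < be -> `|w y - w x| <= L * (y - x)) ->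
  (forall x y, al' < x -> x <= y -> y < be' -> `|psi y - psi x| <= F y - F x) ->
  (forall x, al < x -> x < be -> ~~ (al' < x < be') -> psi x = 0) ->
  let J1 := Num.min (f al') (f be') in let J2 := Num.max (f al') (f be') in
  let G := fun x => s * (kap * F (g x) + L * prim a (fun z => `|psi z|) (g x)) in
  let T := @transfer _ a d g (fun y => w y * psi y) in
  [/\ J1 < J2, {homo G : x y / x <= y},
      (forall x, ~~ (J1 < x < J2) -> T x = 0),
      (forall x y, J1 < x -> x <= y -> y < J2 -> `|T y - T x| <= G y - G x) &
      G J2 - G J1 = (kap * F be' + L * prim a (fun z => `|psi z|) be')
        - (kap * F al' + L * prim a (fun z => `|psi z|) al')].
Proof.
move=> alal' ab' be'be L0 k0 Wk np hF wW wL cF out J1 J2 G T.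
have al'be := lt_le_trans ab' be'be; have albe' := le_lt_trans alal' ab'.
have [h1 h2] := br_expand B alal' (ltW ab') be'be.
have D0 : 0 < s * (f be' - f al').
  by rewrite -(pmulr_rgt0 _ (br_r0 B)) (lt_le_trans _ h1)// subr_gt0.
have /andP[fal1 fal2] := br_f B alal' (ltW al'be).
have /andP[fbe1 fbe2] := br_f B (ltW albe') be'be.
have gal := br_gf B alal' (ltW al'be).
have gbe := br_gf B (ltW albe') be'be.
have hP : {homo (fun x => kap * F x + L * prim a (fun z => `|psi z|) x) : x y / x <= y}.
  move=> x y xy; rewrite lerD// ler_wpM2l//; first exact: hF.
  by apply: prim_homo => //; exact: nice_norm.
have hG : {homo G : x y / x <= y}.
  move=> x y xy; rewrite /G; have := br_gmono B xy.
  case: (br_s B) => ->; rewrite !(mul1r, mulN1r) ?lerN2 => gxy; exact: hP.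
have JG : s = 1 /\ J1 = f al' /\ J2 = f be' \/ s = -1 /\ J1 = f be' /\ J2 = f al'.
  case: (br_s B) => se; rewrite se in D0.
    left; split => //; rewrite /J1 /J2.
    have h : f al' <= f be' by linear.
    by rewrite (min_idPl h) (max_idPr h).
  right; split => //; rewrite /J1 /J2.
  have h : f be' <= f al' by linear.
  by rewrite (min_idPr h) (max_idPl h).
have Jin x : a < x -> x < d -> (J1 < x < J2) = (al' < g x < be').
  move=> ax xd; have fx := br_fg B (ltW ax) (ltW xd).
  have G1 y z : a <= y -> y <= d -> a <= z -> z <= d -> (s * g y < s * g z) = (y < z).
    move=> ay yd az zd; have [yz|zy] := ltP y z; first by rewrite (br_gstrict B).
    by apply/negbTE; rewrite -leNgt (br_gmono B).
  case: JG => -[se [-> ->]].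
    rewrite -(G1 (f al') x)// ?ltW// -(G1 x (f be'))// ?ltW//.
    by rewrite gal gbe se !mul1r.
  rewrite -(G1 (f be') x)// ?ltW// -(G1 x (f al'))// ?ltW//.
  by rewrite gal gbe se !mulN1r !ltrN2 andbC.
have Jad : a <= J1 /\ J2 <= d.
  by case: JG => -[_ [-> ->]].
split => //.
- by case: JG => -[se [-> ->]]; move: D0; rewrite se; linear.
- move=> x xJ; rewrite /T /transfer; case: ifP => // /andP[ax xd].
  have /andP[g1 g2] := br_in B ax xd.
  by rewrite out ?mulr0// -Jin.
- move=> x y xJ xy yJ.
  have ax := le_lt_trans Jad.1 xJ; have yd := lt_le_trans yJ Jad.2.
  have xd := le_lt_trans xy yd; have ay := lt_le_trans ax xy.
  rewrite /T /transfer ax xd ay yd /=.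
  have /andP[gx1 gx2] : al' < g x < be' by rewrite -Jin// xJ (le_lt_trans xy yJ).
  have /andP[gy1 gy2] : al' < g y < be' by rewrite -Jin// yJ (lt_le_trans xJ xy).
  have key p q : al' < p -> p <= q -> q < be' ->
    `|w q * psi q - w p * psi p| <= (kap * F q + L * prim a (fun y => `|psi y|) q)
    - (kap * F p + L * prim a (fun y => `|psi y|) p).
    move=> p1 pq q2; apply: (weighted_variation L0 Wk) => //.
    + by rewrite (le_trans (br_a B))// (le_trans alal')// ltW.
    + move=> x' y' px xy' yq; apply: wL => //.
        exact: lt_le_trans (le_lt_trans alal' p1) px.
      exact: lt_le_trans (le_lt_trans yq q2) be'be.
    + move=> x' y' px xy' yq; apply: cF => //; first exact: lt_le_trans px.
      exact: le_lt_trans q2.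
  case: (br_gle (ltW ax) xy (ltW yd)) => -[se gxy]; rewrite /G se.
    by rewrite !mul1r; exact: key.
  by rewrite distrC (le_trans (key _ _ gy1 gxy gx2))// !mulN1r; linear.
- by rewrite /G; case: JG => -[se [-> ->]]; rewrite gal gbe se; ring.
Qed.

End BranchOperator.

(** * Two-branch systems and the Lasota-Yorke inequality *)

Section System.
Context {R : realType}.
Implicit Types (F psi chi w : R -> R).

(** Here [d] stands for the critical value [f c]; the equality follows from the orientations of the
    two branches. *)
Record system (a c b d : R) (f gp gm v : R -> R) (l r K : R) : Prop := System {
  sy_p : branch a d f a c 1 v gp l r K;
  sy_m : branch a d f c b (-1) v gm l r K;
  sy_d : d <= b;
  sy_v : nice v
}.

Context {a c b d l r K : R} {f gp gm v : R -> R}.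
Hypothesis S : system a c b d f gp gm v l r K.

(** For [w = v] this is the Perron-Frobenius operator; other weights arise when [rho = L rho] is
    differentiated. *)
Definition op w psi x : R :=
  @transfer _ a d gp (fun y => w y * psi y) x +
  @transfer _ a d gm (fun y => w y * psi y) x.

(* [Bd] bounds the norm of [op w] on L^1, [W] its contraction of variation. *)
Record weight w (W L Bd : R) : Prop := Weight {
  wt_nice : nice w;
  wt_le : forall y, `|w y| <= W;
  wt_L0 : 0 <= L;
  wt_p : forall x y, a < x -> x <= y -> y < c -> `|w y - w x| <= L * (y - x);
  wt_m : forall x y, c < x -> x <= y -> y < b -> `|w y - w x| <= L * (y - x);
  wt_B0 : 0 <= Bd;
  wt_Bp : forall y, a < y -> y < c -> `|w y| <= Bd * v y;
  wt_Bm : forall y, c < y -> y < b -> `|w y| <= Bd * v y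
}.

Lemma sy_ac : a < c. Proof. exact: br_lt (sy_p S). Qed.
Lemma sy_cb : c < b. Proof. exact: br_lt (sy_m S). Qed.
Lemma sy_ab : a < b. Proof. exact: lt_trans sy_ac sy_cb. Qed.
Lemma sy_ad : a < d. Proof. exact: br_ad (sy_p S). Qed.

Lemma opD w psi chi : op w (fun x => psi x + chi x) = (fun x => op w psi x + op w chi x).
Proof. by apply/funext => x; rewrite /op /transfer; case: ifP => _; ring. Qed.

Lemma opZ w k psi : op w (fun x => k * psi x) = (fun x => k * op w psi x).
Proof. by apply/funext => x; rewrite /op /transfer; case: ifP => _; ring. Qed.

Lemma iter_opD w m psi chi :
  iter m (op w) (fun x => psi x + chi x) =
  (fun x => iter m (op w) psi x + iter m (op w) chi x).
Proof. by elim: m => // m IH; rewrite !iterS IH opD. Qed.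

Lemma iter_opZ w m k psi :
  iter m (op w) (fun x => k * psi x) = (fun x => k * iter m (op w) psi x).
Proof. by elim: m => // m IH; rewrite !iterS IH opZ. Qed.

Lemma iter_op0 w m : iter m (op w) (cst 0) = cst 0.
Proof.
elim: m => // m IH; rewrite iterS IH; apply/funext => x.
by rewrite /op /transfer /=; case: ifP => _; rewrite ?mulr0 addr0.
Qed.

Lemma op_out w psi x : ~~ (a < x < d) -> op w psi x = 0.
Proof. by rewrite /op /transfer => /negbTE ->; rewrite addr0. Qed.

Lemma op_in w psi x : a < x -> x < d ->
  op w psi x = w (gp x) * psi (gp x) + w (gm x) * psi (gm x).
Proof. by rewrite /op /transfer => -> ->. Qed.

Lemma op_nice w psi : nice w -> nice psi -> nice (op w psi).
Proof.
move=> nw np; apply: niceD.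
  by apply: (transfer_nice (sy_p S)); exact: niceM.
by apply: (transfer_nice (sy_m S)); exact: niceM.
Qed.

Lemma prim_op psi V : varle psi V -> prim a (op v psi) b = prim a psi b.
Proof.
move=> vp; have np := varle_nice vp; have nv := sy_v S.
rewrite /op primD.
- rewrite (transfer_total (sy_p S) (sy_d S) nv vp).
  rewrite (transfer_total (sy_m S) (sy_d S) nv vp) prim_base; ring.
- by apply: (transfer_nice (sy_p S)); exact: niceM.
- by apply: (transfer_nice (sy_m S)); exact: niceM.
Qed.

Lemma op_abs_le w W L Bd psi x : weight w W L Bd ->
  `|op w psi x| <= Bd * op v (fun y => `|psi y|) x.
Proof.
move=> ww; have B0 := wt_B0 ww; have [/andP[ax xd]|nx] := boolP (a < x < d); last first.
  by rewrite !op_out// normr0 mulr0.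
rewrite !op_in//; have /andP[p1 p2] := br_in (sy_p S) ax xd.
have /andP[m1 m2] := br_in (sy_m S) ax xd.
rewrite (le_trans (ler_normD _ _))// mulrDr !normrM !mulrA.
by rewrite lerD// ler_wpM2r//; [exact: (wt_Bp ww)|exact: (wt_Bm ww)].
Qed.

Lemma prim_op_abs w W L Bd psi V : weight w W L Bd -> varle psi V ->
  prim a (fun y => `|op w psi y|) b <= Bd * prim a (fun y => `|psi y|) b.
Proof.
move=> ww vp; have np := varle_nice vp; have vap := varle_norm vp.
have ab := sy_ab; rewrite -(prim_op vap) -primZ; last first.
  by apply: op_nice; [exact: sy_v S|exact: varle_nice vap].
have := @prim_le _ a (fun y => `|op w psi y|) (fun x => Bd * op v (fun y => `|psi y|) x) a b.
rewrite !prim_base !subr0; apply => //.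
- by apply: nice_norm; apply: op_nice => //; exact: wt_nice ww.
- apply: niceZ; apply: op_nice; [exact: sy_v S|exact: varle_nice vap].
- exact: ltW.
- by move=> x _ _; exact: op_abs_le ww.
Qed.

(* Lasota-Yorke: [psi] lives on [(al, be)]; the image under [f] of each of its
   two pieces lives on one interval again, so cutting costs a factor [3] only
   once, at the last step. *)
Definition LY_at w kap m := forall al be : R, a <= al -> al < be -> be <= b ->
  exists2 C : R, 0 <= C & forall psi F, nice psi -> {homo F : x y / x <= y} ->
    (forall x, ~~ (al < x < be) -> psi x = 0) ->
    (forall x y, al < x -> x <= y -> y < be -> `|psi y - psi x| <= F y - F x) ->
    varle (iter m (op w) psi)
      (3 * kap ^+ m * (F be - F al) + C * prim a (fun x => `|psi x|) b).

Lemma prim_abs_ge0 psi x : 0 <= prim a (fun x => `|psi x|) x.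
Proof. exact: Rintegral_ge0. Qed.

Lemma LY_0 w kap : LY_at w kap 0.
Proof.
move=> al be aal ab beb; exists (2 / (be - al)).
  by rewrite mulr_ge0 ?ler0n// invr_ge0 subr_ge0 ltW.
move=> psi F np hF out cF /=; rewrite expr0 mulr1.
have dF : 0 <= F be - F al by rewrite subr_ge0 hF// ltW.
have iba : 0 <= (be - al)^-1 by rewrite invr_ge0 subr_ge0 ltW.
set I := prim a _ b.
have I0 : 0 <= I by exact: prim_abs_ge0.
set M := (F be - F al) + (be - al)^-1 * I.
have -> : 3 * (F be - F al) + 2 / (be - al) * I = F be - F al + 2 * M.
  by rewrite /M; ring.
apply: varle_cut => //; first by rewrite addr_ge0// mulr_ge0.
move=> x; have [xin|xout] := boolP (al < x < be); last first.
  by rewrite out// normr0 addr_ge0// mulr_ge0.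
rewrite (le_trans (sup_le_average aal ab np hF cF xin))// lerD2l ler_wpM2l//.
have h1 : 0 <= prim a (fun x => `|psi x|) al by exact: prim_abs_ge0.
have h2 : prim a (fun x => `|psi x|) be <= I.
  by apply: prim_homo => //; exact: nice_norm.
linear.
Qed.

(** The part of [(al, be)] inside the branch, obtained by clamping, is mapped onto one interval
    [(J1, J2)], where the induction hypothesis applies. The constant depends on this interval and
    not on [psi]. *)
Lemma LY_branch w W L Bd kap m (s al0 be0 : R) g : weight w W L Bd -> 0 <= kap ->
  W < kap -> LY_at w kap m ->
  branch a d f al0 be0 s v g l r K -> be0 <= b ->
  (forall x y, al0 < x -> x <= y -> y < be0 -> `|w y - w x| <= L * (y - x)) ->
  (forall y, al0 < y -> y < be0 -> `|w y| <= Bd * v y) ->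
  forall al be : R, a <= al -> al < be -> be <= b ->
  exists2 C : R, 0 <= C & forall psi F, nice psi -> {homo F : x y / x <= y} ->
    (forall x, ~~ (al < x < be) -> psi x = 0) ->
    (forall x y, al < x -> x <= y -> y < be -> `|psi y - psi x| <= F y - F x) ->
    varle (iter m (op w) (@transfer _ a d g (fun y => w y * psi y)))
      (3 * kap ^+ m.+1 * (F (clamp al0 be0 be) - F (clamp al0 be0 al))
         + C * prim a (fun x => `|psi x|) b).
Proof.
move=> ww k0 Wk IH B be0b wL wB al be aal ab beb.
have L0 := wt_L0 ww; have B0 := wt_B0 ww; have ab0 := br_lt B.
set al' := clamp al0 be0 al; set be' := clamp al0 be0 be.
have /andP[al1 al2] : al0 <= al' <= be0 by exact/clamp_in/ltW.
have /andP[be1 be2] : al0 <= be' <= be0 by exact/clamp_in/ltW.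
have abp : al' <= be' by apply: clamp_homo; exact: ltW.
(* In the first case [(al, be)] misses the domain of this branch and the image vanishes. *)
have [ee|ne] := eqVneq al' be'.
  exists 0 => // psi F np hF out cF.
  have -> : @transfer _ a d g (fun y => w y * psi y) = cst 0.
    apply/funext => x; rewrite /transfer; case: ifP => // /andP[ax xd].
    have /andP[g1 g2] := br_in B ax xd.
    rewrite out ?mulr0//; apply/negP => /andP[h1 h2].
    have : al' < be'.
      rewrite /al' /be' /clamp !(lt_max, gt_max, lt_min, gt_min).
      by rewrite ab0 (lt_trans g1 h2) (lt_trans h1 g2) ab ?orbT ?andbT.
    by rewrite ee ltxx.
  rewrite iter_op0 ee subrr mulr0 mul0r addr0.
  by exists (cst 0) => x y; rewrite ?subrr ?normr0.
have abl : al' < be' by rewrite lt_neqAle ne.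
have [f1 f2] : a <= f al' <= d /\ a <= f be' <= d.
  by split; apply: (br_f B).
move: f1 f2 => /andP[f11 f12] /andP[f21 f22].
set J1 := Num.min (f al') (f be'); set J2 := Num.max (f al') (f be').
have aJ1 : a <= J1 by rewrite le_min f11.
have J2b : J2 <= b by rewrite ge_max (le_trans f12 (sy_d S)) (le_trans f22 (sy_d S)).
have [J12|J21] := ltP J1 J2; last first.
  exists 0 => // psi F np hF out cF; exfalso.
  have h : J1 < J2; last by move: J21; rewrite leNgt h.
  have [h1 h2] := br_expand B al1 (ltW abl) be2.
  have D0 : 0 < s * (f be' - f al').
    by rewrite -(pmulr_rgt0 _ (br_r0 B)) (lt_le_trans _ h1)// subr_gt0.
  rewrite /J1 /J2; case: (ltgtP (f al') (f be')) D0 => // e D.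
  by move: D; rewrite e subrr mulr0 !ltxx.
have [C C0 HC] := IH J1 J2 aJ1 J12 J2b.
exists (3 * kap ^+ m * L + C * Bd).
  by rewrite addr_ge0// !mulr_ge0// exprn_ge0.
move=> psi F np hF out cF.
have sub x : al' < x -> x < be' -> al < x /\ x < be.
  rewrite /al' /be' /clamp gt_max lt_max lt_min => /andP[h1 h2] h3.
  have {}h2 : al < x \/ be0 < x.
    by move: h2; rewrite gt_min => /orP[]; auto.
  have {}h3 : x < al0 \/ x < be /\ x < be0.
    by case/orP: h3 => [|/andP[]]; auto.
  by split; case: h3 => [?|[? ?]]; case: h2 => ?; linear.
have cF' x y : al' < x -> x <= y -> y < be' -> `|psi y - psi x| <= F y - F x.
  move=> h1 xy h2; apply: cF => //.
    by have [] := sub x h1 (le_lt_trans xy h2).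
  by have [] := sub y (lt_le_trans h1 xy) h2.
have out' x : al0 < x -> x < be0 -> ~~ (al' < x < be') -> psi x = 0.
  move=> x1 x2 nx; apply: out; apply: contra nx => /andP[h1 h2].
  by rewrite /al' /be' /clamp gt_max lt_max lt_min gt_min x1 h1 h2 x2 /= orbT.
have := transfer_piece B al1 abl be2 L0 k0 Wk np hF (wt_le ww) wL cF' out'.
cbv zeta; rewrite -/J1 -/J2; set G := fun x : R => s * _.
set T := @transfer _ a d g _ => -[_ hG outT cT eG].
have nT : nice T by apply: (transfer_nice B); apply: niceM => //; exact: wt_nice ww.
apply: varleW (HC T G nT hG outT cT).
rewrite eG; set P := prim a (fun z => `|psi z|).
have hP : {homo P : x y / x <= y} by apply: prim_homo => //; exact: nice_norm.
have P0 x : 0 <= P x by exact: prim_abs_ge0.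
(* A qualitative bound, required by the change of variables that estimates the L^1 norm of the
   image. *)
have vp : exists V, varle psi V.
  have [C1 C10 HC1] := LY_0 w kap aal ab beb.
  by eexists; exact: (HC1 psi F np hF out cF).
have [V vpV] := vp; have vapV := varle_norm vpV.
have hT : prim a (fun x => `|T x|) b <= Bd * P b.
  have e := transfer_total B (sy_d S) (sy_v S) vapV.
  have nvp : nice (fun y => v y * `|psi y|).
    by apply: niceM; [exact: sy_v S|exact: nice_norm].
  have h : prim a (fun x => `|T x|) b <= Bd * prim a (@transfer _ a d g (fun y => v y * `|psi y|)) b.
    rewrite -primZ; last by apply: (transfer_nice B).
    have := @prim_le _ a (fun x => `|T x|)
      (fun x => Bd * @transfer _ a d g (fun y => v y * `|psi y|) x) a b.
    rewrite !prim_base !subr0; apply => //.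
    - exact: nice_norm.
    - by apply: niceZ; apply: (transfer_nice B).
    - by rewrite ltW// sy_ab.
    - move=> x ax xb; rewrite /T /transfer; case: ifP => [/andP[_ xd]|]; last by rewrite normr0 mulr0.
      have /andP[g1 g2] := br_in B ax xd.
      by rewrite normrM mulrA ler_wpM2r//; exact: wB.
  rewrite (le_trans h)// ler_wpM2l// e -/(P be0) -/(P al0).
  have := hP _ _ be0b; have := P0 al0; linear.
have km0 : 0 <= kap ^+ m by rewrite exprn_ge0.
have hPb : P be' - P al' <= P b.
  have := hP _ _ (le_trans be2 be0b); have := P0 al'; linear.
have e1 : L * (P be' - P al') <= L * P b by exact: ler_wpM2l.
have e2 := ler_wpM2l C0 hT.
have e3 : 3 * kap ^+ m * (L * (P be' - P al')) <= 3 * kap ^+ m * (L * P b).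
  by rewrite ler_wpM2l// mulr_ge0.
rewrite exprS.
have -> : kap * F be' + L * P be' - (kap * F al' + L * P al') =
  kap * (F be' - F al') + L * (P be' - P al') by ring.
rewrite mulrDr.
have -> : 3 * (kap * kap ^+ m) * (F be' - F al') + (3 * kap ^+ m * L + C * Bd) * P b =
  (3 * kap ^+ m * (kap * (F be' - F al')) + 3 * kap ^+ m * (L * P b)) + C * (Bd * P b) by ring.
by rewrite lerD// lerD.
Qed.

Lemma LY_all w W L Bd kap m : weight w W L Bd -> 0 <= kap -> W < kap -> LY_at w kap m.
Proof.
move=> ww k0 Wk; elim: m => [|m IH]; first exact: LY_0.
move=> al be aal ab beb.
have ac := sy_ac; have cb := sy_cb.
have [C1 C10 H1] := LY_branch ww k0 Wk IH (sy_p S) (ltW cb) (wt_p ww) (wt_Bp ww) aal ab beb.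
have [C2 C20 H2] := LY_branch ww k0 Wk IH (sy_m S) (lexx _) (wt_m ww) (wt_Bm ww) aal ab beb.
exists (C1 + C2); first by rewrite addr_ge0.
move=> psi F np hF out cF.
rewrite iterSr {2}/op iter_opD.
apply: varleW (varleD (H1 psi F np hF out cF) (H2 psi F np hF out cF)).
(* The increments of [F] over the two clamped pieces add up to its increment over [(al, be)], so
   summing the branches does not double the factor in front of the variation. *)
have split x : a <= x -> x <= b ->
   F (clamp a c x) + F (clamp c b x) = F x + F c.
  move=> ax xb; have [xc|/ltW cx] := leP x c.
    by rewrite clamp_id// clamp_l// ltW.
  by rewrite (@clamp_r _ a c)// ?clamp_id 1?addrC// ltW.
have := split al aal (ltW (lt_le_trans ab beb)).
have := split be (le_trans aal (ltW ab)) beb.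
set x1 := F (clamp a c be); set x2 := F (clamp c b be).
set y1 := F (clamp a c al); set y2 := F (clamp c b al) => e1 e2.
have -> : F be - F al = (x1 - y1) + (x2 - y2) by linear.
linear.
Qed.

Definition cutoff psi x := if a < x < b then psi x else 0.

Lemma op_cutoff w psi : op w (cutoff psi) = op w psi.
Proof.
apply/funext => x; have [/andP[ax xd]|nx] := boolP (a < x < d); last by rewrite !op_out.
have /andP[p1 p2] := br_in (sy_p S) ax xd; have /andP[m1 m2] := br_in (sy_m S) ax xd.
rewrite !op_in// /cutoff p1 (lt_trans p2 sy_cb) m2 (lt_trans sy_ac m1) //.
Qed.

Lemma LY_supported w W L Bd kap m : weight w W L Bd -> 0 <= kap -> W < kap ->
  exists2 C : R, 0 <= C & forall psi V, varle psi V ->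
    (forall x, ~~ (a < x < b) -> psi x = 0) ->
    varle (iter m (op w) psi) (3 * kap ^+ m * V + C * prim a (fun x => `|psi x|) b).
Proof.
move=> ww k0 Wk.
have [C C0 H] := LY_all m ww k0 Wk (lexx a) sy_ab (lexx b).
exists C => // psi V vp out; have np := varle_nice vp; case: vp => F cF bF.
apply: (varleW _ (H psi F np (gctrl_homo cF) out _)).
  by rewrite lerD2r ler_wpM2l// mulr_ge0// exprn_ge0.
by move=> x y _ xy _; exact: cF.
Qed.

Lemma varle_cutoff_ab psi V : varle psi V -> exists V', varle (cutoff psi) V'.
Proof.
move=> vp; have [M _ hM] := nice_bound (varle_nice vp).
by eexists; apply: (varle_cutoff sy_ab hM vp).
Qed.

Lemma varle_iter w W L Bd psi V m : weight w W L Bd -> varle psi V ->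
  exists V', varle (iter m (op w) psi) V'.
Proof.
move=> ww vp; case: m => [|m]; first by exists V.
have W0 : 0 <= W by exact: le_trans (normr_ge0 _) (wt_le ww 0).
(* Any rate above [W] serves: finiteness is wanted here, not contraction. *)
have [C C0 H] := @LY_supported w W L Bd (W + 1) m.+1 ww (addr_ge0 W0 ler01) ltac:(by rewrite ltrDl).
have [V' vV'] := varle_cutoff_ab vp.
have := H _ _ vV' (fun x h => ltac:(by rewrite /cutoff (negbTE h))).
by rewrite iterSr op_cutoff -iterSr; eexists; eassumption.
Qed.

Lemma prim_iter_abs w W L Bd psi V m : weight w W L Bd -> varle psi V ->
  prim a (fun y => `|iter m (op w) psi y|) b <= Bd ^+ m * prim a (fun y => `|psi y|) b.
Proof.
move=> ww vp; elim: m => [|m IH]; first by rewrite expr0 mul1r.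
have [V' vV'] := varle_iter m ww vp.
rewrite (le_trans (prim_op_abs ww vV'))// exprS -mulrA.
by rewrite ler_wpM2l// (wt_B0 ww).
Qed.

Lemma prim_iter W L Bd psi V m : weight v W L Bd -> varle psi V ->
  prim a (iter m (op v) psi) b = prim a psi b.
Proof.
move=> ww vp; elim: m => // m IH; have [V' vV'] := varle_iter m ww vp.
by rewrite iterS (prim_op vV').
Qed.

End System.

(** * Spectral gap *)

Section CountableExceptions.
Context {R : realType}.
Notation mu := (@lebesgue_measure R).
Implicit Types (p q psi : R -> R) (A : set R).

(** Exceptional sets have to be stable under images by [f], which is immediate for countable
    ones. *)
Definition eqc p q := countable [set x | p x <> q x].

Lemma eqc_refl p : eqc p p.
Proof.
by rewrite /eqc (_ : [set x | _] = set0)// -subset0 => x /=.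
Qed.

Lemma countableS (T : Type) (A B : set T) : A `<=` B -> countable B -> countable A.
Proof. by move=> AB; apply: sub_countable; exact: subset_card_le. Qed.

Lemma countableU (T : Type) (A B : set T) :
  countable A -> countable B -> countable (A `|` B).
Proof.
move=> cA cB; rewrite -bigcup2E; apply: bigcup_countable => // -[|[|n]] _ //=.
Qed.

Lemma eqc_trans p q psi : eqc p q -> eqc q psi -> eqc p psi.
Proof.
move=> h1 h2; apply: countableS (countableU h1 h2) => x /= h.
have [e|] := pselect (p x = q x); last by left.
by right => /= e'; apply: h; rewrite e e'.
Qed.

Lemma eqc_sym p q : eqc p q -> eqc q p.
Proof. by apply: countableS => x /= h /esym. Qed.

Lemma countable_measurableR A : countable A -> measurable A.
Proof. exact: countable_measurable. Qed.

Lemma eqc_measurable p q : measurable_fun [set: R] p -> eqc p q ->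
  measurable_fun [set: R] q.
Proof.
move=> mp cpq _ Y mY; rewrite setTI.
set C := [set x | p x <> q x].
have -> : q @^-1` Y = (p @^-1` Y `\` C) `|` (q @^-1` Y `&` C).
  apply/seteqP; split => x /=.
    by move=> qY; have [e|ne] := pselect (p x = q x); [left; split; [rewrite e|move=> h; exact: h]|right].
  by move=> [[pY] /contrapT <-|[]].
apply: measurableU; last by apply: countable_measurableR; apply: countableS cpq => x [].
apply: measurableD; first by rewrite -[X in measurable X]setTI; exact: mp.
exact: countable_measurableR.
Qed.

Lemma eqc_Rintegral (D : set R) p q : measurable D -> measurable_fun [set: R] p ->
  eqc p q -> \int[mu]_(x in D) p x = \int[mu]_(x in D) q x.
Proof.
move=> mD mp cpq; rewrite /Rintegral; congr fine; apply: ae_eq_integral => //.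
- by apply/measurable_EFinP; exact: measurable_funS mp.
- by apply/measurable_EFinP; apply: measurable_funS (eqc_measurable mp cpq).
- exists [set x | p x <> q x]; split.
  + exact: countable_measurableR.
  + exact: countable_lebesgue_measure0.
  + by move=> x /= h e; apply: h => _; rewrite e.
Qed.

Lemma prim_eqc a p q t : nice p -> eqc p q -> prim a p t = prim a q t.
Proof. by move=> [mp _] pq; exact: eqc_Rintegral. Qed.

Lemma prim_le_eqc a p q t A : nice p -> nice q -> a <= t -> countable A ->
  (forall x, a < x -> x < t -> ~ A x -> p x <= q x) ->
  prim a p t <= prim a q t.
Proof.
move=> np nq at_ cA H.
(* The minimum of [p] and [q], in a form whose niceness is purely algebraic; it agrees with [p] on
   [(a, t)] off [A]. *)
pose p' x := 2^-1 * (p x + q x - `|p x - q x|).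
have np' : nice p'.
  by apply: niceZ; apply: niceB; [exact: niceD|apply: nice_norm; exact: niceB].
have p'q x : p' x <= q x.
  by rewrite /p'; case: (ltrP (p x) (q x)) => h; linear.
pose cut (h : R -> R) x := if a < x < t then h x else 0.
have cutE h : nice h -> prim a (cut h) t = prim a h t.
  move=> nh; have := @prim_eq _ a (cut h) h a t (nice_cut a t nh) nh (lexx _) at_.
  by rewrite !prim_base !subr0; apply => x ax xt; rewrite /cut ax xt.
rewrite -(cutE p)// -(cutE q)//.
have -> : prim a (cut p) t = prim a (cut p') t.
  apply: prim_eqc; first exact: nice_cut.
  apply: countableS cA => x /=; rewrite /cut; case: ifP => // /andP[ax xt] h.
  apply: contrapT => nA; apply: h; have := H x ax xt nA; rewrite /p' => pq.
  by rewrite ler0_norm ?subr_le0//; linear.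
have := @prim_le _ a (cut p') (cut q) a t (nice_cut a t np') (nice_cut a t nq) (lexx _) at_.
rewrite !prim_base !subr0; apply => x _ _; rewrite /cut; case: ifP => _ //; exact: p'q.
Qed.

End CountableExceptions.

Section Geometric.
Context {R : realType}.

Lemma bernoulli_ineq (x : R) n : 0 <= x <= 1 -> 1 - n%:R * x <= (1 - x) ^+ n.
Proof.
move=> /andP[x0 x1]; elim: n => [|n IH]; first by rewrite expr0 mul0r subr0.
rewrite exprS -natr1.
have := ler_wpM2l (_ : 0 <= 1 - x) IH; rewrite subr_ge0 => /(_ x1).
have : 0 <= n%:R * x * x :> R by rewrite !mulr_ge0.
linear.
Qed.

(** Decay per block of [n] steps becomes decay per step. Bernoulli's inequality supplies some
    [k < 1] with [k0 <= k ^+ n], so no root is taken. *)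
Lemma geometric_of_block n (k0 : R) : (0 < n)%N -> 0 <= k0 -> k0 < 1 ->
  exists C k : R, [/\ 0 <= C, 0 < k, k < 1 & forall j, k0 ^+ (j %/ n) <= C * k ^+ j].
Proof.
move=> n0 k00 k01.
have nR : 1 <= n%:R :> R by rewrite ler1n.
(* With this choice [1 - n%:R * x] is the midpoint of [k0] and [1]. *)
pose x := (1 - k0) / (2 * n%:R).
have x0 : 0 < x by rewrite divr_gt0// ?subr_gt0// mulr_gt0//; linear.
have x1 : x <= 1 / 2.
  rewrite ler_pdivrMr; last by rewrite mulr_gt0//; linear.
  by nra.
pose k := 1 - x.
have k0' : 0 < k by rewrite /k; linear.
have kn : k0 <= k ^+ n.
  apply: (@le_trans _ _ (1 - n%:R * x)); last by apply: bernoulli_ineq; linear.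
  have -> : n%:R * x = (1 - k0) / 2.
    by rewrite /x; field; apply/eqP => e; rewrite e in nR; linear.
  linear.
exists (k ^+ n)^-1, k; split => //; [by rewrite invr_ge0 exprn_ge0// ltW|by rewrite /k; linear|].
move=> j; rewrite {2}(divn_eq j n) exprD mulnC exprM.
have h1 : k0 ^+ (j %/ n) <= (k ^+ n) ^+ (j %/ n) by apply: lerXn2r; rewrite ?nnegrE ?exprn_ge0// ltW.
rewrite (le_trans h1)// mulrCA ler_peMr ?exprn_ge0 ?(ltW k0')//.
rewrite mulrC ler_pdivlMr ?exprn_gt0// mul1r.
apply: ler_wiXn2l; [exact: ltW|rewrite /k; linear|exact/ltnW/ltn_pmod].
Qed.

End Geometric.

(** * Contraction in L^1 for functions of mean zero *)

Section Contraction.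
Context {R : realType}.
Implicit Types (F psi chi w : R -> R).
Context {a c b d l r K : R} {f gp gm v : R -> R}.
Hypothesis S : system a c b d f gp gm v l r K.
Hypothesis wv : @weight _ a c b v v r K 1.
Notation L := (@op _ a d gp gm v).
Let ac := sy_ac S.
Let cb := sy_cb S.
Let ab := sy_ab S.
Let ad := sy_ad S.

Lemma sy_fE : [/\ f a = a, f c = d & f b = a].
Proof.
case: (br_orient (sy_p S)) => -[s1 [e1 e2]]; last linear.
by case: (br_orient (sy_m S)) => -[s2 [e3 e4]]; [linear|split].
Qed.

Lemma sy_f_in x : a <= x -> x <= b -> a <= f x <= d.
Proof.
move=> ax xb; have [xc|/ltW cx] := leP x c; first exact: (br_f (sy_p S)).
exact: (br_f (sy_m S)).
Qed.

Lemma sy_iter_in n x : a <= x -> x <= b -> a <= iter n f x <= b.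
Proof.
move=> ax xb; elim: n => [|n /andP[h1 h2]]; first by rewrite /= ax.
by have /andP[h3 h4] := sy_f_in h1 h2; rewrite iterS h3 (le_trans h4 (sy_d S)).
Qed.

Lemma sy_f_strict x : a < x -> x < b -> x <> c -> a < f x < d.
Proof.
move=> ax xb xc; have [fa fc fb] := sy_fE.
have /andP[h1 h2] := sy_f_in (ltW ax) (ltW xb).
rewrite !lt_neqAle h1 h2 !andbT; have [xltc|cx] := ltP x c.
  have g0 := br_gf (sy_p S) (ltW ax) (ltW xltc).
  apply/andP; split; apply/eqP => e.
    by move: g0; rewrite -e -[X in gp X]fa (br_gf (sy_p S) (lexx _) (ltW ac)) => e'; move: ax; rewrite e' ltxx.
  by move: g0; rewrite e -[X in gp X]fc (br_gf (sy_p S) (ltW ac) (lexx _)) => e'; apply: xc.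
have g0 := br_gf (sy_m S) cx (ltW xb).
apply/andP; split; apply/eqP => e.
  by move: g0; rewrite -e -[X in gm X]fb (br_gf (sy_m S) (ltW cb) (lexx _)) => e'; move: xb; rewrite e' ltxx.
by move: g0; rewrite e -[X in gm X]fc (br_gf (sy_m S) (lexx _) (ltW cb)) => e'; apply: xc.
Qed.

Lemma sy_vge0 y : a < y -> y < b -> y <> c -> l <= v y.
Proof.
move=> ay yb yc; have [h|h] := ltP y c.
  by have /andP[] := br_v (sy_p S) ay h.
have h' : c < y by rewrite lt_neqAle h andbT; apply/eqP => /esym.
by have /andP[] := br_v (sy_m S) h' yb.
Qed.

Lemma op_ge0 psi x : (forall y, 0 <= psi y) -> 0 <= L psi x.
Proof.
move=> p0; have [/andP[ax xd]|nx] := boolP (a < x < d); last by rewrite op_out.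
rewrite op_in//; have /andP[p1 p2] := br_in (sy_p S) ax xd.
have /andP[m1 m2] := br_in (sy_m S) ax xd.
have l0 := br_l (sy_p S).
have := br_v (sy_p S) p1 p2; have := br_v (sy_m S) m1 m2 => /andP[h1 _] /andP[h2 _].
by rewrite addr_ge0// mulr_ge0//; linear.
Qed.

Lemma iter_op_ge0 n psi x : (forall y, 0 <= psi y) -> 0 <= iter n L psi x.
Proof.
move=> p0; elim: n x => [|n IH] x //=.
by apply: op_ge0 => y; exact: IH.
Qed.

Lemma op_lower psi y : (forall y, 0 <= psi y) -> a < y -> y < b -> y <> c ->
  l * psi y <= L psi (f y).
Proof.
move=> p0 ay yb yc; have /andP[f1 f2] := sy_f_strict ay yb yc.
rewrite op_in//; have /andP[p1 p2] := br_in (sy_p S) f1 f2.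
have /andP[m1 m2] := br_in (sy_m S) f1 f2.
have l0 := br_l (sy_p S).
have := br_v (sy_p S) p1 p2; have := br_v (sy_m S) m1 m2 => /andP[h1 _] /andP[h2 _].
have q1 : 0 <= v (gp (f y)) * psi (gp (f y)) by rewrite mulr_ge0//; linear.
have q2 : 0 <= v (gm (f y)) * psi (gm (f y)) by rewrite mulr_ge0//; linear.
have [h|h] := ltP y c.
  have e := br_gf (sy_p S) (ltW ay) (ltW h).
  rewrite (@le_trans _ _ (v (gp (f y)) * psi (gp (f y))))//; last linear.
  by rewrite e in h2 *; rewrite ler_wpM2r.
have e := br_gf (sy_m S) h (ltW yb).
rewrite (@le_trans _ _ (v (gm (f y)) * psi (gm (f y))))//; last linear.
by rewrite e in h1 *; rewrite ler_wpM2r.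
Qed.

(** Among all preimages of order [n] only [y] is kept. Every step costs at most the factor [l],
    provided that the orbit stays in the open branches. *)
Lemma iter_lower n psi y : (forall y, 0 <= psi y) ->
  (forall i, (i < n)%N -> a < iter i f y < b /\ iter i f y <> c) ->
  l ^+ n * psi y <= iter n L psi (iter n f y).
Proof.
move=> p0; elim: n => [|n IH] H; first by rewrite expr0 mul1r.
have [/andP[h1 h2] h3] := H n (ltnSn n).
rewrite iterS [iter _ f y]iterS (le_trans _ (op_lower _ h1 h2 h3))//.
  rewrite exprS -mulrA ler_wpM2l//; first exact/ltW/(br_l (sy_p S)).
  by apply: IH => i iln; apply: H; exact: ltnW.
by move=> z; exact: iter_op_ge0.
Qed.

Lemma iter_fa n : iter n f a = a.
Proof. by have [fa _ _] := sy_fE; elim: n => // n IH; rewrite iterS IH. Qed.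

(** A visit to [a] or [b] would leave the orbit at [a] forever, and a visit to [c] would put [z] on
    the critical orbit. *)
Lemma orbit_inside n y z : a < y -> y < b -> iter n f y = z -> a < z ->
  (forall k, (0 < k <= n)%N -> z <> iter k f c) ->
  forall i, (i < n)%N -> a < iter i f y < b /\ iter i f y <> c.
Proof.
move=> ay yb e az nz i iln; have [fa _ fb] := sy_fE.
have /andP[h1 h2] := sy_iter_in i (ltW ay) (ltW yb).
have e2 : z = iter (n - i) f (iter i f y) by rewrite -iterD subnK// ltnW.
have ni : (0 < n - i)%N by rewrite subn_gt0.
have nia x : f x = a -> iter i f y <> x.
  move=> fx ex; move: e2; rewrite ex -(prednK ni) iterSr fx iter_fa => e3.
  by move: az; rewrite e3 ltxx.
split; last by move=> ei; apply: (nz (n - i)%N); rewrite ?ni ?leq_subr// e2 ei.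
rewrite !lt_neqAle h1 h2 !andbT; apply/andP; split; apply/eqP => ex.
  by apply: (nia a).
by apply: (nia b).
Qed.

Definition ppart psi x : R := 2^-1 * (`|psi x| + psi x).

Lemma nice_ppart psi : nice psi -> nice (ppart psi).
Proof. by move=> np; apply: niceZ; apply: niceD => //; exact: nice_norm. Qed.

Lemma ppart_ge0 psi x : 0 <= ppart psi x.
Proof. by rewrite /ppart; case: (ler0P (psi x)) => h; linear. Qed.

Lemma ppart_ge psi x : psi x <= ppart psi x.
Proof. rewrite /ppart; have := ler_norm (psi x); linear. Qed.

(** A cell that contains a value below [al] has all its values below [al] plus the increment of the
    control over that cell. Integrated and summed, the increments give at most the cell length times
    [V]. *)
Lemma level_bound psi V N al : (0 < N)%N -> 0 <= al -> varle psi V ->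
  (forall i, (i < N)%N -> exists2 x,
     a + i%:R * ((b - a) / N%:R) < x < a + i.+1%:R * ((b - a) / N%:R) & psi x < al) ->
  prim a (ppart psi) b <= al * (b - a) + (b - a) / N%:R * V.
Proof.
move=> N0 al0 vp H; have np := nice_ppart (varle_nice vp).
case: vp => F cF bF; have hF := gctrl_homo cF.
set h := (b - a) / N%:R; pose t i := a + i%:R * h.
have NR : 0 < N%:R :> R by rewrite ltr0n.
have h0 : 0 < h by rewrite divr_gt0// subr_gt0.
have tN : t N = b by rewrite /t /h mulrC divfK ?gt_eqF//; ring.
suff K1 n : (n <= N)%N -> prim a (ppart psi) (t n) <= al * (t n - a) + h * (F (t n) - F a).
  have := K1 N (leqnn N); rewrite tN => h1; rewrite (le_trans h1)//.
  by rewrite lerD2l ler_wpM2l// ltW.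
elim: n => [|n IH] nN.
  by rewrite /t mul0r addr0 prim_base !subrr !mulr0 addr0.
have {}IH := IH (ltnW nN).
have [x /andP[x1 x2] xal] := H n nN.
rewrite -/h -/(t n) -/(t n.+1) in x1 x2.
have tt : t n.+1 - t n = h by rewrite /t -natr1; ring.
have at_ : a <= t n by rewrite /t lerDl mulr_ge0// ltW.
have hz z : t n < z -> z < t n.+1 -> ppart psi z <= al + (F (t n.+1) - F (t n)).
  move=> z1 z2.
  have : `|psi z - psi x| <= F (t n.+1) - F (t n).
    have [xz|/ltW zx] := leP x z.
      by rewrite (le_trans (cF _ _ xz))// lerB// hF// ltW.
    by rewrite distrC (le_trans (cF _ _ zx))// lerB// hF// ltW.
  rewrite ler_norml => /andP[h1 h2].
  have dF : 0 <= F (t n.+1) - F (t n) by rewrite subr_ge0 hF//; linear.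
  by rewrite /ppart; have [p0|p0] := ler0P (psi z); linear.
have h2 := @prim_le _ a _ (cst (al + (F (t n.+1) - F (t n)))) (t n) (t n.+1)
  np (nice_cst _) at_ _ hz.
have := h2 ltac:(linear); rewrite prim_cst//; last linear.
rewrite tt; have -> : t n.+1 - a = t n - a + h by rewrite -tt; ring.
linear.
Qed.

Lemma uniform_from (P : nat -> nat -> Prop) N :
  (forall i, (i < N)%N -> exists n0, forall n, (n0 <= n)%N -> P i n) ->
  exists n1, forall n, (n1 <= n)%N -> forall i, (i < N)%N -> P i n.
Proof.
elim: N => [|N IH] H; first by exists 0%N.
have [n1 H1] := IH (fun i h => H i (ltnW h)).
have [n2 H2] := H N (ltnSn N).
exists (maxn n1 n2) => n; rewrite geq_max => /andP[h1 h2] i.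
by rewrite ltnS leq_eqVlt => /orP[/eqP ->|/H1]; [exact: H2|exact].
Qed.

Definition covers q1 q2 := forall x y, a <= x -> x < y -> y <= b ->
  exists n0, forall n, (n0 <= n)%N -> forall z, q1 <= z <= q2 ->
    exists2 y', x < y' < y & iter n f y' = z.

Lemma prim_ppart psi : nice psi -> prim a psi b = 0 ->
  prim a (ppart psi) b = 2^-1 * prim a (fun x => `|psi x|) b.
Proof.
move=> np p0; rewrite /ppart primZ; last by apply: niceD => //; exact: nice_norm.
by rewrite primD// ?p0 ?addr0//; exact: nice_norm.
Qed.

(* If [psi] has mean zero and moderate variation, then its positive and its
   negative part are both bounded below on some cell of a fixed grid; after
   [n] steps these two cells cover [q1, q2], where cancellation occurs. *)
Lemma mean_zero_contraction q1 q2 Kb : a < q1 -> q1 < q2 -> q2 < d -> covers q1 q2 -> 0 < Kb ->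
  exists n1, forall n, (n1 <= n)%N -> exists2 dl, 0 < dl <= 1 / 2 &
    forall psi V, varle psi V -> prim a psi b = 0 ->
    V <= Kb * prim a (fun x => `|psi x|) b ->
    prim a (fun x => `|iter n L psi x|) b <= (1 - dl) * prim a (fun x => `|psi x|) b.
Proof.
move=> aq1 q12 q2d cov Kb0.
have ba0 : 0 < b - a by rewrite subr_gt0.
(* The cells are so short that cell length times variation is at most an eighth of the L^1 norm. *)
pose N := (Num.truncn (8 * Kb * (b - a))).+1.
have NR : 0 < N%:R :> R by rewrite ltr0n.
set h := (b - a) / N%:R.
have h0 : 0 < h by rewrite divr_gt0.
have hK : h * Kb <= 1 / 8.
  have hN : 8 * Kb * (b - a) < N%:R by exact: truncnS_gt.
  by rewrite /h mulrAC ler_pdivrMr//; linear.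
pose t (i : nat) := a + i%:R * h.
have tb i : (i <= N)%N -> t i <= b.
  move=> iN; have -> : b = t N by rewrite /t /h mulrC divfK ?gt_eqF//; ring.
  by rewrite lerD2l ler_wpM2r// ?ler_nat// ltW.
have [n1 Hn1] := @uniform_from (fun i n => forall z, q1 <= z <= q2 ->
    exists2 y', t i < y' < t i.+1 & iter n f y' = z) N
  (fun i iN => cov (t i) (t i.+1) ltac:(by rewrite lerDl mulr_ge0// ltW)
     ltac:(by rewrite ltrD2l ltr_pM2r// ltr_nat) (tb i.+1 iN)).
exists n1 => n n1n; have {Hn1}Hn := Hn1 n n1n.
have l0 := br_l (sy_p S).
have ln0 : 0 < l ^+ n by rewrite exprn_gt0.
(* Cancellation removes twice the common lower bound [l ^+ n * al] over [(q1, q2)]; with the level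
   [al] chosen below this is [dl0 * I]. *)
pose dl0 := l ^+ n * (q2 - q1) / (4 * (b - a)).
have dl00 : 0 < dl0 by rewrite divr_gt0// mulr_gt0// subr_gt0.
exists (Num.min (1/2) dl0); first by rewrite lt_min ge_min lexx dl00 divr_gt0.
move=> psi V vp p0 VK.
have np := varle_nice vp.
set I := prim a (fun x => `|psi x|) b in VK *.
have I0 : 0 <= I by exact: Rintegral_ge0.
have [Ipos|] := ltP 0 I; last first.
  move=> I1; have I00 : I = 0 by apply/eqP; rewrite eq_le I0 I1.
  by have := prim_iter_abs S n wv vp; rewrite expr1n mul1r -/I I00 mulr0.
pose al := I / (8 * (b - a)).
have al0 : 0 < al by rewrite divr_gt0// mulr_gt0.
(* Otherwise [level_bound] would make the positive part, whose integral is [I / 2], at most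
   [I / 8 + I / 8]. The claim serves both [psi] and its opposite. *)
have level chi : varle chi V -> prim a chi b = 0 -> (forall x, `|chi x| = `|psi x|) ->
    exists2 i, (i < N)%N & forall x, t i < x < t i.+1 -> al <= chi x.
  move=> vc c0 cp; apply: contrapT => nex.
  have H i : (i < N)%N -> exists2 x, t i < x < t i.+1 & chi x < al.
    move=> iN; apply: contrapT => nx; apply: nex; exists i => // x xin.
    by rewrite leNgt; apply/negP => xal; apply: nx; exists x.
  have := level_bound (ltn0Sn _ : (0 < N)%N) (ltW al0) vc H.
  rewrite (prim_ppart (varle_nice vc) c0).
  have -> : prim a (fun x => `|chi x|) b = I.
    by rewrite /I; congr prim; apply/funext => x; exact: cp.
  rewrite -/h => h1.
  have h2 : al * (b - a) = I / 8 by rewrite /al; field; rewrite gt_eqF.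
  have h3 : h * V <= h * (Kb * I) by rewrite ler_wpM2l// ltW.
  have h4 : h * Kb * I <= 1 / 8 * I by rewrite ler_wpM2r.
  linear.
have [i iN Hi] := level psi vp p0 (fun=> erefl).
pose npsi x := -1 * psi x.
have vnp : varle npsi V by have := varleZ (-1) vp; rewrite normrN1 mul1r.
have [j jN Hj] := level npsi vnp ltac:(by rewrite primZ// p0 mulr0)
  (fun x => ltac:(by rewrite /npsi !mulN1r normrN)).
pose X := iter n L (ppart psi); pose Y := iter n L (ppart npsi).
have eX : iter n L psi = (fun x => X x + (-1) * Y x).
  have e : (fun x => ppart psi x + (-1) * ppart npsi x) = psi.
    by apply/funext => x; rewrite /ppart /npsi !mulN1r normrN; field.
  by rewrite -[in LHS]e iter_opD (iter_opZ _ _ (-1) (ppart npsi)).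
have eY : iter n L (fun x => `|psi x|) = (fun x => X x + Y x).
  have e : (fun x => ppart psi x + ppart npsi x) = (fun x => `|psi x|).
    by apply/funext => x; rewrite /ppart /npsi !mulN1r normrN; field.
  by rewrite -e iter_opD.
have X0 x : 0 <= X x by apply: iter_op_ge0 => y; exact: ppart_ge0.
have Y0 x : 0 <= Y x by apply: iter_op_ge0 => y; exact: ppart_ge0.
have near_ij k (chi : R -> R) x : (k < N)%N -> (forall y, 0 <= chi y) ->
    (forall y, t k < y < t k.+1 -> al <= chi y) ->
    q1 < x < q2 -> ~ (exists m, x = iter m f c) -> l ^+ n * al <= iter n L chi x.
  move=> kN chi0 Hk /andP[x1 x2] nA.
  have [y /andP[y1 y2] e] := Hn k kN x ltac:(by rewrite !ltW).
  rewrite -e (le_trans _ (iter_lower chi0 _))//.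
    by apply: ler_wpM2l; [exact: ltW|apply: Hk; rewrite y1].
  apply: (orbit_inside _ _ e); last by move=> m _ xm; apply: nA; exists m.
  - by rewrite (le_lt_trans _ y1)// lerDl mulr_ge0// ltW.
  - exact: lt_le_trans y2 (tb _ kN).
  - exact: lt_trans x1.
have HX x := @near_ij i (ppart psi) x iN (ppart_ge0 psi)
  (fun y h => le_trans (Hi y h) (ppart_ge psi y)).
have HY x := @near_ij j (ppart npsi) x jN (ppart_ge0 npsi)
  (fun y h => le_trans (Hj y h) (ppart_ge npsi y)).
have [V1 vV1] := varle_iter S n wv vp.
have [V2 vV2] := varle_iter S n wv (varle_norm vp).
(* Where both [X] and [Y] are at least [l ^+ n * al], the absolute value of [X - Y] falls short of
   [X + Y] by twice that amount. This is known off the critical orbit, a countable set. *)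
pose q x : R := if q1 < x < q2 then 2 * (l ^+ n * al) else 0.
have nq : nice q by apply: (nice_cut _ _ (nice_cst _)).
have n1' := nice_norm (varle_nice vV1); have n2' := varle_nice vV2.
have h1 : prim a (fun x => `|iter n L psi x| + q x) b <= prim a (iter n L (fun x => `|psi x|)) b.
  apply: (@prim_le_eqc _ _ _ _ _ [set x | exists m, x = iter m f c]) => //.
  - exact: niceD.
  - exact: ltW.
  - have -> : [set x | exists m, x = iter m f c] = \bigcup_m [set iter m f c].
      by apply/seteqP; split => x /= [m]; [move=> ->|move=> _ ->]; exists m.
    by apply: bigcup_countable.
  - move=> x _ _ nA; rewrite eX eY /q.
    have hx := X0 x; have hy := Y0 x.
    case: ifP => xq.
      have := HX x xq nA; have := HY x xq nA; rewrite -/X -/Y => h1 h2.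
      by case: (ler0P (X x + -1 * Y x)) => ?; linear.
    by case: (ler0P (X x + -1 * Y x)) => ?; linear.
rewrite primD// (prim_iter S n wv (varle_norm vp)) -/I in h1.
have h2 : prim a q b = 2 * (l ^+ n * al) * (q2 - q1).
  have q2b : q2 <= b by rewrite (le_trans (ltW q2d)) ?(sy_d S).
  have e1 : prim a q q1 = 0.
    have := @prim_eq _ a q (cst 0) a q1 nq (nice_cst _) (lexx _) (ltW aq1).
    rewrite (prim_cst 0 (lexx a) (ltW aq1)) mul0r prim_base subr0; apply => x _ xq.
    by rewrite /q (lt_gtF xq).
  have e2 : prim a q b - prim a q q2 = 0.
    have := @prim_eq _ a q (cst 0) q2 b nq (nice_cst _) (ltW (lt_trans aq1 q12)) q2b.
    rewrite (prim_cst 0 (ltW (lt_trans aq1 q12)) q2b) mul0r; apply => x xq _.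
    by rewrite /q (lt_gtF xq) andbF.
  have := @prim_eq _ a q (cst (2 * (l ^+ n * al))) q1 q2 nq (nice_cst _) (ltW aq1) (ltW q12).
  rewrite (prim_cst _ (ltW aq1) (ltW q12)).
  have H x : q1 < x -> x < q2 -> q x = cst (2 * (l ^+ n * al)) x.
    by move=> h3 h4; rewrite /q h3 h4.
  move=> /(_ H); linear.
have h3 : 2 * (l ^+ n * al) * (q2 - q1) = dl0 * I.
  by rewrite /dl0 /al; field; rewrite gt_eqF.
have h4 : Num.min (1 / 2) dl0 * I <= dl0 * I.
  by rewrite ler_wpM2r// ge_min lexx orbT.
linear.
Qed.

End Contraction.

(** * Exponential decay in variation and in L^1 *)

Section Decay.
Context {R : realType}.
Implicit Types (F psi chi w : R -> R).
Context {a c b d l r K : R} {f gp gm v : R -> R}.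
Hypothesis S : system a c b d f gp gm v l r K.
Let ab := sy_ab S.
Notation I psi := (prim a (fun x => `|psi x|) b).

Lemma small_power (k : R) : 0 <= k -> k < 1 -> exists2 m, (0 < m)%N & 3 * k ^+ m <= 1 / 2.
Proof.
move=> k0 k1; have := @cvg_geometric R 3 k; rewrite ger0_norm// => /(_ k1).
move=> /cvgrPdist_le /(_ (1/2) ltac:(linear)) [N _ H].
exists N.+1 => //; have := H N.+1 (leqnSn N); rewrite /= sub0r normrN.
by move=> h; exact: le_trans (ler_norm _) h.
Qed.

Lemma supported_bound psi V : varle psi V -> (forall x, ~~ (a < x < b) -> psi x = 0) ->
  I psi <= (b - a) * V.
Proof.
move=> vp out; have := prim_lip (nice_norm (varle_nice vp)) (lexx a) (ltW ab) (M := V).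
rewrite prim_base subr0 mulrC => H; apply: le_trans (ler_norm _) (H _) => x _ _.
rewrite normr_id; have := varle_osc a x vp.
by rewrite (out a) ?ltxx// subr0.
Qed.

Lemma iter_op_out w m psi : (forall x, ~~ (a < x < b) -> psi x = 0) ->
  forall x, ~~ (a < x < b) -> iter m (@op _ a d gp gm w) psi x = 0.
Proof.
case: m => [//|m] out x nx; rewrite iterS op_out//.
apply: contra nx => /andP[-> xd] /=; exact: lt_le_trans (sy_d S).
Qed.

(** Variation and L^1 norm both contract, so for a large weight [E] the quantity [V + E * I psi]
    shrinks by a fixed factor over [m] steps. *)
Lemma variation_decay w W L Bd : @weight _ a c b v w W L Bd -> W < 1 -> Bd < 1 ->
  exists C k, [/\ 0 <= C, 0 < k, k < 1 & forall psi V, varle psi V ->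
    (forall x, ~~ (a < x < b) -> psi x = 0) ->
    forall j, varle (iter j (@op _ a d gp gm w) psi) (C * k ^+ j * V)].
Proof.
move=> ww W1 B1.
have W0 : 0 <= W by exact: le_trans (normr_ge0 _) (wt_le ww 0).
have B0 := wt_B0 ww.
pose kap := (1 + W) / 2.
have [kap0 kap1 Wkap] : [/\ 0 <= kap, kap < 1 & W < kap] by rewrite /kap; split; linear.
have [m m0 Hm] := small_power kap0 kap1.
have LYs s := LY_supported S s ww kap0 Wkap.
have [C0 C00 H0] := LYs m.
(* Uniform bounds for the fewer than [m] steps that remain after the last full block. *)
have [A A0 HA] : exists2 A, 0 <= A & forall s, (s < m)%N -> forall psi V, varle psi V ->
    (forall x, ~~ (a < x < b) -> psi x = 0) ->
    varle (iter s (@op _ a d gp gm w) psi) (3 * V + A * I psi).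
  elim: m {m0 Hm H0} => [|m [A A0 HA]]; first by exists 0.
  have [C Cge H] := LYs m.
  exists (A + C); first exact: addr_ge0.
  move=> s; rewrite ltnS leq_eqVlt => /orP[/eqP ->|sm] psi V vp out.
    apply: varleW (H psi V vp out).
    have V0 := varle_ge0 vp; have I0 : 0 <= I psi by exact: prim_abs_ge0.
    have h1 : kap ^+ m <= 1 by rewrite exprn_ile1// ltW.
    have h2 : kap ^+ m * V <= 1 * V by rewrite ler_wpM2r.
    have h3 : 0 <= A * I psi by rewrite mulr_ge0.
    linear.
  apply: varleW (HA s sm psi V vp out).
  have I0 : 0 <= C * I psi by rewrite mulr_ge0//; exact: prim_abs_ge0.
  linear.
(* Large enough for [C0 + E * Bd <= E * ((1 + Bd) / 2)]: the L^1 term created by the Lasota-Yorke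
   inequality is absorbed. *)
pose E := 2 * C0 / (1 - Bd) + 1.
have E1 : 1 <= E by rewrite lerDr divr_ge0// ?mulr_ge0//; linear.
pose k0 := Num.max (1 / 2) ((1 + Bd) / 2).
have k00 : 0 <= k0 by rewrite le_max; apply/orP; left; linear.
have k01 : k0 < 1 by rewrite gt_max; apply/andP; split; linear.
have kh : 1 / 2 <= k0 by rewrite le_max lexx.
have kB : (1 + Bd) / 2 <= k0 by rewrite le_max lexx orbT.
have blk psi V q : varle psi V -> (forall x, ~~ (a < x < b) -> psi x = 0) ->
    exists2 Vq, varle (iter (q * m) (@op _ a d gp gm w) psi) Vq &
      Vq + E * I (iter (q * m) (@op _ a d gp gm w) psi) <= k0 ^+ q * (V + E * I psi).
  move=> vp out; elim: q => [|q [Vq vq hq]].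
    by exists V => //=; rewrite expr0 mul1r.
  set chi := iter _ _ _ in vq hq.
  have outq := iter_op_out w (q * m) out.
  have := H0 chi Vq vq outq; rewrite /chi -iterD -mulSn -/chi => h1.
  eexists; first exact: h1.
  have Iq0 : 0 <= I chi by exact: prim_abs_ge0.
  have Vq0 := varle_ge0 vq.
  have h2 : I (iter (q.+1 * m) (@op _ a d gp gm w) psi) <= Bd * I chi.
    rewrite mulSn iterD -/chi (le_trans (prim_iter_abs S m ww vq))// ler_wpM2r//.
    by rewrite -(prednK m0) exprS ler_piMr// exprn_ile1// ltW.
  have h3 : E * I (iter (q.+1 * m) (@op _ a d gp gm w) psi) <= E * (Bd * I chi).
    by rewrite ler_wpM2l//; linear.
  have h4 : 3 * kap ^+ m * Vq <= 1 / 2 * Vq by rewrite ler_wpM2r.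
  have h5 : C0 + E * Bd <= E * ((1 + Bd) / 2).
    have : C0 <= E * ((1 - Bd) / 2); last linear.
    have -> : E * ((1 - Bd) / 2) = C0 + (1 - Bd) / 2 by rewrite /E; field; rewrite gt_eqF//; linear.
    linear.
  have h6 : (C0 + E * Bd) * I chi <= E * ((1 + Bd) / 2) * I chi by rewrite ler_wpM2r.
  have h7 : E * ((1 + Bd) / 2) * I chi <= k0 * (E * I chi).
    have EB : 0 <= E * ((1 + Bd) / 2) by rewrite mulr_ge0//; linear.
    have := ler_wpM2r Iq0 kB => h; have := ler_wpM2l (_ : 0 <= E) h.
    by move=> /(_ ltac:(linear)); linear.
  have h8 : 1 / 2 * Vq <= k0 * Vq by rewrite ler_wpM2r.
  have h9 := ler_wpM2l k00 hq.
  rewrite exprS -mulrA; linear.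
have [C' [k [C'0 kpos k1 Hk]]] := geometric_of_block m0 k00 k01.
have E0 : 0 <= E by linear.
have Eba : 0 <= E * (b - a) by rewrite mulr_ge0// subr_ge0 ltW.
exists ((3 + A) * (1 + E * (b - a)) * C'), k; split => //.
  by rewrite mulr_ge0// mulr_ge0//; linear.
move=> psi V vp out j.
have [Vq vq hq] := blk psi V (j %/ m)%N vp out.
have outq := iter_op_out w (j %/ m * m) out.
have := HA (j %% m)%N (ltn_pmod j m0) _ _ vq outq.
rewrite -iterD addnC -divn_eq; apply: varleW.
set J := I _ in hq *.
have J0 : 0 <= J by exact: prim_abs_ge0.
have V0 := varle_ge0 vp; have Vq0 := varle_ge0 vq.
have EJ : J <= E * J by rewrite ler_peMl.
have AV : 0 <= A * Vq by rewrite mulr_ge0.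
have AJ : A * J <= A * (E * J) by rewrite ler_wpM2l.
have h1 : 3 * Vq + A * J <= (3 + A) * (Vq + E * J) by linear.
have h2 := ler_wpM2l (_ : 0 <= 3 + A) hq.
have h3 : V + E * I psi <= (1 + E * (b - a)) * V.
  have := ler_wpM2l E0 (supported_bound vp out); linear.
have h4 := Hk j.
have k0q : 0 <= k0 ^+ (j %/ m) by rewrite exprn_ge0.
have h5 := ler_wpM2l k0q h3.
have EV : 0 <= (1 + E * (b - a)) * V by rewrite mulr_ge0//; linear.
have h6 := ler_wpM2r EV h4.
have h7 : (3 + A) * (k0 ^+ (j %/ m) * (V + E * I psi)) <=
    (3 + A) * (C' * k ^+ j * ((1 + E * (b - a)) * V)).
  by apply: ler_wpM2l; [linear|exact: le_trans h5 h6].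
rewrite (le_trans h1)// (le_trans (h2 _))//; first linear.
rewrite (le_trans h7)// le_eqVlt; apply/orP; left; apply/eqP; ring.
Qed.

(** The quantity [I psi + e * V] contracts in both regimes. If [V] is at most [8 * C1 * I psi],
    cancellation lowers the L^1 norm; otherwise the variation dominates and the Lasota-Yorke
    inequality, which halves it up to an L^1 term, pays for everything. *)
Lemma spectral_gap q1 q2 : @weight _ a c b v v r K 1 ->
  a < q1 -> q1 < q2 -> q2 < d -> @covers _ a b f q1 q2 ->
  exists C k, [/\ 0 <= C, 0 < k, k < 1 & forall psi V, varle psi V ->
    (forall x, ~~ (a < x < b) -> psi x = 0) -> prim a psi b = 0 ->
    forall j, I (iter j (@op _ a d gp gm v) psi) <= C * k ^+ j * V].
Proof.
move=> wv aq1 q12 q2d cov.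
have r0 := br_r0 (sy_p S); have r1 := br_r (sy_p S).
pose kap := (1 + r) / 2.
have [kap0 kap1 Wkap] : [/\ 0 <= kap, kap < 1 & r < kap] by rewrite /kap; split; linear.
have [m m0 Hm] := small_power kap0 kap1.
have [C0 C00 H0] := LY_supported S m wv kap0 Wkap.
(* A bound that reproduces itself: [C1 / 2 + C0 <= C1]. *)
pose C1 := 2 * C0 + 1.
have C10 : 0 < C1 by rewrite /C1; linear.
have LYq psi V q : varle psi V -> (forall x, ~~ (a < x < b) -> psi x = 0) ->
    varle (iter (q * m) (@op _ a d gp gm v) psi) ((1 / 2) ^+ q * V + C1 * I psi).
  move=> vp out; have I0 : 0 <= I psi by exact: prim_abs_ge0.
  elim: q => [|q IH].
    by apply: varleW vp; rewrite expr0 mul1r lerDl mulr_ge0// ltW.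
  have := H0 _ _ IH (iter_op_out v (q * m) out).
  rewrite -iterD -mulSn; apply: varleW.
  have h1 := prim_iter_abs S (q * m) wv vp; rewrite expr1n mul1r in h1.
  have h2 := ler_wpM2l C00 h1.
  have V0 := varle_ge0 IH.
  have h3 := ler_wpM2r V0 Hm.
  have CI : 0 <= C0 * I psi by rewrite mulr_ge0.
  rewrite exprS -mulrA; rewrite /C1 in h3 *; linear.
have C18 : 0 < 8 * C1 by linear.
have [n1 Hn1] := mean_zero_contraction S wv aq1 q12 q2d cov C18.
(* A multiple of [m], so that the block estimate applies, and at least [n1]. *)
pose n := (n1.+1 * m)%N.
have n0 : (0 < n)%N by rewrite muln_gt0.
have [dl /andP[dl0 dl1] Hdl] := Hn1 n (leq_trans (leqnSn n1) (leq_pmulr _ m0)).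
(* The L^1 term [e * C1 * I psi] then uses up half of the gain [dl * I psi]. *)
pose e := dl / (2 * C1).
have e0 : 0 < e by rewrite divr_gt0// mulr_gt0.
have eC : e * C1 = dl / 2 by rewrite /e; field; rewrite gt_eqF.
pose k0 := 1 - dl / 2.
have [k00 k01] : 0 <= k0 /\ k0 < 1 by rewrite /k0; split; linear.
have step psi V : varle psi V -> (forall x, ~~ (a < x < b) -> psi x = 0) ->
    prim a psi b = 0 -> exists2 V', varle (iter n (@op _ a d gp gm v) psi) V' &
      I (iter n (@op _ a d gp gm v) psi) + e * V' <= k0 * (I psi + e * V).
  move=> vp out p0; have V0 := varle_ge0 vp.
  have I0 : 0 <= I psi by exact: prim_abs_ge0.
  exists (1 / 2 * V + C1 * I psi).
    apply: varleW (LYq _ _ n1.+1 vp out); rewrite lerD2r ler_wpM2r//.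
    by rewrite exprS ler_piMr// ?exprn_ile1//; linear.
  have -> : e * (1 / 2 * V + C1 * I psi) = 1 / 2 * (e * V) + dl / 2 * I psi.
    by rewrite -eC; ring.
  have eV0 : 0 <= e * V by rewrite mulr_ge0// ltW.
  have h0 : 0 <= dl * (e * V) by rewrite mulr_ge0// ltW.
  have h0' : dl * (e * V) <= 1 / 2 * (e * V) by rewrite ler_wpM2r.
  have [hV|hV] := leP V (8 * C1 * I psi).
    have := Hdl psi V vp p0 hV; rewrite /k0; linear.
  have h1 := prim_iter_abs S n wv vp; rewrite expr1n mul1r in h1.
  have h2 : dl * I psi <= e * V / 4.
    have -> : dl * I psi = e * (8 * C1 * I psi) / 4.
      have -> : e * (8 * C1 * I psi) / 4 = 2 * (e * C1) * I psi by field.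
      by rewrite eC; field.
    by rewrite ler_wpM2r ?invr_ge0// ler_wpM2l ?ltW.
  rewrite /k0; linear.
have blk psi V q : varle psi V -> (forall x, ~~ (a < x < b) -> psi x = 0) ->
    prim a psi b = 0 -> exists2 Vq, varle (iter (q * n) (@op _ a d gp gm v) psi) Vq &
      I (iter (q * n) (@op _ a d gp gm v) psi) + e * Vq <= k0 ^+ q * (I psi + e * V).
  move=> vp out p0; elim: q => [|q [Vq vq hq]]; first by exists V => //=; rewrite expr0 mul1r.
  have pq : prim a (iter (q * n) (@op _ a d gp gm v) psi) b = 0 by rewrite (prim_iter S _ wv vp).
  have [V' v' h'] := step _ _ vq (iter_op_out v (q * n) out) pq.
  exists V'; rewrite mulSn iterD//.
  by rewrite (le_trans h')// exprS -mulrA ler_wpM2l.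
have [C' [k [C'0 kpos k1 Hk]]] := geometric_of_block n0 k00 k01.
exists ((b - a + e) * C'), k; split => //.
  by rewrite mulr_ge0// addr_ge0 ?(ltW e0)// subr_ge0 ltW.
move=> psi V vp out p0 j.
have [Vq vq hq] := blk psi V (j %/ n)%N vp out p0.
have V0 := varle_ge0 vp.
rewrite {1}(divn_eq j n) addnC iterD.
have h1 := prim_iter_abs S (j %% n) wv vq; rewrite expr1n mul1r in h1.
rewrite (le_trans h1)//.
have h2 : 0 <= e * Vq by rewrite mulr_ge0 ?(ltW e0)// (varle_ge0 vq).
have h3 : I psi + e * V <= (b - a + e) * V by have := supported_bound vp out; linear.
have k0q : 0 <= k0 ^+ (j %/ n) by rewrite exprn_ge0.
have h4 := ler_wpM2l k0q h3.
have E0 : 0 <= (b - a + e) * V by rewrite mulr_ge0// addr_ge0 ?(ltW e0)// subr_ge0 ltW.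
have h5 := ler_wpM2r E0 (Hk j).
linear.
Qed.

End Decay.

Section BranchExists.
Context {R : realType}.

Lemma branch_exists (a d al be s l r K : R) (f v : R -> R) :
  al < be -> a <= al -> a <= d ->
  (s = 1 /\ f al = a /\ f be = d) \/ (s = -1 /\ f al = d /\ f be = a) ->
  {within `[al, be], continuous f} -> 0 < l -> r < 1 ->
  (forall y, al < y -> y < be -> l <= v y <= r) ->
  (forall u t, al <= u -> u < t -> t <= be ->
    exists2 xi, u < xi < t & s * (f t - f u) * v xi = t - u) ->
  (forall x y, al < x -> x <= y -> y < be -> `|v y - v x| <= K * (y - x)) ->
  exists g, branch a d f al be s v g l r K.
Proof.
move=> ab aal ad ends cf l0 r1 hv mvt lip.
have mono u t : al <= u -> u < t -> t <= be -> s * f u < s * f t.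
  move=> alu ut tbe; have [xi /andP[h1 h2] e] := mvt u t alu ut tbe.
  have /andP[v1 _] := hv xi (le_lt_trans alu h1) (lt_le_trans h2 tbe).
  rewrite -subr_gt0 -mulrBr -(pmulr_lgt0 _ (_ : 0 < v xi)); last linear.
  by rewrite e subr_gt0.
have wmono u t : al <= u -> u <= t -> t <= be -> s * f u <= s * f t.
  move=> alu; rewrite le_eqVlt => /orP[/eqP ->//|ut] tbe; exact/ltW/mono.
have inj u t : al <= u -> u <= be -> al <= t -> t <= be -> f u = f t -> u = t.
  move=> u1 u2 t1 t2 e; case: (ltgtP u t) => // h.
    by have := mono u t u1 h t2; rewrite e ltxx.
  by have := mono t u t1 h u2; rewrite e ltxx.
have fr t : al <= t -> t <= be -> a <= f t <= d.
  move=> t1 t2; have := wmono al t (lexx _) t1 t2; have := wmono t be t1 t2 (lexx _).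
  by case: ends => -[-> [-> ->]]; linear.
(* Clamping the argument first makes the inverse defined and monotone on the whole line. *)
have ex x : exists y, al <= y <= be /\ f y = clamp a d x.
  have /andP[c1 c2] := clamp_in x ad.
  have [|y] := @IVT _ f al be (clamp a d x) (ltW ab) cf.
    case: ends => -[_ [-> ->]]; rewrite ?(minC d) ?(maxC d) (min_idPl ad) (max_idPr ad).
      by rewrite c1.
    by rewrite c1.
  by rewrite in_itv/= => yin <-; exists y.
have [g Hg] := choice ex.
exists g; split => //.
- by case: ends => -[-> _]; [left|right].
- by move=> x; have [] := Hg x.
- move=> t t1 t2; have [/andP[g1 g2] e] := Hg (f t).
  have /andP[f1 f2] := fr t t1 t2.
  by apply: inj => //; rewrite e clamp_id.
- by move=> x ax xd; have [_ ->] := Hg x; rewrite clamp_id.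
- move=> x y xy; have [/andP[gx1 gx2] ex1] := Hg x; have [/andP[gy1 gy2] ey1] := Hg y.
  have cxy : clamp a d x <= clamp a d y by exact: clamp_homo.
  rewrite -ex1 -ey1 in cxy.
  case: ends => -[se _]; rewrite se ?mul1r ?mulN1r ?lerN2 leNgt; apply/negP => h.
    by have := mono _ _ gy1 h gx2; rewrite se !mul1r ltNge cxy.
  by have := mono _ _ gx1 h gy2; rewrite se !mulN1r ltrN2 ltNge cxy.
- by case: ends => -[_ [-> _]]; auto.
- by case: ends => -[_ [_ ->]]; auto.
Qed.

End BranchExists.

(** * From topological mixing to covering a fixed interval *)

Section Covering.
Context {R : realType}.
Context {a c b d l r K : R} {f gp gm v : R -> R}.
Hypothesis S : system a c b d f gp gm v l r K.
Hypothesis cf : {within `[a, b], continuous f}.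
Let ac := sy_ac S.
Let cb := sy_cb S.
Let ab := sy_ab S.
Let ad := sy_ad S.

Lemma sy_cd : c < d.
Proof.
have [fa fc fb] := sy_fE S.
have [h _] := br_expand (sy_p S) (lexx a) (ltW ac) (lexx c).
rewrite fa fc mul1r in h; have r1 := br_r (sy_p S).
have : r * (d - a) < 1 * (d - a) by rewrite ltr_pM2r// subr_gt0.
linear.
Qed.

(** By expansion [[c, d]] is shorter than its image [[f d, d]], so the image extends beyond [c] to
    the left. *)
Lemma sy_c2 : a <= f d /\ f d < c.
Proof.
have [fa fc fb] := sy_fE S; have cd := sy_cd.
have [h _] := br_expand (sy_m S) (lexx c) (ltW cd) (sy_d S).
split; first by have /andP[] := sy_f_in S (ltW ad) (sy_d S).
rewrite fc mulN1r opprB in h; have r1 := br_r (sy_p S).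
have dfd : f d < d.
  have : 0 < r * (d - f d) by linear.
  by rewrite (pmulr_rgt0 _ (br_r0 (sy_p S))) subr_gt0.
have : r * (d - f d) < 1 * (d - f d) by rewrite ltr_pM2r// subr_gt0.
linear.
Qed.

(** An interval to the left of [f d] lies in the increasing branch and is stretched by at least
    [r^-1]. As lengths cannot exceed [b - a], it meets the core [[f d, d]] after finitely many
    steps. *)
Lemma reach_core n x y : a <= x -> x < y -> y <= b -> x < d ->
  b - a < (r^-1) ^+ n * (y - x) ->
  exists k x' y', [/\ f d <= x', x' < y', y' <= d &
    forall z, x' <= z <= y' -> exists2 y0, x <= y0 <= y & iter k f y0 = z].
Proof.
have [c21 c22] := sy_c2; have cd := sy_cd; have r0 := br_r0 (sy_p S).
elim: n x y => [|n IH] x y ax xy yb xd hn.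
  by exfalso; move: hn; rewrite expr0 mul1r; linear.
have [yc2|c2y] := leP y (f d).
  have xc : x <= c by linear.
  have yc : y <= c by linear.
  have [h _] := br_expand (sy_p S) ax (ltW xy) yc.
  rewrite mul1r in h.
  have fxy : f x < f y.
    have : 0 < r * (f y - f x) by linear.
    by rewrite (pmulr_rgt0 _ r0) subr_gt0.
  have /andP[fx1 fx2] := sy_f_in S ax (le_trans (ltW xy) yb).
  have /andP[fy1 fy2] := sy_f_in S (le_trans ax (ltW xy)) yb.
  have [|k [x' [y' [h1 h2 h3 h4]]]] := IH (f x) (f y) fx1 fxy (le_trans fy2 (sy_d S)) (lt_le_trans fxy fy2).
    rewrite (lt_le_trans hn)// exprSr -mulrA ler_wpM2l//.
      by rewrite exprn_ge0// invr_ge0 ltW.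
    by rewrite mulrC ler_pdivrMr// mulrC.
  exists k.+1, x', y'; split => // z zin; have [y0 /andP[y01 y02] e] := h4 z zin.
  have ay0 := le_trans fx1 y01; have y0d := le_trans y02 fy2.
  have fg := br_fg (sy_p S) ay0 y0d.
  exists (gp y0); last by rewrite iterSr fg.
  have := br_gmono (sy_p S) y01; have := br_gmono (sy_p S) y02.
  by rewrite !mul1r (br_gf (sy_p S) ax xc) (br_gf (sy_p S) (le_trans ax (ltW xy)) yc) => -> ->.
exists 0%N, (Num.max x (f d)), (Num.min y d); split.
- by rewrite le_max lexx orbT.
- by rewrite gt_max !lt_min xy xd c2y; linear.
- by rewrite ge_min lexx orbT.
- move=> z; rewrite ge_max le_min => /andP[/andP[xz _] /andP[zy _]].
  by exists z => //; rewrite xz.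
Qed.

Lemma reach x y : a <= x -> x < y -> y <= b ->
  exists k x' y', [/\ f d <= x', x' < y', y' <= d &
    forall z, x' <= z <= y' -> exists2 y0, x <= y0 <= y & iter k f y0 = z].
Proof.
have [c21 c22] := sy_c2; have cd := sy_cd; have r0 := br_r0 (sy_p S).
have big u t : u < t -> exists n, b - a < (r^-1) ^+ n * (t - u).
  move=> ut; have := @cvg_geometric R (b - a) r; rewrite ger0_norm ?ltW//.
  move=> /(_ (br_r (sy_p S))) /cvgrPdist_lt /(_ (t - u)).
  rewrite subr_gt0 => /(_ ut) [n _ /(_ n (leqnn n))] /=.
  rewrite sub0r normrN => h; exists n.
  rewrite exprVn mulrC ltr_pdivlMr ?exprn_gt0//.
  exact: le_lt_trans (ler_norm _) h.
move=> ax xy yb; have [xd|dx] := ltP x d.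
  by have [n hn] := big _ _ xy; exact: reach_core hn.
(* An interval to the right of [d] is carried into [[a, d]] by one step of the decreasing branch. *)
have cx : c <= x by linear.
have cy : c <= y by linear.
have [h _] := br_expand (sy_m S) cx (ltW xy) yb.
have fyx : f y < f x.
  have : 0 < r * (-1 * (f y - f x)) by linear.
  by rewrite (pmulr_rgt0 _ r0); linear.
have /andP[fx1 fx2] := sy_f_in S ax (le_trans (ltW xy) yb).
have /andP[fy1 fy2] := sy_f_in S (le_trans ax (ltW xy)) yb.
have [n hn] := big _ _ fyx.
have [k [x' [y' [h1 h2 h3 h4]]]] := reach_core fy1 fyx (le_trans fx2 (sy_d S)) (lt_le_trans fyx fx2) hn.
exists k.+1, x', y'; split => // z zin; have [y0 /andP[y01 y02] e] := h4 z zin.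
have ay0 := le_trans fy1 y01; have y0d := le_trans y02 fx2.
have fg := br_fg (sy_m S) ay0 y0d.
exists (gm y0); last by rewrite iterSr fg.
have := br_gmono (sy_m S) y01; have := br_gmono (sy_m S) y02.
rewrite !mulN1r !lerN2 (br_gf (sy_m S) cx (le_trans (ltW xy) yb)).
by rewrite (br_gf (sy_m S) cy yb) => -> ->.
Qed.

Lemma iter_IVT n u t z : a <= u -> u <= t -> t <= b ->
  Num.min (iter n f u) (iter n f t) <= z <= Num.max (iter n f u) (iter n f t) ->
  exists2 y, u <= y <= t & iter n f y = z.
Proof.
elim: n u t => [|n IH] u t au ut tb.
  by rewrite /= (min_idPl ut) (max_idPr ut) => h; exists z.
rewrite !iterSr => h.
have tb' := le_trans au ut; have ub := le_trans ut tb.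
have /andP[fu1 fu2] := sy_f_in S au ub; have /andP[ft1 ft2] := sy_f_in S tb' tb.
have db := sy_d S.
have [y yin e] : exists2 y, Num.min (f u) (f t) <= y <= Num.max (f u) (f t) & iter n f y = z.
  have [ftu|/ltW fut] := leP (f u) (f t); first by apply: IH => //; exact: le_trans db.
  by apply: IH => //; [exact: le_trans db|rewrite minC maxC].
have cut : {within `[u, t], continuous f}.
  apply: continuous_subspaceW cf => x /=; rewrite !in_itv/= => /andP[ux xt].
  by rewrite (le_trans au ux) (le_trans xt tb).
have [y0 y0in e0] := IVT ut cut yin.
exists y0; first by move: y0in; rewrite in_itv.
by rewrite iterSr e0.
Qed.

(** Mixing is applied to neighbourhoods of the two ends of the core: at all large times the image
    has points left of [q1] and right of [q2], and the intermediate value theorem fills the gap. *)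
Lemma mixing_covers : mixing c f -> exists q1 q2, [/\ a < q1, q1 < q2, q2 < d & @covers _ a b f q1 q2].
Proof.
have [fa fc fb] := sy_fE S; have [c21 c22] := sy_c2; have cd := sy_cd.
rewrite /mixing fc => mix.
pose q1 := (2 * f d + d) / 3; pose q2 := (f d + 2 * d) / 3.
exists q1, q2; split; [rewrite /q1; linear|rewrite /q1 /q2; linear|rewrite /q2; linear|].
move=> x y ax xy yb.
(* The middle third of [(x, y)] yields preimages strictly inside. *)
have [k [x' [y' [h1 h2 h3 h4]]]] := @reach ((2 * x + y) / 3) ((x + 2 * y) / 3)
  ltac:(linear) ltac:(linear) ltac:(linear).
have oU : open (`]x', y'[%classic : set R) by exact: interval_open.
have J0 z : x' < z < y' -> (`[f d, d]%classic : set R) z.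
  by rewrite /= in_itv/=; linear.
have nU : (`]x', y'[%classic : set R) `&` `[f d, d]%classic !=set0.
  exists ((x' + y') / 2); apply: conj; last by apply: J0; linear.
  by rewrite /= in_itv/=; linear.
have nV1 : (`]f d - 1, q1[%classic : set R) `&` `[f d, d]%classic !=set0.
  by exists (f d); apply: conj; rewrite /= in_itv/= ?/q1; linear.
have nV2 : (`]q2, d + 1[%classic : set R) `&` `[f d, d]%classic !=set0.
  by exists d; apply: conj; rewrite /= in_itv/= ?/q2; linear.
have oV1 : open (`]f d - 1, q1[%classic : set R) by exact: interval_open.
have oV2 : open (`]q2, d + 1[%classic : set R) by exact: interval_open.
have [n1 Hn1] := mix _ _ oU oV1 nU nV1.
have [n2 Hn2] := mix _ _ oU oV2 nU nV2.
exists (k + maxn n1 n2)%N => n nn z /andP[z1 z2].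
have nk : (maxn n1 n2 <= n - k)%N by rewrite leq_subRL ?(leq_trans (leq_addr _ _) nn).
move: nk; rewrite geq_max => /andP[nk1 nk2].
have [_ [[u1 [u1in _] <-] [+ _]]] := Hn1 _ nk1; rewrite /= in_itv/= => /andP[_ f1].
have [_ [[u2 [u2in _] <-] [+ _]]] := Hn2 _ nk2; rewrite /= in_itv/= => /andP[f2 _].
have db := sy_d S.
move: u1in u2in; rewrite /= !in_itv/= => /andP[u11 u12] /andP[u21 u22].
have [y0 y0in e] : exists2 y0, x' <= y0 <= y' & iter (n - k) f y0 = z.
  have [u12'|/ltW u21'] := leP u1 u2.
    have [||||y0 /andP[p1 p2] e] := @iter_IVT (n - k) u1 u2 z; [linear|done|linear| |].
      rewrite ge_min le_max; apply/andP; split; apply/orP; [left|right]; linear.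
    by exists y0 => //; apply/andP; split; linear.
  have [||||y0 /andP[p1 p2] e] := @iter_IVT (n - k) u2 u1 z; [linear|done|linear| |].
    rewrite ge_min le_max; apply/andP; split; apply/orP; [right|left]; linear.
  by exists y0 => //; apply/andP; split; linear.
have [y1 /andP[p1 p2] e1] := h4 y0 y0in.
exists y1; first by apply/andP; split; linear.
by rewrite -(subnK (leq_trans (leq_addr _ _) nn)) iterD e1.
Qed.

End Covering.

(** * The model of a piecewise expanding unimodal map *)

Section OneSide.
Context {R : realType}.
Implicit Types (e g f : R -> R).

Lemma within_segment_proper (p q x : R) : p < q -> p <= x -> x <= q ->
  ProperFilter (within `[p, q]%classic x^').
Proof.
move=> pq px xq; apply: Build_ProperFilter_ex => P.
rewrite /within/= => /nbhs_ballP[e /= e0 He].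
have [y [py yq yx dy]] : exists y, [/\ p <= y, y <= q, y != x & `|x - y| < e].
  have [xltq|qx] := ltP x q.
    pose h := Num.min (e / 2) (q - x).
    have h0 : 0 < h by rewrite lt_min divr_gt0 ?subr_gt0.
    have hq : h <= q - x by rewrite ge_min lexx orbT.
    have he : h <= e / 2 by rewrite ge_min lexx.
    exists (x + h); split; [linear|linear|by rewrite gt_eqF//; linear|].
    by rewrite opprD addNKr normrN gtr0_norm//; linear.
  pose h := Num.min (e / 2) (x - p).
  have h0 : 0 < h by rewrite lt_min divr_gt0 ?subr_gt0//; linear.
  have hq : h <= x - p by rewrite ge_min lexx orbT.
  have he : h <= e / 2 by rewrite ge_min lexx.
  exists (x - h); split; [linear|linear|by rewrite lt_eqF//; linear|].
  by rewrite opprB addrC subrK gtr0_norm//; linear.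
by exists y; apply: (He y) => //=; rewrite in_itv/= py.
Qed.

Lemma deriv_in_quotient (A : set R) f e (x D : R) : is_derive x 1 e D ->
  f x = e x -> (\forall y \near x, A y -> f y = e y) ->
  (f y - f x) / (y - x) @[y --> within A x^'] --> D.
Proof.
move=> /is_derive1_caratheodory[g [Hg cg <-]] fx near_e.
have H : g y @[y --> within A x^'] --> g x.
  by apply: cvg_within_filter; apply: cvg_within_filter; exact: cg.
apply: cvg_trans H; apply: near_eq_cvg.
have H' : nbhs x [set y | y != x -> A y -> g y = (f y - f x) / (y - x)].
  apply: filterS near_e => y H' yx Ay; have yx0 : y - x != 0 by rewrite subr_eq0.
  by rewrite H'// fx Hg mulfK.
exact: H'.
Qed.

Lemma deriv_in_segment (p q x D : R) f e : p < q -> p <= x -> x <= q ->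
  is_derive x 1 e D -> f x = e x ->
  (\forall y \near x, `[p, q]%classic y -> f y = e y) ->
  deriv_in `[p, q] f x = D.
Proof.
move=> pq px xq de fx near_e; have PF := within_segment_proper pq px xq.
by apply: cvg_lim => //; exact: deriv_in_quotient de fx near_e.
Qed.

Lemma bounded_on_segment (p q : R) g : p <= q ->
  (forall x, p <= x -> x <= q -> {for x, continuous g}) ->
  exists2 M, 0 <= M & forall x, p <= x -> x <= q -> `|g x| <= M.
Proof.
move=> pq cg.
have cg' : {within `[p, q], continuous (fun x => `|g x|)}.
  apply: continuous_in_subspaceT => x /set_mem /=; rewrite in_itv/= => /andP[px xq].
  by apply: (@cvg_norm _ _ _ _ _ g (g x)); exact: cg.
have [z _ H] := EVT_max pq cg'.
exists `|g z| => // x px xq; apply: H; by rewrite in_itv/= px.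
Qed.

Lemma mvt_derive (p q : R) e e1 : p < q ->
  (forall x, p <= x -> x <= q -> is_derive x 1 e (e1 x)) ->
  exists2 xi, p < xi < q & e q - e p = e1 xi * (q - p).
Proof.
move=> pq de.
have [x||xi xin E] := @MVT _ e e1 p q pq.
- by rewrite in_itv/= => /andP[/ltW px /ltW xq]; exact: de.
- apply: derivable_within_continuous => x; rewrite in_itv/= => /andP[px xq].
  by have [] := de x px xq.
- by exists xi => //; move: xin; rewrite in_itv.
Qed.

Lemma lipschitz_derive (p q M : R) e e1 :
  (forall x, p <= x -> x <= q -> is_derive x 1 e (e1 x)) ->
  (forall x, p <= x -> x <= q -> `|e1 x| <= M) ->
  forall x y, p <= x -> x <= y -> y <= q -> `|e y - e x| <= M * (y - x).
Proof.
move=> de hM x y px; rewrite le_eqVlt => /orP[/eqP->|xy] yq.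
  by rewrite !subrr normr0 mulr0.
have [z zx|xi /andP[h1 h2] ->] := @mvt_derive x y e e1 xy.
  by move=> zy; apply: de; [exact: le_trans zx|exact: le_trans yq].
have yx : 0 < y - x by rewrite subr_gt0.
rewrite normrM (gtr0_norm yx); apply: ler_wpM2r; first exact: ltW.
apply: hM.
  exact: le_trans px (ltW h1).
exact: le_trans (ltW h2) yq.
Qed.

Lemma is_derive_continuous e (x D : R) : is_derive x 1 e D -> {for x, continuous e}.
Proof. by move=> [de _]; apply: differentiable_continuous; exact/derivable1_diffP. Qed.

Lemma Cr_is_derive r (U : set R) g k : Cr_on_open r U g -> (k < r)%N ->
  forall x, U x -> is_derive x 1 (derive1n k g) (derive1n k.+1 g x).
Proof.
move=> [_ H] kr x Ux; rewrite derive1nS derive1E; apply: derivableP.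
exact: H.
Qed.

Lemma is_derive_conv e g (x D D' : R) : e = g -> D = D' ->
  is_derive x 1 e D -> is_derive x 1 g D'.
Proof. by move=> -> ->. Qed.

(** [e] extends the branch, [e1] is its derivative, [V] is [1 / |f'|] and [Q] is the derivative of
    [V]. Three derivatives of [f] make [Q] Lipschitz. *)
Record side (al be s : R) (f e e1 V Q : R -> R) (l r K M : R) : Prop := Side {
  sd_l : 0 < l;
  sd_r : 0 < r < 1;
  sd_e : forall x, al <= x -> x <= be -> e x = f x;
  sd_der : forall x, al <= x -> x <= be -> is_derive x 1 e (e1 x);
  sd_e1 : forall x, al <= x -> x <= be -> e1 x != 0 /\ `|(e1 x)^-1| <= r;
  sd_V : forall x, V x = s / e1 x;
  sd_Vb : forall y, al < y -> y < be -> l <= V y <= r;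
  sd_dV : forall x, al <= x -> x <= be -> is_derive x 1 V (Q x);
  sd_VL : forall x y, al <= x -> x <= y -> y <= be -> `|V y - V x| <= K * (y - x);
  sd_QL : forall x y, al <= x -> x <= y -> y <= be -> `|Q y - Q x| <= K * (y - x);
  sd_QM : forall x, al <= x -> x <= be -> `|Q x| <= M;
  sd_K : 0 <= K; sd_M : 0 <= M
}.

Lemma side_exists (al be s : R) f : al < be -> s = 1 \/ s = -1 ->
  Cr_ext 3 `[al, be] f ->
  (forall x y, al <= x -> x < y -> y <= be -> s * f x < s * f y) ->
  1 < inf [set `|deriv_in `[al, be] f x| | x in `[al, be]%classic] ->
  exists e e1 V Q l r K M, side al be s f e e1 V Q l r K M.
Proof.
move=> ab hs [U [e [oU AU ef Ce]]] mono.
set lam := inf _ => lam1.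
have inU x : al <= x -> x <= be -> U x by move=> h1 h2; apply: AU; rewrite /= in_itv/= h1.
have efE x : al <= x -> x <= be -> e x = f x by move=> h1 h2; apply: ef; rewrite /= in_itv/= h1.
pose e1 := derive1n 1 e; pose e2 := derive1n 2 e; pose e3 := derive1n 3 e.
have d0 x : al <= x -> x <= be -> is_derive x 1 e (e1 x).
  by move=> h1 h2; exact: (Cr_is_derive Ce (isT : (0 < 3)%N) (inU x h1 h2)).
have d1 x : al <= x -> x <= be -> is_derive x 1 e1 (e2 x).
  by move=> h1 h2; exact: (Cr_is_derive Ce (isT : (1 < 3)%N) (inU x h1 h2)).
have d2 x : al <= x -> x <= be -> is_derive x 1 e2 (e3 x).
  by move=> h1 h2; exact: (Cr_is_derive Ce (isT : (2 < 3)%N) (inU x h1 h2)).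
have c3 x : al <= x -> x <= be -> {for x, continuous e3}.
  by move=> h1 h2; exact: (Ce.1 3%N (leqnn _) x (inU x h1 h2)).
have c1 x : al <= x -> x <= be -> {for x, continuous e1}.
  by move=> h1 h2; exact: is_derive_continuous (d1 x h1 h2).
have c2 x : al <= x -> x <= be -> {for x, continuous e2}.
  by move=> h1 h2; exact: is_derive_continuous (d2 x h1 h2).
have [M1 M10 hM1] := bounded_on_segment (ltW ab) c1.
have [M2 M20 hM2] := bounded_on_segment (ltW ab) c2.
have [M3 M30 hM3] := bounded_on_segment (ltW ab) c3.
have lamE x : al <= x -> x <= be -> lam <= `|e1 x|.
  move=> h1 h2; have <- : deriv_in `[al, be] f x = e1 x.
    apply: (@deriv_in_segment _ _ _ _ _ e) => //; [exact: d0|by rewrite efE|].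
    apply: (@filterE _ (nbhs x)) => y; rewrite /= in_itv/= => /andP[? ?].
    by rewrite efE.
  apply: ge_inf; last by exists x => //=; rewrite in_itv/= h1.
  by exists 0 => _ [y _ <-].
have e1n0 x : al <= x -> x <= be -> e1 x != 0.
  by move=> h1 h2; rewrite -normr_gt0 (lt_le_trans _ (lamE x h1 h2))//; linear.
have ss : s * s = 1 by case: hs => ->; ring.
have ns : `|s| = 1 by case: hs => ->; rewrite ?normrN normr1.
(* Expansion excludes a zero of the derivative. With the wrong sign, the slope function of
   Caratheodory would contradict monotonicity at some [x + h]. *)
have pos x : al < x -> x < be -> 0 < s * e1 x.
  move=> h1 h2; rewrite lt_neqAle eq_sym mulf_neq0 ?e1n0 ?(ltW h1) ?(ltW h2)//=; last first.
    by apply/eqP => s0; move: ss; rewrite s0 mulr0; linear.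
  rewrite leNgt; apply/negP => neg.
  have /is_derive1_caratheodory[g [Hg cg gx]] := d0 x (ltW h1) (ltW h2).
  have csg : {for x, continuous (fun y => s * g y)}.
    by apply: cvgM => //; exact: cvg_cst.
  have : \forall y \near x, s * g y < 0.
    have := @cvgr_lt _ _ (nbhs x) _ _ _ csg 0; apply; by rewrite /= gx.
  move=> /nbhs_ballP[eps /= eps0 Heps].
  pose h := Num.min (eps / 2) (be - x).
  have hp : 0 < h by rewrite lt_min divr_gt0 ?subr_gt0.
  have hq : h <= be - x by rewrite ge_min lexx orbT.
  have he : h <= eps / 2 by rewrite ge_min lexx.
  have := Heps (x + h); rewrite /ball /= opprD addNKr normrN gtr0_norm// => /(_ ltac:(linear)) sg.
  have := mono x (x + h) (ltW h1) ltac:(linear) ltac:(linear).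
  rewrite -(efE x) ?(ltW h1) ?(ltW h2)// -(efE (x + h)); [|linear|linear].
  have := Hg (x + h); rewrite addrAC subrr add0r => E.
  have : s * (e (x + h) - e x) < 0 by rewrite E mulrA nmulr_rlt0.
  linear.
have spE x : al < x -> x < be -> s * e1 x = `|e1 x|.
  by move=> h1 h2; rewrite -[LHS]gtr0_norm ?pos// normrM ns mul1r.
pose V x := s / e1 x; pose Q x := - s * e2 x / e1 x ^+ 2.
have dV x : al <= x -> x <= be -> is_derive x 1 V (Q x).
  move=> h1 h2; apply: is_derive_conv (is_deriveZ s (is_deriveV (e1n0 x h1 h2) (d1 x h1 h2))).
    by apply/funext => y.
  by rewrite /Q /GRing.scale /=; ring.
pose Q' x := - s * (e3 x / e1 x ^+ 2 - 2 * e2 x ^+ 2 / e1 x ^+ 3).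
have dQ x : al <= x -> x <= be -> is_derive x 1 Q (Q' x).
  move=> h1 h2; have n0 := e1n0 x h1 h2.
  have D1 := is_deriveV n0 (d1 x h1 h2); have D2 := d2 x h1 h2.
  apply: is_derive_conv (is_deriveZ (- s) (is_deriveM D2 (is_deriveM D1 D1))).
    apply/funext => y; rewrite -[LHS]/((- s) * (e2 y * ((e1 y)^-1 * (e1 y)^-1))).
    by rewrite /Q expr2 invfM; ring.
  rewrite -[LHS]/((- s) * (e2 x * ((e1 x)^-1 * (- (e1 x) ^- 2 * e2 x) +
    (e1 x)^-1 * (- (e1 x) ^- 2 * e2 x)) + ((e1 x)^-1 * (e1 x)^-1) * e3 x)).
  by rewrite /Q'; field.
have ie1 x : al <= x -> x <= be -> `|(e1 x)^-1| <= lam^-1.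
  by move=> h1 h2; rewrite normfV lef_pV2 ?posrE ?normr_gt0 ?e1n0 ?lamE//; linear.
have r01 : 0 < lam^-1 < 1 by rewrite invr_gt0 invf_lt1; linear.
have ie1' x : al <= x -> x <= be -> `|(e1 x)^-1| <= 1.
  by move=> h1 h2; rewrite (le_trans (ie1 x h1 h2))//; linear.
have QM x : al <= x -> x <= be -> `|Q x| <= M2.
  move=> h1 h2; rewrite /Q !normrM normrN ns mul1r -exprVn normrX.
  by rewrite (le_trans _ (hM2 x h1 h2))// ler_piMr// exprn_ile1 ?ie1'.
have Q'M x : al <= x -> x <= be -> `|Q' x| <= M3 + 2 * M2 ^+ 2.
  move=> h1 h2; rewrite /Q' !normrM normrN ns mul1r (le_trans (ler_normB _ _))//.
  rewrite !normrM -!exprVn !normrX (ger0_norm (ler0n R 2)) lerD//.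
    by rewrite -[leRHS]mulr1 ler_pM ?exprn_ge0 ?hM3// exprn_ile1 ?ie1'.
  rewrite -[leRHS]mulr1 ler_pM ?mulr_ge0 ?exprn_ge0//; last by rewrite exprn_ile1 ?ie1'.
  by rewrite ler_wpM2l// expr2 ler_pM ?hM2.
(* [M1 + 1] is a positive upper bound of [|f'|]. The Lipschitz constant adds the bounds of [Q] and
   of its derivative, so that it serves for both [V] and [Q]. *)
exists e, e1, V, Q, (M1 + 1)^-1, lam^-1, (M2 + (M3 + 2 * M2 ^+ 2)), M2.
have q0 : 0 <= 2 * M2 ^+ 2 by rewrite mulr_ge0 ?exprn_ge0.
split => //.
- by rewrite invr_gt0; linear.
- by move=> x h1 h2; split; [exact: e1n0|exact: ie1].
- move=> y h1 h2.
  have VE : V y = `|(e1 y)^-1|.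
    by rewrite normfV -spE// /V invfM; case: hs => ->; rewrite ?invrN invr1.
  have n0 := e1n0 y (ltW h1) (ltW h2).
  rewrite VE (ie1 y (ltW h1) (ltW h2)) andbT normfV lef_pV2 ?posrE ?normr_gt0//; last linear.
  by have := hM1 y (ltW h1) (ltW h2); linear.
- move=> x y px xy yq; rewrite (le_trans (lipschitz_derive dV QM px xy yq))//.
  by rewrite ler_wpM2r ?subr_ge0//; linear.
- move=> x y px xy yq; rewrite (le_trans (lipschitz_derive dQ Q'M px xy yq))//.
  by rewrite ler_wpM2r ?subr_ge0//; linear.
- linear.
Qed.

End OneSide.

Section Model.
Context {R : realType}.

(** The sign of [f'] away from [c]. *)
Definition sgc (c y : R) : R := if y < c then 1 else -1.

(* [v] is [1 / |f'|] and [q] its derivative. *)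
Record model (a b c : R) (f gp gm v q : R -> R) (l r K M : R) : Prop := Model {
  md_sys : system a c b (f c) f gp gm v l r K;
  md_w1 : @weight R a c b v v r K 1;
  md_qM : forall y, `|q y| <= M;
  md_qp : forall x y, a < x -> x <= y -> y < c -> `|q y - q x| <= K * (y - x);
  md_qm : forall x y, c < x -> x <= y -> y < b -> `|q y - q x| <= K * (y - x);
  md_vv : exists V, varle v V;
  md_vq : exists V, varle q V;
  md_ftcp : forall u t, a < u -> u <= t -> t < c -> v t - v u = prim a q t - prim a q u;
  md_ftcm : forall u t, c < u -> u <= t -> t < b -> v t - v u = prim a q t - prim a q u;
  md_dp : forall y, a < y -> y < c -> dmap a b f y = (v y)^-1;
  md_dm : forall y, c < y -> y < b -> dmap a b f y = - (v y)^-1;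
  md_da : v t @[t --> a^'+] --> (dmap a b f a)^-1;
  md_db : v t @[t --> b^'-] --> - (dmap a b f b)^-1;
  md_dr : forall y, a <= y -> y <= b -> y <> c -> `|(dmap a b f y)^-1| <= r
}.

Lemma varle_pieces (a b c K M : R) (h : R -> R) : a < c -> c < b -> 0 <= K ->
  (forall x, `|h x| <= M) ->
  (forall x y, a < x -> x <= y -> y < c -> `|h y - h x| <= K * (y - x)) ->
  (forall x y, c < x -> x <= y -> y < b -> `|h y - h x| <= K * (y - x)) ->
  (forall x, ~~ (a < x < c) -> ~~ (c < x < b) -> h x = 0) ->
  exists V, varle h V.
Proof.
move=> ac cb K0 hM Lp Lm out.
have M0 : 0 <= M by exact: le_trans (normr_ge0 _) (hM 0).
have -> : h = (fun x => (if a < x < c then h x else 0) + (if c < x < b then h x else 0)).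
  apply/funext => x; case: ifPn => [/andP[ax xc]|h1].
    by rewrite (lt_gtF xc) addr0.
  by case: ifPn => [|h2]; rewrite add0r// out.
have hK : {homo (fun x => K * x) : x y / x <= y} by move=> x y xy; rewrite ler_wpM2l.
have piece p t : p < t -> (forall x y, p < x -> x <= y -> y < t -> `|h y - h x| <= K * (y - x)) ->
    varle (fun x => if p < x < t then h x else 0) (K * t - K * p + 2 * M).
  move=> pt L; apply: varle_cut => //.
  - by move=> x /negbTE ->.
  - by move=> x; case: ifP => // _; rewrite normr0.
  - move=> x y px xy yt; rewrite px (lt_le_trans px xy) yt (le_lt_trans xy yt) /=.
    by rewrite -mulrBr; exact: L.
by eexists; apply: varleD; apply: piece.
Qed.

Lemma ftc_piece (a p t K : R) (v q V Q : R -> R) : a <= p -> nice q ->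
  (forall x, p < x -> x < t -> v x = V x /\ q x = Q x) ->
  (forall x, p <= x -> x <= t -> is_derive x 1 V (Q x)) ->
  (forall x y, p <= x -> x <= y -> y <= t -> `|Q y - Q x| <= K * (y - x)) -> 0 <= K ->
  forall u w, p < u -> u <= w -> w < t -> v w - v u = prim a q w - prim a q u.
Proof.
move=> ap nq E dV QL K0 u w pu uw wt.
pose Phi x := v x - prim a q x.
suff : Phi w = Phi u by rewrite /Phi; linear.
apply: (@subdivision_quadratic _ Phi (fun x => K * x)) => // x y ux.
rewrite le_eqVlt => /orP[/eqP->|xy] yw.
  by rewrite !subrr normr0 mul0r.
have px := lt_le_trans pu ux; have yt := le_lt_trans yw wt.
have [z zx|xi /andP[x1 x2] e] := @mvt_derive _ x y V Q xy.
  by move=> zy; apply: dV; [exact: le_trans (ltW px) zx|exact: le_trans zy (ltW yt)].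
have near z : x < z -> z < y -> `|q z - Q xi| <= K * (y - x).
  move=> xz zy; rewrite (E z (lt_trans px xz) (lt_trans zy yt)).2.
  have [h|/ltW h] := leP z xi.
    rewrite distrC (le_trans (QL z xi _ h _))//; try linear.
    by rewrite ler_wpM2l//; linear.
  rewrite (le_trans (QL xi z _ h _))//; try linear.
  by rewrite ler_wpM2l//; linear.
have H := @prim_near _ a q x y (Q xi) _ nq (le_trans ap (ltW px)) (ltW xy) near.
rewrite /Phi (E y (lt_trans px xy) yt).1 (E x px (lt_trans xy yt)).1.
have -> : V y - prim a q y - (V x - prim a q x) =
  - (prim a q y - prim a q x - Q xi * (y - x)) by rewrite -e; ring.
rewrite normrN (le_trans H)// le_eqVlt; apply/orP; left; apply/eqP; ring.
Qed.

Lemma model_exists (a b c : R) (f : R -> R) : unimodal 3 a b c f ->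
  exists gp gm v q l r K M, model a b c f gp gm v q l r K M.
Proof.
move=> U; have ac := uni_ac U; have cb := uni_cb U; have ab := lt_trans ac cb.
have incr x y : a <= x -> x < y -> y <= c -> 1 * f x < 1 * f y.
  move=> ax xy yc; rewrite !mul1r; apply: (uni_incr U) => //; rewrite in_itv/=; linear.
have decr x y : c <= x -> x < y -> y <= b -> -1 * f x < -1 * f y.
  move=> ax xy yc; rewrite !mulN1r ltrN2; apply: (uni_decr U) => //; rewrite in_itv/=; linear.
have [ep [ep1 [Vp [Qp [lp [rp [Kp [Mp Sp]]]]]]]] :=
  side_exists ac (or_introl erefl) (uni_Cr_left U) incr (uni_exp_left U).
have [em [em1 [Vm [Qm [lm [rm [Km [Mm Sm]]]]]]]] :=
  side_exists cb (or_intror erefl) (uni_Cr_right U) decr (uni_exp_right U).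
(* The value [0] at [a], [b], [c] and outside makes the bounds hold on the whole line. *)
pose v y := if a < y < c then Vp y else if c < y < b then Vm y else 0.
pose q y := if a < y < c then Qp y else if c < y < b then Qm y else 0.
have vp y : a < y -> y < c -> v y = Vp y by rewrite /v => -> ->.
have vm y : c < y -> y < b -> v y = Vm y.
  by move=> cy yb; rewrite /v (lt_gtF cy) andbF cy yb.
have qp y : a < y -> y < c -> q y = Qp y by rewrite /q => -> ->.
have qm y : c < y -> y < b -> q y = Qm y.
  by move=> cy yb; rewrite /q (lt_gtF cy) andbF cy yb.
pose l := Num.min lp lm; pose r := Num.max rp rm.
pose K := Num.max Kp Km; pose M := Num.max Mp Mm.
have l0 : 0 < l by rewrite lt_min (sd_l Sp) (sd_l Sm).
have r1 : r < 1.
  by rewrite gt_max; have /andP[_ ->] := sd_r Sp; have /andP[_ ->] := sd_r Sm.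
have [rpr rmr] : rp <= r /\ rm <= r by rewrite !le_max !lexx orbT.
have [KpK KmK] : Kp <= K /\ Km <= K by rewrite !le_max !lexx orbT.
have [MpM MmM] : Mp <= M /\ Mm <= M by rewrite !le_max !lexx orbT.
have [lpl lml] : l <= lp /\ l <= lm by rewrite !ge_min !lexx orbT.
have K0 : 0 <= K by rewrite (le_trans _ KpK)// (sd_K Sp).
have M0 : 0 <= M by rewrite (le_trans _ MpM)// (sd_M Sp).
have r0 : 0 <= r by have /andP[/ltW h _] := sd_r Sp; exact: le_trans rpr.
have Lp x y : a < x -> x <= y -> y < c -> `|v y - v x| <= K * (y - x).
  move=> ax xy yc; rewrite !vp//; [|exact: le_lt_trans yc|exact: lt_le_trans xy].
  rewrite (le_trans (sd_VL Sp (ltW ax) xy (ltW yc)))// ler_wpM2r// subr_ge0//.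
have Lm x y : c < x -> x <= y -> y < b -> `|v y - v x| <= K * (y - x).
  move=> ax xy yc; rewrite !vm//; [|exact: le_lt_trans yc|exact: lt_le_trans xy].
  rewrite (le_trans (sd_VL Sm (ltW ax) xy (ltW yc)))// ler_wpM2r// subr_ge0//.
have QLp x y : a < x -> x <= y -> y < c -> `|q y - q x| <= K * (y - x).
  move=> ax xy yc; rewrite !qp//; [|exact: le_lt_trans yc|exact: lt_le_trans xy].
  rewrite (le_trans (sd_QL Sp (ltW ax) xy (ltW yc)))// ler_wpM2r// subr_ge0//.
have QLm x y : c < x -> x <= y -> y < b -> `|q y - q x| <= K * (y - x).
  move=> ax xy yc; rewrite !qm//; [|exact: le_lt_trans yc|exact: lt_le_trans xy].
  rewrite (le_trans (sd_QL Sm (ltW ax) xy (ltW yc)))// ler_wpM2r// subr_ge0//.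
have bp y : a < y -> y < c -> l <= v y <= r.
  move=> ay yc; rewrite vp//; have /andP[h1 h2] := sd_Vb Sp ay yc.
  by rewrite (le_trans lpl h1) (le_trans h2 rpr).
have bm y : c < y -> y < b -> l <= v y <= r.
  move=> ay yc; rewrite vm//; have /andP[h1 h2] := sd_Vb Sm ay yc.
  by rewrite (le_trans lml h1) (le_trans h2 rmr).
have mp u t : a <= u -> u < t -> t <= c ->
    exists2 xi, u < xi < t & 1 * (f t - f u) * v xi = t - u.
  move=> au ut tc.
  have [z uz zt|xi /andP[x1 x2] e] := @mvt_derive _ u t ep ep1 ut.
    by apply: (sd_der Sp); [exact: le_trans uz|exact: le_trans zt tc].
  exists xi; first by rewrite x1.
  have axi := le_lt_trans au x1; have xic := lt_le_trans x2 tc.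
  have et : ep t = f t by apply: (sd_e Sp); linear.
  have eu : ep u = f u by apply: (sd_e Sp); linear.
  rewrite -et -eu e.
  rewrite vp// (sd_V Sp); have [n0 _] := sd_e1 Sp (ltW axi) (ltW xic).
  by field.
have mm u t : c <= u -> u < t -> t <= b ->
    exists2 xi, u < xi < t & -1 * (f t - f u) * v xi = t - u.
  move=> au ut tc.
  have [z uz zt|xi /andP[x1 x2] e] := @mvt_derive _ u t em em1 ut.
    by apply: (sd_der Sm); [exact: le_trans uz|exact: le_trans zt tc].
  exists xi; first by rewrite x1.
  have axi := le_lt_trans au x1; have xic := lt_le_trans x2 tc.
  have et : em t = f t by apply: (sd_e Sm); linear.
  have eu : em u = f u by apply: (sd_e Sm); linear.
  rewrite -et -eu e.
  rewrite vm// (sd_V Sm); have [n0 _] := sd_e1 Sm (ltW axi) (ltW xic).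
  by field.
have afc : a < f c.
  by rewrite -[X in X < _](uni_fa U); have := incr a c (lexx _) ac (lexx _); linear.
have fcb : f c <= b.
  have := uni_maps U (x := c); rewrite /= !in_itv/= => H.
  by have /andP[] := H ltac:(linear).
have cf1 : {within `[a, c], continuous f}.
  apply: continuous_subspaceW (uni_cont U) => x /=; rewrite !in_itv/=; linear.
have cf2 : {within `[c, b], continuous f}.
  apply: continuous_subspaceW (uni_cont U) => x /=; rewrite !in_itv/=; linear.
have [gp Bp] := @branch_exists _ a (f c) a c 1 l r K f v ac (lexx a) (ltW afc)
  (or_introl (conj erefl (conj (uni_fa U) erefl))) cf1 l0 r1 bp mp Lp.
have [gm Bm] := @branch_exists _ a (f c) c b (-1) l r K f v cb (ltW ac) (ltW afc)
  (or_intror (conj erefl (conj erefl (uni_fb U)))) cf2 l0 r1 bm mm Lm.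
have vout x : ~~ (a < x < c) -> ~~ (c < x < b) -> v x = 0.
  by rewrite /v => /negbTE -> /negbTE ->.
have qout x : ~~ (a < x < c) -> ~~ (c < x < b) -> q x = 0.
  by rewrite /q => /negbTE -> /negbTE ->.
have vr x : `|v x| <= r.
  have [/andP[h1 h2]|h1] := boolP (a < x < c).
    by have /andP[h3 h4] := bp x h1 h2; rewrite ger0_norm//; linear.
  have [/andP[h2 h3]|h2] := boolP (c < x < b).
    by have /andP[h4 h5] := bm x h2 h3; rewrite ger0_norm//; linear.
  by rewrite vout// normr0.
have qM x : `|q x| <= M.
  have [/andP[h1 h2]|h1] := boolP (a < x < c).
    by rewrite qp// (le_trans (sd_QM Sp (ltW h1) (ltW h2))).
  have [/andP[h2 h3]|h2] := boolP (c < x < b).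
    by rewrite qm// (le_trans (sd_QM Sm (ltW h2) (ltW h3))).
  by rewrite qout// normr0.
have vv := varle_pieces ac cb K0 vr Lp Lm vout.
have vq := varle_pieces ac cb K0 qM QLp QLm qout.
have nv : nice v by have [V hV] := vv; exact: varle_nice hV.
have nq : nice q by have [V hV] := vq; exact: varle_nice hV.
have dp y : a <= y -> y < c -> dmap a b f y = ep1 y.
  move=> ay yc; apply: (@deriv_in_segment _ _ _ _ _ _ ep) => //; first linear.
  - exact: (sd_der Sp ay (ltW yc)).
  - by rewrite (sd_e Sp)// ltW.
  - apply: filterS (lt_nbhsl yc) => z zc; rewrite /= in_itv/= => /andP[az _].
    by rewrite (sd_e Sp)// ltW.
have dm y : c < y -> y <= b -> dmap a b f y = em1 y.
  move=> cy yb; apply: (@deriv_in_segment _ _ _ _ _ _ em) => //; first linear.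
  - exact: (sd_der Sm (ltW cy) yb).
  - by rewrite (sd_e Sm)// ltW.
  - apply: filterS (lt_nbhsr cy) => z zc; rewrite /= in_itv/= => /andP[_ az].
    by rewrite (sd_e Sm)// ltW.
have qKp x y : a <= x -> x <= y -> y <= c -> `|Qp y - Qp x| <= K * (y - x).
  move=> ax xy yc; rewrite (le_trans (sd_QL Sp ax xy yc))// ler_wpM2r// subr_ge0//.
have qKm x y : c <= x -> x <= y -> y <= b -> `|Qm y - Qm x| <= K * (y - x).
  move=> ax xy yc; rewrite (le_trans (sd_QL Sm ax xy yc))// ler_wpM2r// subr_ge0//.
exists gp, gm, v, q, l, r, K, M; split => //.
- split => //.
  + by move=> y h1 h2; rewrite mul1r ger0_norm//; have := bp y h1 h2; linear.
  + by move=> y h1 h2; rewrite mul1r ger0_norm//; have := bm y h1 h2; linear.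
- apply: (@ftc_piece a a c K v q Vp Qp (lexx a) nq _ (sd_dV Sp) qKp K0).
  by move=> x h1 h2; rewrite vp// qp.
- apply: (@ftc_piece a c b K v q Vm Qm (ltW ac) nq _ (sd_dV Sm) qKm K0).
  by move=> x h1 h2; rewrite vm// qm.
- by move=> y h1 h2; rewrite dp ?ltW// vp// (sd_V Sp) div1r invrK.
- by move=> y h1 h2; rewrite dm ?ltW// vm// (sd_V Sm) mulN1r invrN invrK opprK.
- rewrite dp//; have := is_derive_continuous (sd_dV Sp (lexx a) (ltW ac)) => cV.
  have -> : (ep1 a)^-1 = Vp a by rewrite (sd_V Sp) div1r.
  have := cvg_at_right_filter cV; apply: cvg_trans; apply: near_eq_cvg.
  near=> t.
  have h1 : a < t by near: t; exact: nbhs_right_gt.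
  have h2 : t < c by near: t; exact: nbhs_right_lt.
  by rewrite /= vp.
- rewrite dm//; have := is_derive_continuous (sd_dV Sm (ltW cb) (lexx b)) => cV.
  have -> : - (em1 b)^-1 = Vm b by rewrite (sd_V Sm) mulN1r.
  have := cvg_at_left_filter cV; apply: cvg_trans; apply: near_eq_cvg.
  near=> t.
  have h1 : c < t by near: t; exact: nbhs_left_gt.
  have h2 : t < b by near: t; exact: nbhs_left_lt.
  by rewrite /= vm.
- move=> y ay yb yc; have [h|h] := ltP y c.
    by rewrite dp//; have [_ h'] := sd_e1 Sp ay (ltW h); exact: le_trans h' rpr.
  have cy : c < y by rewrite lt_neqAle h andbT; apply/eqP => /esym.
  by rewrite dm//; have [_ h'] := sd_e1 Sm h yb; exact: le_trans h' rmr.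
Unshelve. all: by end_near. Qed.

Context {a b c l r K M : R} {f gp gm v q : R -> R}.
Hypothesis D : model a b c f gp gm v q l r K M.

Lemma sgc_nice : nice (sgc c).
Proof.
split; last first.
  by exists 1 => x; rewrite /sgc; case: ifP => _; rewrite ?normrN normr1.
have -> : sgc c = (fun x => - (- sgc c x)) by apply/funext => x; rewrite opprK.
apply: measurableT_comp => //; apply: nondecreasing_measurable => // x y xy.
rewrite /sgc; have [xc|cx] := ltP x c; have [yc|cy] := ltP y c => //; try linear.
Qed.

Lemma sgc_norm y : `|sgc c y| = 1.
Proof. by rewrite /sgc; case: ifP => _; rewrite ?normrN normr1. Qed.

(** An inverse branch [g] with orientation [s] has derivative [s * v (g x)]. Differentiating
    [v (g x) * rho (g x)] thus gives [s * v^2 * rho' + s * v * q * rho] at [g x]: [w2] weights the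
    derivative and [w3] the density. *)
Definition w2 y := sgc c y * (v y * v y).
Definition w3 y := sgc c y * (v y * q y).

Let S := md_sys D.
Let W := md_w1 D.

Lemma md_r : 0 < r < 1.
Proof. by rewrite (br_r0 (sy_p S)) (br_r (sy_p S)). Qed.

Lemma md_v1 y : `|v y| <= 1.
Proof. by rewrite (le_trans (wt_le W y))//; have := md_r; linear. Qed.

Lemma md_M0 : 0 <= M.
Proof. exact: le_trans (normr_ge0 _) (md_qM D 0). Qed.

Lemma md_K0 : 0 <= K.
Proof. exact: wt_L0 W. Qed.

Lemma md_vge y : a < y -> y < b -> y <> c -> `|v y| = v y.
Proof.
move=> ay yb yc; rewrite ger0_norm//.
by have := sy_vge0 S ay yb yc; have := br_l (sy_p S); linear.
Qed.

Lemma md_vpos y : a < y -> y < b -> y <> c -> 0 <= v y.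
Proof. by move=> ay yb yc; rewrite -md_vge. Qed.

Lemma product_lip (h : R -> R) N x y : 0 <= N -> (forall z, `|h z| <= N) -> x <= y ->
  `|h y - h x| <= K * (y - x) -> `|v y - v x| <= K * (y - x) ->
  `|v y * h y - v x * h x| <= (N + 1) * K * (y - x).
Proof.
move=> N0 hN xy Lh Lv.
have -> : v y * h y - v x * h x = v y * (h y - h x) + (v y - v x) * h x by ring.
have e : (N + 1) * K * (y - x) = 1 * (K * (y - x)) + K * (y - x) * N by ring.
rewrite e (le_trans (ler_normD _ _))// !normrM lerD//.
  by rewrite ler_pM// md_v1.
by rewrite ler_pM// hN.
Qed.

Lemma weight_product (h : R -> R) N : nice h -> 0 <= N -> (forall z, `|h z| <= N) ->
  (forall x y, a < x -> x <= y -> y < c -> `|h y - h x| <= K * (y - x)) ->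
  (forall x y, c < x -> x <= y -> y < b -> `|h y - h x| <= K * (y - x)) ->
  @weight R a c b v (fun y => sgc c y * (v y * h y)) (r * N) ((N + 1) * K) N.
Proof.
move=> nh N0 hN Lp Lm; have K0 := md_K0; have ac := sy_ac S; have cb := sy_cb S.
have W3 := wt_le W.
split => //.
- by apply: niceM; [exact: sgc_nice|apply: niceM => //; exact: sy_v S].
- by move=> y; rewrite normrM sgc_norm mul1r normrM ler_pM.
- by rewrite mulr_ge0// addr_ge0.
- move=> x y ax xy yc; rewrite /sgc yc (le_lt_trans xy yc) !mul1r.
  by apply: product_lip => //; [exact: Lp|exact: (wt_p W)].
- move=> x y cx xy yb; rewrite /sgc (lt_gtF cx) (lt_gtF (lt_le_trans cx xy)).
  rewrite -mulrBr mulN1r normrN.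
  by apply: product_lip => //; [exact: Lm|exact: (wt_m W)].
- move=> y ay yc; have yb := lt_trans yc cb; have nyc : y <> c by move=> e; linear.
  by rewrite normrM sgc_norm mul1r normrM mulrC md_vge// ler_wpM2r// md_vpos.
- move=> y cy yb; have ay := lt_trans ac cy; have nyc : y <> c by move=> e; linear.
  by rewrite normrM sgc_norm mul1r normrM mulrC md_vge// ler_wpM2r// md_vpos.
Qed.

(** The second factor [v] bounds the L^1 norm of the operator by [r < 1], so its iterates decay on
    functions of any mean. *)
Lemma weight_w2 : @weight R a c b v w2 (r * r) ((r + 1) * K) r.
Proof.
apply: weight_product; [exact: sy_v S|by have := md_r; linear|exact: wt_le W|exact: wt_p W|exact: wt_m W].
Qed.

Lemma weight_w3 : @weight R a c b v w3 (r * M) ((M + 1) * K) M.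
Proof.
apply: weight_product; [|exact: md_M0|exact: md_qM D|exact: md_qp D|exact: md_qm D].
by have [V hV] := md_vq D; exact: varle_nice hV.
Qed.

End Model.

(** * The invariant density *)

Section Density.
Context {R : realType}.
Notation mu := (@lebesgue_measure R).
Context {a b c l r K M : R} {f gp gm v q : R -> R}.
Hypothesis D : model a b c f gp gm v q l r K M.
Notation d := (f c).
Notation L := (@op _ a d gp gm v).
Let S := md_sys D.
Let ac := sy_ac S.
Let cb := sy_cb S.
Let ab := sy_ab S.
Let ad := sy_ad S.
Let db := sy_d S.

Lemma preimage_cases x y : a <= y -> y <= b -> f y = x -> y = gp x \/ y = gm x.
Proof.
move=> ay yb <-; have [yc|/ltW cy] := leP y c.
  by left; rewrite (br_gf (sy_p S)).
by right; rewrite (br_gf (sy_m S)).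
Qed.

(** A point of [(a, d)] has exactly one preimage per branch and a point outside [[a, d]] has none;
    the ends and the [f]-image of the exceptional set are discarded. *)
Lemma L1_eqc p p' : eqc p p' -> eqc (L1 a b f p) (L p').
Proof.
move=> h.
apply: (@countableS _ _ ([set a] `|` [set d] `|` f @` [set y | p y <> p' y])).
  move=> x /= ne; apply: contrapT => nx; apply: ne.
  have xa : x <> a by move=> e; apply: nx; left; left.
  have xd : x <> d by move=> e; apply: nx; left; right.
  have pp y : f y = x -> p y = p' y.
    by move=> fy; apply: contrapT => py; apply: nx; right; exists y.
  have [/andP[ax xdl]|nin] := boolP (a < x < d); last first.
    rewrite op_out// /L1 fsbig1// => y [/= + fy].
    rewrite in_itv/= => /andP[ay yb]; have /andP[h1 h2] := sy_f_in S ay yb.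
    exfalso; move/negP: nin; apply; rewrite !lt_neqAle -fy h1 h2 !andbT fy.
    by apply/andP; split; apply/eqP => e; [apply: xa|apply: xd].
  rewrite op_in//; have /andP[p1 p2] := br_in (sy_p S) ax xdl.
  have /andP[m1 m2] := br_in (sy_m S) ax xdl.
  have fp := br_fg (sy_p S) (ltW ax) (ltW xdl).
  have fm := br_fg (sy_m S) (ltW ax) (ltW xdl).
  have ip : gp x \in `[a, b] `&` f @^-1` [set x].
    by apply/mem_set; split => //=; rewrite in_itv/= (ltW p1) (ltW (lt_trans p2 cb)).
  have im : gm x \in `[a, b] `&` f @^-1` [set x].
    by apply/mem_set; split => //=; rewrite in_itv/= (ltW m2) (ltW (lt_trans ac m1)).
  rewrite /L1 (fsbigE [:: gp x; gm x]).
  - rewrite !big_cons big_nil ip im /= addr0 (md_dp D p1 p2) (md_dm D m1 m2) normrN.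
    have vp : 0 <= v (gp x) by have := br_v (sy_p S) p1 p2; have := br_l (sy_p S); linear.
    have vm : 0 <= v (gm x) by have := br_v (sy_m S) m1 m2; have := br_l (sy_m S); linear.
    by rewrite !normfV !ger0_norm// !invrK !pp// ![_ * v _]mulrC.
  - by rewrite /= inE andbT lt_eqF// (lt_trans p2 m1).
  - by move=> y /=; rewrite !inE => /orP[]/eqP ->; exact: set_mem.
  - move=> y [/= + fy]; rewrite in_itv/= => /andP[ay yb].
    by have [->|->] := preimage_cases ay yb fy; rewrite !inE eqxx ?orbT.
apply: countableU; first by apply: countableU; exact: countable1.
exact: (sub_countable (card_image_le _ _)).
Qed.

Lemma iter_L1_eqc p p' n : eqc p p' -> eqc (iter n (L1 a b f) p) (iter n L p').
Proof. by move=> h; elim: n => // n IH; rewrite !iterS; exact: L1_eqc. Qed.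

Lemma op_eqc p p' : eqc p p' -> eqc (L p) (L p').
Proof.
move=> h; apply: eqc_trans (L1_eqc h); apply: eqc_sym; apply: L1_eqc; exact: eqc_refl.
Qed.

Lemma iter_op_fixed p n : eqc p (L p) -> eqc (iter n L p) p.
Proof.
move=> h; elim: n => [|n IH]; first exact: eqc_refl.
rewrite iterS; exact: eqc_trans (op_eqc IH) (eqc_sym h).
Qed.

Lemma varle_of_bounded_variation (rho : R -> R) : bounded_variation a b rho ->
  (forall x, ~ `[a, b]%classic x -> rho x = 0) -> exists V, varle rho V.
Proof.
move=> bv out.
have Nbv : bounded_variation a b (\- rho) by apply/bounded_variationN.
have hN := fine_neg_tv_nondecreasing bv; have hP := fine_neg_tv_nondecreasing Nbv.
have E := bounded_variation_pos_neg_tvE bv.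
pose G x := (fine \o pos_tv a rho) x + (fine \o neg_tv a rho) x.
have ctrl x y : a <= x -> x <= y -> y <= b -> `|rho y - rho x| <= G y - G x.
  move=> ax xy yb; have xin : x \in `[a, b] by rewrite in_itv/= ax (le_trans xy yb).
  have yin : y \in `[a, b] by rewrite in_itv/= yb (le_trans ax xy).
  rewrite (E _ xin) (E _ yin) /G; have := hP _ _ xin yin xy; have := hN _ _ xin yin xy.
  rewrite /pos_tv /=; set A := fine _; set B := fine _; set A' := fine _; set B' := fine _.
  by move=> h1 h2; rewrite ler_norml; apply/andP; split; linear.
have out1 x : x < a -> rho x = 0.
  by move=> xa; apply: out; rewrite /= in_itv/= => /andP[]; rewrite leNgt xa.
have out2 x : b < x -> rho x = 0.
  by move=> xa; apply: out; rewrite /= in_itv/= => /andP[_]; rewrite leNgt xa.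
pose st (p : bool) : R := if p then 1 else 0.
(* The extension by [0] jumps on arrival at [a] and on departure from [b], hence the two different
   inequalities. *)
pose H x := G (clamp a b x) + `|rho a| * st (a <= x) + `|rho b| * st (b < x).
have Gm x y : x <= y -> G (clamp a b x) <= G (clamp a b y).
  move=> xy; have /andP[h1 h2] := clamp_in x (ltW ab); have /andP[h3 h4] := clamp_in y (ltW ab).
  rewrite -subr_ge0; exact: le_trans (normr_ge0 _) (ctrl _ _ h1 (clamp_homo a b xy) h4).
have ra := normr_ge0 (rho a); have rb := normr_ge0 (rho b).
have gH : gctrl rho H.
  move=> x y xy; have := Gm _ _ xy; rewrite /H /st.
  have [ax|xa] := leP a x.
    rewrite (le_trans ax xy).
    have [bx|xb] := ltP b x.
      rewrite (lt_le_trans bx xy) (out2 x bx) (out2 y (lt_le_trans bx xy)).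
      by rewrite subrr normr0; linear.
    have [by_|yb] := ltP b y; last first.
      by have := ctrl x y ax xy yb; rewrite !clamp_id ?(le_trans ax xy)//; linear.
    move=> _; rewrite (clamp_r (ltW ab) (ltW by_)) (clamp_id ax xb) (out2 y by_) sub0r normrN.
    have := ctrl x b ax xb (lexx _).
    have : `|rho x| <= `|rho b| + `|rho b - rho x|.
      have {1}-> : rho x = rho b - (rho b - rho x) by ring.
      exact: ler_normB.
    linear.
  have -> : (b < x) = false by rewrite (lt_gtF (lt_trans xa ab)).
  rewrite (out1 x)// subr0 => _.
  have [ay|ya] := leP a y; last first.
    have -> : (b < y) = false by rewrite (lt_gtF (lt_trans ya ab)).
    by rewrite (out1 y)// normr0 (clamp_l (ltW ab) (ltW ya)) (clamp_l (ltW ab) (ltW xa)); linear.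
  rewrite (clamp_l (ltW ab) (ltW xa)).
  have [by_|yb] := ltP b y.
    rewrite (out2 y by_) normr0 (clamp_r (ltW ab) (ltW by_)).
    have := ctrl a b (lexx _) (ltW ab) (lexx _).
    by have := normr_ge0 (rho b - rho a); linear.
  rewrite (clamp_id ay yb); have := ctrl a y (lexx _) ay yb.
  have : `|rho y| <= `|rho a| + `|rho y - rho a|.
    have {1}-> : rho y = rho a + (rho y - rho a) by ring.
    exact: ler_normD.
  linear.
exists (G b - G a + `|rho a| + `|rho b|); exists H => // x y.
have /andP[x1 x2] := clamp_in x (ltW ab); have /andP[y1 y2] := clamp_in y (ltW ab).
have h1 : G a <= G (clamp a b x).
  by rewrite -subr_ge0; exact: le_trans (normr_ge0 _) (ctrl _ _ (lexx _) x1 x2).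
have h2 : G (clamp a b y) <= G b.
  by rewrite -subr_ge0; exact: le_trans (normr_ge0 _) (ctrl _ _ y1 y2 (lexx _)).
rewrite /H; have s01 (p : bool) : 0 <= st p <= 1 by rewrite /st; case: p; rewrite lexx ler01.
have k1 (p : bool) z : 0 <= z -> 0 <= z * st p <= z.
  move=> z0; have /andP[? ?] := s01 p; rewrite mulr_ge0//=.
  by rewrite -[leRHS]mulr1 ler_wpM2l.
have := k1 (a <= x) _ ra; have := k1 (b < x) _ rb.
have := k1 (a <= y) _ ra; have := k1 (b < y) _ rb.
linear.
Qed.

Lemma prim_continuity_eq p p' x : nice p -> nice p' -> a < x -> x < b ->
  (forall t, a <= t -> t <= b -> prim a p t = prim a p' t) ->
  {for x, continuous p} -> {for x, continuous p'} -> p x = p' x.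
Proof.
move=> np np' ax xb E cp cp'; apply/eqP; rewrite -subr_eq0; apply: contrapT => /negP ne.
have ne0 : 0 < `|p x - p' x| / 2 by rewrite divr_gt0// normr_gt0.
have ch : {for x, continuous (fun y => p y - p' y)} by apply: cvgB.
have /cvgrPdist_le /(_ _ ne0) /nbhs_ballP[e /= e0 He] := ch.
pose h := Num.min (e / 2) (b - x).
have h0 : 0 < h by rewrite lt_min divr_gt0 ?subr_gt0.
have hq : h <= b - x by rewrite ge_min lexx orbT.
have he : h <= e / 2 by rewrite ge_min lexx.
have near z : x < z -> z < x + h -> `|(p z - p' z) - (p x - p' x)| <= `|p x - p' x| / 2.
  move=> xz zh; rewrite distrC; apply: He; rewrite /ball /= distrC ger0_norm; linear.
have := @prim_near _ a _ x (x + h) _ _ (niceB np np') (ltW ax) ltac:(linear) near.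
rewrite !primB// !E; try linear.
rewrite !subrr add0r normrN addrAC subrr add0r normrM (gtr0_norm h0).
rewrite ler_pM2r//; linear.
Qed.

Context {rho : R -> R}.
Hypothesis A : acim_density a b f rho.

Lemma rho_varle : exists V, varle rho V.
Proof. exact: varle_of_bounded_variation (acim_bv A) (acim_supp A). Qed.

Lemma rho_nice : nice rho.
Proof. by have [V hV] := rho_varle; exact: varle_nice hV. Qed.

Lemma Rintegral_prim t : t <= b -> a <= t ->
  \int[mu]_(x in `[a, b] `&` `]-oo, t[) rho x = prim a rho t.
Proof.
move=> tb at_; rewrite /prim; congr (Rintegral mu _ rho).
apply/seteqP; split => x /=; rewrite !in_itv/=.
  by move=> [/andP[-> _] ->].
by move=> /andP[ax xt]; rewrite ax xt (ltW (lt_le_trans xt tb)).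
Qed.

Lemma prim_full : \int[mu]_(x in `[a, b]) rho x = prim a rho b.
Proof.
rewrite /prim Rintegral_itv_bndo_bndc//; exact: nice_integrable rho_nice.
Qed.

Lemma rho_mass : prim a rho b = 1.
Proof. by rewrite -prim_full /Rintegral (acim_mass A). Qed.

(** Invariance is tested on a half-line: for [t] in the image, the preimage consists of [[a, gp t[]
    and []gm t, b]], and each piece is transported by the change of variables. *)
Lemma prim_invariant t : a <= t -> t <= b -> prim a (L rho) t = prim a rho t.
Proof.
move=> at_ tb; have [V vV] := rho_varle; have nr := rho_nice; have nv := sy_v S.
have mA : measurable (`]-oo, t[%classic : set R) by exact: measurable_itv.
have := congr1 fine (acim_inv A mA); rewrite -!/(Rintegral _ _ _) (Rintegral_prim tb at_) => <-.
have nT1 : nice (@transfer _ a d gp (fun y => v y * rho y)).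
  by apply: (transfer_nice (sy_p S)); exact: niceM.
have nT2 : nice (@transfer _ a d gm (fun y => v y * rho y)).
  by apply: (transfer_nice (sy_m S)); exact: niceM.
have [fa fc fb] := sy_fE S.
move: at_; rewrite le_eqVlt => /orP[/eqP <-|lt_at].
  rewrite prim_base (_ : _ `&` _ = set0) ?Rintegral_set0// -subset0 => x /= [].
  rewrite !in_itv/= => /andP[ax xb]; have /andP[h _] := sy_f_in S ax xb.
  by rewrite ltNge h.
have [dt|td] := ltP d t.
  have -> : `[a, b] `&` f @^-1` `]-oo, t[ = `[a, b]%classic.
    apply/seteqP; split => x /=; first by case.
    rewrite !in_itv/= => /andP[ax xb]; split; first by rewrite ax.
    by have /andP[_ h] := sy_f_in S ax xb; exact: le_lt_trans h dt.
  rewrite prim_full -(prim_op S vV); apply/esym/eqP; rewrite -subr_eq0; apply/eqP.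
  rewrite (@prim_eq _ a _ (cst 0) t b)//.
  - by rewrite prim_cst ?mul0r// ltW.
  - apply: (op_nice S) => //; exact: sy_v S.
  - exact: nice_cst.
  - exact: ltW.
  - by move=> x tx _; rewrite op_out// negb_and -!leNgt (ltW (lt_trans dt tx)) orbT.
have fgp := br_fg (sy_p S) (ltW lt_at) td; have fgm := br_fg (sy_m S) (ltW lt_at) td.
have /andP[gp1 gp2] := br_g (sy_p S) t; have /andP[gm1 gm2] := br_g (sy_m S) t.
have -> : `[a, b] `&` f @^-1` `]-oo, t[ = `[a, gp t[%classic `|` `]gm t, b]%classic.
  apply/seteqP; split => x /=; rewrite !in_itv/=.
    move=> [/andP[ax xb] fxt]; have /andP[h1 h2] := sy_f_in S ax xb.
    have [xc|/ltW cx] := leP x c.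
      left; rewrite ax /=; have := br_gstrict (sy_p S) h1 fxt td.
      by rewrite !mul1r (br_gf (sy_p S) ax xc).
    right; rewrite xb andbT; have := br_gstrict (sy_m S) h1 fxt td.
    by rewrite !mulN1r ltrN2 (br_gf (sy_m S) cx xb).
  move=> [/andP[ax xg]|/andP[gx xb]].
    have xc := ltW (lt_le_trans xg gp2); split; first by rewrite ax (le_trans xc (ltW cb)).
    have [h _] := br_expand (sy_p S) ax (ltW xg) gp2; rewrite fgp mul1r in h.
    have : 0 < r * (t - f x) by linear.
    by rewrite (pmulr_rgt0 _ (br_r0 (sy_p S))); linear.
  have cx := ltW (le_lt_trans gm1 gx); split; first by rewrite xb (le_trans (ltW ac) cx).
  have [h _] := br_expand (sy_m S) gm1 (ltW gx) xb; rewrite fgm mulN1r in h.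
  have : 0 < r * - (f x - t) by linear.
  by rewrite (pmulr_rgt0 _ (br_r0 (sy_p S))); linear.
have agm : a <= gm t by linear.
rewrite Rintegral_setU//; last 2 first.
- apply: (@integrableS _ _ _ mu `[a, b]%classic) => //.
  + exact: measurableU.
  + move=> x /=; rewrite !in_itv/= => -[/andP[h1 h2]|/andP[h1 h2]]; linear.
  + exact: nice_integrable.
- apply/disj_setPS => x [] /=; rewrite !in_itv/= => /andP[_ h1] /andP[h2 _]; linear.
have -> : \int[mu]_(x in `]gm t, b]) rho x = prim a rho b - prim a rho (gm t).
  rewrite primE// Rintegral_itv_bndo_bndc//; exact: nice_integrable.
rewrite -/(prim a rho (gp t)) /op primD//.
have h1 := transfer_prim (sy_p S) nv vV (lexx a) gp1 gp2.
have h2 := transfer_prim (sy_m S) nv vV gm1 gm2 (lexx b).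
rewrite fa fgp prim_base in h1; rewrite fb fgm prim_base in h2.
rewrite prim_base in h1; linear.
Qed.

(** Both functions have bounded variation and the same primitive, so they agree wherever both are
    continuous. *)
Lemma rho_fixed : eqc rho (L rho).
Proof.
have [V vV] := rho_varle; have [V' vV'] := varle_iter S 1 (md_w1 D) vV.
apply: (@countableS _ _ ([set a] `|` [set b] `|`
  ([set x | ~ {for x, continuous rho}] `|` [set x | ~ {for x, continuous (L rho)}]))).
  move=> x /= ne; apply: contrapT => nx; apply: ne.
  have xa : x <> a by move=> e; apply: nx; left; left.
  have xb : x <> b by move=> e; apply: nx; left; right.
  have c1 : {for x, continuous rho} by apply: contrapT => h; apply: nx; right; left.
  have c2 : {for x, continuous (L rho)} by apply: contrapT => h; apply: nx; right; right.
  have [/andP[ax xlb]|nin] := boolP (a < x < b).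
    apply: prim_continuity_eq => //; [exact: varle_nice vV|exact: varle_nice vV'|].
    by move=> t at_ tb; rewrite prim_invariant.
  rewrite op_out; last first.
    by apply: contra nin => /andP[-> /= xd]; exact: lt_le_trans xd db.
  apply: (acim_supp A); rewrite /= in_itv/= => /andP[h1 h2].
  move/negP: nin; apply; rewrite !lt_neqAle h1 h2 !andbT.
  by apply/andP; split; apply/eqP => e; [apply: xa|apply: xb].
apply: countableU; first by apply: countableU; exact: countable1.
by apply: countableU; [exact: varle_countable_discontinuity vV|exact: varle_countable_discontinuity vV'].
Qed.

End Density.

(** * The critical orbit and the jumps of the density *)

Section Orbits.
Context {T : Type}.
Implicit Types (P : nat -> Prop) (f : T -> T).

Lemma least_None P : least P = None -> forall n, ~ P n.
Proof.
rewrite /least; case: pselect => // h _ n Pn; apply: h; exists n.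
by apply/asboolP.
Qed.

Lemma least_Some P n : least P = Some n -> P n /\ forall k, P k -> (n <= k)%N.
Proof.
rewrite /least; case: pselect => // h [] <-; case: ex_minnP => m /asboolP Pm H.
by split => // k Pk; apply: H; apply/asboolP.
Qed.

Lemma min_period_None f x : min_period f x = None ->
  forall n, (0 < n)%N -> iter n f x <> x.
Proof. by move=> /least_None H n n0 e; apply: (H n). Qed.

Lemma min_period_Some f x p : min_period f x = Some p ->
  [/\ (0 < p)%N, iter p f x = x & forall k, (0 < k < p)%N -> iter k f x <> x].
Proof.
move=> /least_Some [[p0 e] H]; split => // k /andP[k0 kp] e'.
by have := H k (conj k0 e'); rewrite leqNgt kp.
Qed.

Variables (f : T -> T) (c : T).
Notation o n := (iter n f c).

Lemma M_of_None : M_of f c = None -> forall k, (0 < k)%N -> o k <> c.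
Proof. exact: min_period_None. Qed.

Lemma M_of_Some m : M_of f c = Some m ->
  [/\ (0 < m)%N, o m = c & forall k, (0 < k < m)%N -> o k <> c].
Proof. exact: min_period_Some. Qed.

Lemma orbit_shift i j k : o i = o j -> o (k + i) = o (k + j).
Proof. by rewrite !iterD => ->. Qed.

Lemma orbit_periodic i j : (i < j)%N -> o i = o j -> min_period f (o i) <> None.
Proof.
move=> ij e /min_period_None /(_ (j - i)%N); rewrite subn_gt0 => /(_ ij); apply.
by rewrite -iterD subnK ?e// ltnW.
Qed.

Lemma N_of_None i j : N_of f c = None -> o i = o j -> i = j.
Proof.
rewrite /N_of; case E : (least _) => [n0|].
  have [] := least_Some E; by case: (min_period f (o n0)).
move=> _ e; have H := least_None E.
case: (ltngtP i j) => // ij; exfalso.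
  by apply: (H i); exact: orbit_periodic e.
by apply: (H j); apply: orbit_periodic (esym e).
Qed.

(** A common form of the periodic and the preperiodic case: the points of index [1] to [n] are
    distinct and the next one is again in the list. *)
Lemma N_of_Some n : N_of f c = Some n ->
  [/\ (0 < n)%N,
      forall i j, (0 < i <= n)%N -> (0 < j <= n)%N -> o i = o j -> i = j &
      exists2 m, (0 < m <= n)%N & o n.+1 = o m].
Proof.
rewrite /N_of; case E : (least _) => [n0|//].
have [Pn0 H] := least_Some E.
case E1 : (min_period f (o n0)) => [p|//] [] nE.
have [p0 ep Hp] := min_period_Some E1.
have np : ((n0 = 0 /\ n = p) \/ (0 < n0 /\ n.+1 = n0 + p))%N.
  by move: nE p0; case: (n0) => [|m]; lia.
have noteq i j : (0 < i)%N -> (i < j)%N -> (j <= n)%N -> o i <> o j.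
  move=> i0 ij jn e.
  have n0i : (n0 <= i)%N by apply: H; exact: orbit_periodic e.
  (* A coincidence of the points of index [i] and [j] would give the period [p - (j - i)], shorter
     than the minimal one. *)
  apply: (Hp (n0 + p - j + i - n0)%N); first by lia.
  rewrite -iterD subnK; last by lia.
  rewrite (orbit_shift _ e) subnK; last by lia.
  by rewrite addnC iterD.
split; first by lia.
- move=> i j /andP[i0 im] /andP[j0 jm] e; case: (ltngtP i j) => // ij; exfalso.
    exact: (noteq i j).
  exact: (noteq j i).
- case: (posnP n0) => [z|n0p].
    exists 1%N; first by lia.
    have <- : p = n by lia.
    by move: ep; rewrite z /= => ->.
  exists n0; first by lia.
  have -> : n.+1 = (p + n0)%N by lia.
  by rewrite iterD ep.
Qed.

End Orbits.

(** * One-sided limits and summability of jumps *)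

Section Jumps.
Context {R : realType}.
Implicit Types (p psi h F : R -> R) (P : set R).

Lemma near_rightP w P : (\forall y \near w^'+, P y) <->
  exists2 e, 0 < e & forall y, w < y -> y < w + e -> P y.
Proof.
split.
  rewrite /at_right /within /= => /nbhs_ballP[e /= e0 H]; exists e => // y wy ye.
  by apply: (H y) => //; rewrite /ball /= distrC gtr0_norm; linear.
move=> [e e0 H]; rewrite /at_right /within /=; apply/nbhs_ballP; exists e => // y /=.
rewrite /ball /= => yb wy; apply: H => //.
by move: yb; rewrite distrC gtr0_norm; linear.
Qed.

Lemma near_leftP w P : (\forall y \near w^'-, P y) <->
  exists2 e, 0 < e & forall y, w - e < y -> y < w -> P y.
Proof.
split.
  rewrite /at_left /within /= => /nbhs_ballP[e /= e0 H]; exists e => // y wy ye.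
  by apply: (H y) => //; rewrite /ball /= gtr0_norm; linear.
move=> [e e0 H]; rewrite /at_left /within /=; apply/nbhs_ballP; exists e => // y /=.
rewrite /ball /= => yb wy; apply: H => //.
by move: yb; rewrite gtr0_norm; linear.
Qed.

(** The upper bound is what contraction of the inverse branches provides; strictness of [w < h y]
    keeps the limit one-sided. *)
Lemma cvg_right_right h (w z e : R) : 0 < e ->
  (forall y, z < y -> y < z + e -> w < h y /\ h y <= w + (y - z)) ->
  h y @[y --> z^'+] --> w^'+.
Proof.
move=> e0 H P /near_rightP[e' e'0 HP]; apply/near_rightP.
exists (Num.min e e') => [|y zy]; first by rewrite lt_min e0.
move=> ye; have [y1 y2] : y < z + e /\ y < z + e'.
  have : Num.min e e' <= e by rewrite ge_min lexx.
  have : Num.min e e' <= e' by rewrite ge_min lexx orbT.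
  by split; linear.
by have [h1 h2] := H y zy y1; apply: HP => //; linear.
Qed.

Lemma cvg_right_left h (w z e : R) : 0 < e ->
  (forall y, z < y -> y < z + e -> h y < w /\ w <= h y + (y - z)) ->
  h y @[y --> z^'+] --> w^'-.
Proof.
move=> e0 H P /near_leftP[e' e'0 HP]; apply/near_rightP.
exists (Num.min e e') => [|y zy]; first by rewrite lt_min e0.
move=> ye; have [y1 y2] : y < z + e /\ y < z + e'.
  have : Num.min e e' <= e by rewrite ge_min lexx.
  have : Num.min e e' <= e' by rewrite ge_min lexx orbT.
  by split; linear.
by have [h1 h2] := H y zy y1; apply: HP => //; linear.
Qed.

Lemma cvg_left_right h (w z e : R) : 0 < e ->
  (forall y, z - e < y -> y < z -> w < h y /\ h y <= w + (z - y)) ->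
  h y @[y --> z^'-] --> w^'+.
Proof.
move=> e0 H P /near_rightP[e' e'0 HP]; apply/near_leftP.
exists (Num.min e e') => [|y zy]; first by rewrite lt_min e0.
move=> ye; have [y1 y2] : z - e < y /\ z - e' < y.
  have : Num.min e e' <= e by rewrite ge_min lexx.
  have : Num.min e e' <= e' by rewrite ge_min lexx orbT.
  by split; linear.
by have [h1 h2] := H y y1 ye; apply: HP => //; linear.
Qed.

Lemma cvg_left_left h (w z e : R) : 0 < e ->
  (forall y, z - e < y -> y < z -> h y < w /\ w <= h y + (z - y)) ->
  h y @[y --> z^'-] --> w^'-.
Proof.
move=> e0 H P /near_leftP[e' e'0 HP]; apply/near_leftP.
exists (Num.min e e') => [|y zy]; first by rewrite lt_min e0.
move=> ye; have [y1 y2] : z - e < y /\ z - e' < y.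
  have : Num.min e e' <= e by rewrite ge_min lexx.
  have : Num.min e e' <= e' by rewrite ge_min lexx orbT.
  by split; linear.
by have [h1 h2] := H y y1 ye; apply: HP => //; linear.
Qed.

Lemma uncountable_itv (x y : R) : x < y -> ~ countable `]x, y[%classic.
Proof.
move=> xy /countable_lebesgue_measure0; rewrite lebesgue_measure_itv/= lte_fin xy.
by move=> /eqP; rewrite -EFinD eqe subr_eq0 => /eqP e; move: xy; rewrite e ltxx.
Qed.

Lemma exists_off_countable (x y : R) (A : set R) : x < y -> countable A ->
  exists2 z, x < z < y & ~ A z.
Proof.
move=> xy cA; apply: contrapT => H; apply: (uncountable_itv xy).
apply: countableS cA => z /=; rewrite in_itv/= => zin; apply: contrapT => nA.
by apply: H; exists z.
Qed.

Lemma varle_cvg_right psi V x : varle psi V ->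
  psi y @[y --> x^'+] --> lim (psi y @[y --> x^'+]).
Proof. by move=> vp; apply: varle_lim_right vp. Qed.

Lemma varle_cvg_left psi V x : varle psi V ->
  psi y @[y --> x^'-] --> lim (psi y @[y --> x^'-]).
Proof. by move=> vp; apply: varle_lim_left vp. Qed.

(** Every interval to the right of [x] is uncountable, hence contains points where [p] and [psi]
    agree. *)
Lemma cvg_eqc_right p psi (x A B : R) : p y @[y --> x^'+] --> A ->
  psi y @[y --> x^'+] --> B -> eqc p psi -> A = B.
Proof.
move=> cA cB E; apply/eqP; rewrite -subr_eq0; apply: contrapT => /negP ne.
have c : (p y - psi y) @[y --> x^'+] --> A - B by apply: cvgB.
have /cvgrPdist_lt /(_ `|A - B|) := c; rewrite normr_gt0 => /(_ ne) /near_rightP[e e0 H].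
have [z /andP[z1 z2] nz] := @exists_off_countable x (x + e) _ ltac:(linear) E.
have := H z z1 z2; have -> : p z = psi z by apply: contrapT => h; apply: nz.
by rewrite subrr subr0 ltxx.
Qed.

Lemma cvg_eqc_left p psi (x A B : R) : p y @[y --> x^'-] --> A ->
  psi y @[y --> x^'-] --> B -> eqc p psi -> A = B.
Proof.
move=> cA cB E; apply/eqP; rewrite -subr_eq0; apply: contrapT => /negP ne.
have c : (p y - psi y) @[y --> x^'-] --> A - B by apply: cvgB.
have /cvgrPdist_lt /(_ `|A - B|) := c; rewrite normr_gt0 => /(_ ne) /near_leftP[e e0 H].
have [z /andP[z1 z2] nz] := @exists_off_countable (x - e) x _ ltac:(linear) E.
have := H z z1 z2; have -> : p z = psi z by apply: contrapT => h; apply: nz.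
by rewrite subrr subr0 ltxx.
Qed.

Lemma jumpE p (x A B : R) : p y @[y --> x^'+] --> A -> p y @[y --> x^'-] --> B ->
  jump p x = A - B.
Proof. by move=> cA cB; rewrite /jump (cvg_lim _ cA)// (cvg_lim _ cB). Qed.

Lemma jump_continuous p x : {for x, continuous p} -> jump p x = 0.
Proof.
move=> cp; rewrite (@jumpE p x (p x) (p x)) ?subrr//.
  exact: cvg_at_right_filter.
exact: cvg_at_left_filter.
Qed.

Lemma jump_le p F x z y : gctrl p F -> x < z -> z < y -> `|jump p z| <= F y - F x.
Proof.
move=> cF xz zy; have hF := gctrl_homo cF.
have vp : varle (fun u => p (clamp x y u)) (F y - F x).
  have xy := ltW (lt_trans xz zy).
  exists (fun u => F (clamp x y u)) => [u w uw|u w].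
    by apply: cF; exact: clamp_homo.
  have /andP[h1 h2] := clamp_in u xy; have /andP[h3 h4] := clamp_in w xy.
  by rewrite lerB// hF.
have cA := varle_cvg_right (x := z) vp; have cB := varle_cvg_left (x := z) vp.
set A := lim _ in cA; set B := lim _ in cB.
have cA' : p u @[u --> z^'+] --> A.
  apply: cvg_trans cA; apply: near_eq_cvg; apply/near_rightP; exists (y - z); first linear.
  by move=> u zu uy; rewrite /= clamp_id//; linear.
have cB' : p u @[u --> z^'-] --> B.
  apply: cvg_trans cB; apply: near_eq_cvg; apply/near_leftP; exists (z - x); first linear.
  by move=> u zu uy; rewrite /= clamp_id//; linear.
rewrite (jumpE cA' cB').
have bd u w : `|p (clamp x y u) - p (clamp x y w)| <= F y - F x by exact: varle_osc vp.
have step w : `|A - p (clamp x y w)| <= F y - F x.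
  have c : (p (clamp x y u) - p (clamp x y w)) @[u --> z^'+] --> A - p (clamp x y w).
    by apply: cvgB => //; exact: cvg_cst.
  have c' : `|p (clamp x y u) - p (clamp x y w)| @[u --> z^'+] --> `|A - p (clamp x y w)|.
    exact: cvg_norm.
  have <- := cvg_lim (@Rhausdorff R) c'.
  apply: limr_le; first by apply/cvg_ex; eexists; exact: c'.
  by apply: filterE => u; exact: bd.
have c : (A - p (clamp x y u)) @[u --> z^'-] --> A - B by apply: cvgB => //; exact: cvg_cst.
have c' : `|A - p (clamp x y u)| @[u --> z^'-] --> `|A - B| by exact: cvg_norm.
have <- := cvg_lim (@Rhausdorff R) c'.
apply: limr_le; first by apply/cvg_ex; eexists; exact: c'.
by apply: filterE => u; exact: step.
Qed.

Lemma jump_sum_sorted p F s : gctrl p F -> forall z w, path <%R z s ->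
  (forall x, x \in s -> x < w) -> z < w ->
  \sum_(x <- s) `|jump p x| <= F w - F z.
Proof.
move=> cF; have hF := gctrl_homo cF.
elim: s => [|x s IH] z w /=.
  by move=> _ _ zw; rewrite big_nil subr_ge0 hF// ltW.
move=> /andP[zx ps] sw zw; rewrite big_cons.
have xw : x < w by apply: sw; rewrite inE eqxx.
pose y := head w s.
have xy : x < y by rewrite /y; case: (s) ps => //= x' s' /andP[].
(* A point between consecutive jumps, so that the increments of [F] are taken over disjoint
   intervals. *)
pose m := (x + y) / 2.
have [xm my] : x < m /\ m < y by rewrite /m; split; linear.
have yw : y <= w.
  rewrite /y; case: (s) sw => //= x' s' sw; apply/ltW/sw.
  by rewrite !inE eqxx orbT.
have h1 := jump_le cF zx xm.
have h2 : \sum_(x0 <- s) `|jump p x0| <= F w - F m.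
  apply: IH; last linear.
    by move: my ps; rewrite /y; case: (s) => //= x' s' -> /andP[].
  by move=> x0 x0s; apply: sw; rewrite inE x0s orbT.
linear.
Qed.

Lemma jump_sum p V (s : seq R) : varle p V -> uniq s ->
  \sum_(x <- s) `|jump p x| <= V.
Proof.
move=> [F cF bF] us.
rewrite (perm_big (sort <=%R s)) /=; last by rewrite perm_sym perm_sort.
have ss : sorted <%R (sort <=%R s).
  by rewrite sort_lt_sorted.
case E : (sort _ s) ss => [|x t] /= ss; first by rewrite big_nil -(subrr (F 0)) bF.
have [w hw] : exists w, forall y, y \in x :: t -> y < w.
  elim: (x :: t) => [|y l [w hw]]; first by exists 0.
  exists (Num.max w (y + 1)) => z; rewrite inE lt_max => /orP[/eqP ->|/hw ->//].
  by rewrite ltrDl ltr01 orbT.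
apply: (le_trans (jump_sum_sorted cF (z := x - 1) (w := w) _ hw _)); last exact: bF.
  by rewrite /= ss andbT ltrBlDr ltrDl.
by rewrite (lt_trans _ (hw x _)) ?inE ?eqxx// ltrBlDr ltrDl.
Qed.

End Jumps.

Section AbsoluteSums.
Context {R : realType}.
Implicit Types (t y : nat -> R).

Lemma bounded_series_cvg t V : (forall m, series (fun k => `|t k|) m <= V) ->
  cvgn (series (fun k => `|t k|)).
Proof.
move=> hV; apply: nondecreasing_is_cvgn.
  by apply: nondecreasing_series => n _ _.
by exists V => _ [m _ <-].
Qed.

Definition stail t m : R := limn (series (fun k => `|t k|)) - series (fun k => `|t k|) m.

Lemma stail_cvg t V : (forall m, series (fun k => `|t k|) m <= V) -> stail t m @[m --> \oo] --> (0 : R).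
Proof.
move=> hV; have c := bounded_series_cvg hV.
rewrite -[X in _ --> X](subrr (limn (series (fun k => `|t k|)))).
by apply: cvgB => //; exact: cvg_cst.
Qed.

Lemma weighted_series_cvg t y V B : (forall m, series (fun k => `|t k|) m <= V) ->
  (forall k, `|y k| <= B) -> cvgn (series (fun k => t k * y k)).
Proof.
move=> hV hB; apply: normed_cvg.
have B0 : 0 <= B by exact: le_trans (normr_ge0 _) (hB 0%N).
apply: (@series_le_cvg _ _ (fun k => B * `|t k|)) => //.
- by move=> k /=.
- by move=> k /=; rewrite mulr_ge0.
- by move=> k; rewrite /= normrM mulrC ler_wpM2r.
- have -> : series (fun k => B * `|t k|) = (fun m => B * series (fun k => `|t k|) m).
    by apply/funext => m; rewrite /series /= mulr_sumr.
  by apply: is_cvgM; [exact: is_cvg_cst|exact: bounded_series_cvg hV].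
Qed.

Lemma weighted_series_tail t y V B m : (forall m, series (fun k => `|t k|) m <= V) ->
  (forall k, `|y k| <= B) ->
  `|limn (series (fun k => t k * y k)) - series (fun k => t k * y k) m| <= B * stail t m.
Proof.
move=> hV hB; have c1 := weighted_series_cvg hV hB; have c2 := bounded_series_cvg hV.
have step k : (m <= k)%N -> `|series (fun k => t k * y k) k - series (fun k => t k * y k) m|
   <= B * (series (fun k => `|t k|) k - series (fun k => `|t k|) m).
  move=> mk; rewrite !sub_series_geq// mulr_sumr (le_trans (ler_norm_sum _ _ _))//.
  by apply: ler_sum => i _; rewrite normrM mulrC ler_wpM2r.
have h1 : `|series (fun k => t k * y k) k - series (fun k => t k * y k) m| @[k --> \oo] -->
    `|limn (series (fun k => t k * y k)) - series (fun k => t k * y k) m|.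
  by apply: cvg_norm; apply: cvgB => //; exact: cvg_cst.
have h2 : B * (series (fun k => `|t k|) k - series (fun k => `|t k|) m) @[k --> \oo] --> B * stail t m.
  by apply: cvgM; [exact: cvg_cst|apply: cvgB => //; exact: cvg_cst].
rewrite -(cvg_lim (@Rhausdorff R) h1) -(cvg_lim (@Rhausdorff R) h2).
apply: ler_lim; [by apply/cvg_ex; eexists; exact: h1|by apply/cvg_ex; eexists; exact: h2|].
by exists m => // k /= mk; exact: step.
Qed.

Lemma weighted_series_bound t y V B : (forall m, series (fun k => `|t k|) m <= V) ->
  (forall k, `|y k| <= B) -> `|limn (series (fun k => t k * y k))| <= B * V.
Proof.
move=> hV hB; have := weighted_series_tail 0 hV hB.
have B0 : 0 <= B by exact: le_trans (normr_ge0 _) (hB 0%N).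
rewrite {2}/series /= big_geq// subr0 => h; rewrite (le_trans h)// ler_wpM2l//.
rewrite /stail /series /= [X in _ - X]big_geq// subr0; apply: limr_le.
  exact: (bounded_series_cvg hV).
by apply: filterE => m; exact: hV.
Qed.

End AbsoluteSums.

(** * The transfer relation for jumps *)

Section JumpRelation.
Context {R : realType}.
Context {a b c l r K M : R} {f gp gm v q : R -> R}.
Hypothesis D : model a b c f gp gm v q l r K M.
Notation d := (f c).
Notation L := (@op _ a d gp gm v).
Let S := md_sys D.
Let ac := sy_ac S.
Let cb := sy_cb S.
Let ab := sy_ab S.
Let ad := sy_ad S.
Let db := sy_d S.
Context {rho : R -> R}.
Hypothesis A : acim_density a b f rho.

Lemma continuous_of_lipschitz (h : R -> R) (u t k w : R) : 0 <= k ->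
  (forall x y, u < x -> x <= y -> y < t -> `|h y - h x| <= k * (y - x)) ->
  u < w -> w < t -> {for w, continuous h}.
Proof.
move=> k0 H uw wt; apply/cvgrPdist_le => e e0; apply/nbhs_ballP.
pose dl := Num.min (Num.min (w - u) (t - w)) (e / (k + 1)).
have dl0 : 0 < dl by rewrite !lt_min !subr_gt0 uw wt divr_gt0//; linear.
exists dl => // y; rewrite /ball /= lt_min lt_min => /andP[/andP[h1 h2] h3].
have ke : k * (e / (k + 1)) <= e.
  have k1 : k / (k + 1) <= 1 by rewrite ler_pdivrMr; linear.
  by rewrite mulrCA -[leRHS]mulr1 ler_wpM2l// ltW.
have [wy|/ltW yw] := leP w y.
  rewrite [`|h w - h y|]distrC; rewrite distrC in h1 h2 h3; rewrite !ger0_norm ?subr_ge0// in h1 h2 h3.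
  rewrite (le_trans (H w y uw wy _))//; first linear.
  by rewrite (le_trans _ ke)// ler_wpM2l// ltW.
rewrite !ger0_norm ?subr_ge0// in h1 h2 h3.
rewrite (le_trans (H y w _ yw wt))//; first linear.
by rewrite (le_trans _ ke)// ler_wpM2l// ltW.
Qed.

Lemma v_continuous_p w : a < w -> w < c -> {for w, continuous v}.
Proof.
apply: continuous_of_lipschitz; [exact: (md_K0 D)|exact: (wt_p (md_w1 D))].
Qed.

Lemma v_continuous_m w : c < w -> w < b -> {for w, continuous v}.
Proof.
apply: continuous_of_lipschitz; [exact: (md_K0 D)|exact: (wt_m (md_w1 D))].
Qed.

Lemma gp_step x y : a <= x -> x < y -> y <= d -> gp x < gp y /\ gp y <= gp x + (y - x).
Proof.
move=> ax xy yd; have := br_gstrict (sy_p S) ax xy yd; rewrite !mul1r => h; split => //.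
have := br_glip (sy_p S) ax (ltW xy) yd; rewrite gtr0_norm ?subr_gt0// => h2.
have : r * (y - x) <= 1 * (y - x).
  by apply: ler_wpM2r; [linear|apply/ltW; exact: br_r (sy_p S)].
linear.
Qed.

Lemma gm_step x y : a <= x -> x < y -> y <= d -> gm y < gm x /\ gm x <= gm y + (y - x).
Proof.
move=> ax xy yd; have := br_gstrict (sy_m S) ax xy yd; rewrite !mulN1r ltrN2 => h; split => //.
have := br_glip (sy_m S) ax (ltW xy) yd; rewrite ltr0_norm ?subr_lt0// => h2.
have : r * (y - x) <= 1 * (y - x).
  by apply: ler_wpM2r; [linear|apply/ltW; exact: br_r (sy_p S)].
linear.
Qed.

Lemma gp_a : gp a = a.
Proof. by have [fa _ _] := sy_fE S; rewrite -[X in gp X]fa (br_gf (sy_p S)) ?lexx// ltW. Qed.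

Lemma gm_a : gm a = b.
Proof. by have [_ _ fb] := sy_fE S; rewrite -[X in gm X]fb (br_gf (sy_m S)) ?lexx// ltW. Qed.

(** One-sided limits in [rho = L rho]. The map [gp] preserves sides and [gm] exchanges them; that
    sign is the sign of the derivative on the decreasing branch. *)
Lemma jump_relation z : a <= z -> z < d ->
  jump rho z = jump rho (gp z) / dmap a b f (gp z) + jump rho (gm z) / dmap a b f (gm z).
Proof.
move=> az zd; have [V vV] := rho_varle D A.
have E := rho_fixed D A.
have [V' vV'] := varle_iter S 1 (md_w1 D) vV.
have R1 := varle_cvg_right (x := z) vV; have R2 := varle_cvg_left (x := z) vV.
have P1 := varle_cvg_right (x := gp z) vV; have P2 := varle_cvg_left (x := gp z) vV.
have M1 := varle_cvg_right (x := gm z) vV; have M2 := varle_cvg_left (x := gm z) vV.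
set r1 := lim _ in R1; set r2 := lim _ in R2; set p1 := lim _ in P1; set p2 := lim _ in P2.
set m1 := lim _ in M1; set m2 := lim _ in M2.
rewrite (jumpE R1 R2) (jumpE P1 P2) (jumpE M1 M2).
have zd0 : 0 < d - z by rewrite subr_gt0.
have gpR : gp y @[y --> z^'+] --> (gp z)^'+.
  by apply: (cvg_right_right zd0) => y zy yd; apply: gp_step => //; linear.
have gmR : gm y @[y --> z^'+] --> (gm z)^'-.
  by apply: (cvg_right_left zd0) => y zy yd; apply: gm_step => //; linear.
have vpR : v u @[u --> (gp z)^'+] --> (dmap a b f (gp z))^-1.
  move: az; rewrite le_eqVlt => /orP[/eqP <-|az]; first by rewrite gp_a; exact: md_da D.
  have /andP[h1 h2] := br_in (sy_p S) az zd.
  by rewrite (md_dp D h1 h2) invrK; apply: cvg_at_right_filter; exact: v_continuous_p.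
have vmR : v u @[u --> (gm z)^'-] --> - (dmap a b f (gm z))^-1.
  move: az; rewrite le_eqVlt => /orP[/eqP <-|az]; first by rewrite gm_a; exact: md_db D.
  have /andP[h1 h2] := br_in (sy_m S) az zd.
  rewrite (md_dm D h1 h2) invrN invrK opprK.
  by apply: cvg_at_left_filter; exact: v_continuous_m.
have LR : L rho y @[y --> z^'+] --> (dmap a b f (gp z))^-1 * p1 + - (dmap a b f (gm z))^-1 * m2.
  have H : v (gp y) * rho (gp y) + v (gm y) * rho (gm y) @[y --> z^'+] -->
      (dmap a b f (gp z))^-1 * p1 + - (dmap a b f (gm z))^-1 * m2.
    apply: cvgD; apply: cvgM.
    - exact: (cvg_comp _ _ gpR vpR).
    - exact: (cvg_comp _ _ gpR P1).
    - exact: (cvg_comp _ _ gmR vmR).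
    - exact: (cvg_comp _ _ gmR M2).
  apply: cvg_trans H; apply: near_eq_cvg; apply/near_rightP; exists (d - z) => // y zy yd.
  by rewrite op_in//; linear.
have -> := cvg_eqc_right R1 LR E.
(* At [z = a] the preimages are [a] and [b], and [rho] vanishes beyond both. *)
move: az; rewrite le_eqVlt => /orP[/eqP za|az].
  rewrite -za gp_a gm_a in P2 M1 R2 *.
  have zero_left : rho y @[y --> a^'-] --> (0 : R).
    have c0 : cst 0 y @[y --> a^'-] --> (0 : R) by exact: cvg_cst.
    apply: cvg_trans c0; apply: near_eq_cvg; apply/near_leftP; exists 1 => // y _ ya.
    by rewrite /= (acim_supp A)//= in_itv/= => /andP[]; rewrite leNgt ya.
  have zero_right : rho y @[y --> b^'+] --> (0 : R).
    have c0 : cst 0 y @[y --> b^'+] --> (0 : R) by exact: cvg_cst.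
    apply: cvg_trans c0; apply: near_eq_cvg; apply/near_rightP; exists 1 => // y yb _.
    by rewrite /= (acim_supp A)//= in_itv/= => /andP[_]; rewrite leNgt yb.
  have -> : r2 = 0 by exact: (cvg_unique (@Rhausdorff R) R2 zero_left).
  have -> : p2 = 0 by exact: (cvg_unique (@Rhausdorff R) P2 zero_left).
  have -> : m1 = 0 by exact: (cvg_unique (@Rhausdorff R) M1 zero_right).
  ring.
have az0 : 0 < z - a by rewrite subr_gt0.
have /andP[h1 h2] := br_in (sy_p S) az zd; have /andP[h3 h4] := br_in (sy_m S) az zd.
have gpL : gp y @[y --> z^'-] --> (gp z)^'-.
  by apply: (cvg_left_left az0) => y zy yd; apply: gp_step => //; linear.
have gmL : gm y @[y --> z^'-] --> (gm z)^'+.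
  by apply: (cvg_left_right az0) => y zy yd; apply: gm_step => //; linear.
have LL : L rho y @[y --> z^'-] --> v (gp z) * p2 + v (gm z) * m1.
  have H : v (gp y) * rho (gp y) + v (gm y) * rho (gm y) @[y --> z^'-] -->
      v (gp z) * p2 + v (gm z) * m1.
    apply: cvgD; apply: cvgM.
    - apply: (cvg_comp _ _ gpL); apply: cvg_at_left_filter; exact: v_continuous_p.
    - exact: (cvg_comp _ _ gpL P2).
    - apply: (cvg_comp _ _ gmL); apply: cvg_at_right_filter; exact: v_continuous_m.
    - exact: (cvg_comp _ _ gmL M1).
  apply: cvg_trans H; apply: near_eq_cvg; apply/near_leftP; exists (z - a) => // y zy yd.
  by rewrite op_in//; linear.
have -> := cvg_eqc_left R2 LL E.
rewrite (md_dp D h1 h2) (md_dm D h3 h4) invrN !invrK; ring.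
Qed.

End JumpRelation.

(** * The atomic part of the derivative of the density *)

Section Saltus.
Context {R : realType}.
Context {a b c l r K M : R} {f gp gm v q : R -> R}.
Hypothesis D : model a b c f gp gm v q l r K M.
Notation d := (f c).
Let S := md_sys D.
Let ac := sy_ac S.
Let cb := sy_cb S.
Let ab := sy_ab S.
Let ad := sy_ad S.
Let db := sy_d S.
Context {rho rho_reg : R -> R}.
Hypothesis H : decomposed_density a b c f rho rho_reg.
Let A := dd_acim H.
Notation N := (N_of f c).
Notation o n := (iter n f c).
Notation s n := (s_coef f c rho n).

(* Indexed from [0]: [salt k] is the jump at [c_(k+1)]. *)
Definition salt k : R := if le_onat k.+1 N then s k.+1 else 0.

(** The pairing of [Y] with the atomic measure that has mass [s_n] at [c_n]; [rho_sal] and [J_of]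
    are special values. *)
Definition sigma (Y : R -> R) : R := limn (series (fun k => salt k * Y (o k.+1))).

Lemma orbit_inj i j : le_onat i.+1 N -> le_onat j.+1 N -> o i.+1 = o j.+1 -> i = j.
Proof.
case E : (N_of f c) => [n|] /= h1 h2 e.
  by have [_ inj _] := N_of_Some E; apply/eqP; rewrite -eqSS; apply/eqP/inj.
by have := N_of_None (i := i.+1) (j := j.+1) E e => -[].
Qed.

Lemma salt_bound : exists2 V, 0 <= V & forall m, series (fun k => `|salt k|) m <= V.
Proof.
have [V vV] := rho_varle D A; exists V; first exact: varle_ge0 vV.
move=> m; rewrite /series /=.
rewrite (bigID (fun k => le_onat k.+1 N)) /= [X in _ + X]big1 ?addr0; last first.
  by move=> k /negbTE h; rewrite /salt h normr0.
rewrite (eq_bigr (fun k => `|jump rho (o k.+1)|)); last by move=> k h; rewrite /salt h.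
rewrite -big_filter.
rewrite -(big_map (fun k => o k.+1) xpredT (fun x => `|jump rho x|)).
apply: jump_sum vV _; rewrite map_inj_in_uniq ?filter_uniq ?iota_uniq// => i j.
by rewrite !mem_filter => /andP[hi _] /andP[hj _]; exact: orbit_inj.
Qed.

Lemma sum_uptoE Y : sum_upto N (fun n => s n * Y (o n)) = sigma Y.
Proof.
rewrite /sum_upto /sigma; congr (limn _); apply/funext => m.
rewrite /series /= big_add1 /= big_mkcond /=; apply: eq_bigr => k _.
by rewrite /salt; case: ifP => _ //; rewrite mul0r.
Qed.

Lemma rho_salE x : rho_sal f c rho x = sigma (fun p => Hstep p x).
Proof. exact: (sum_uptoE (fun p => Hstep p x)). Qed.

Lemma J_ofE X : J_of f c rho X = sigma X.
Proof. exact: sum_uptoE. Qed.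

Lemma orbit_in k : a <= o k.+1 <= d.
Proof.
have /andP[h1 h2] := sy_iter_in S k (ltW ac) (ltW cb).
by rewrite iterS; exact: (sy_f_in S).
Qed.

Lemma Hstep_norm p x : `|Hstep p x| <= 1 :> R.
Proof.
rewrite /Hstep; case: ifP => _; first by rewrite normrN normr1.
case: ifP => _; first by rewrite normr0.
by rewrite normrN ger0_norm ?invr_ge0// invf_le1// ler1n.
Qed.

Lemma Hstep_locally_constant p x : x <> p -> \forall y \near x, Hstep p y = Hstep p x :> R.
Proof.
move=> xp; case: (ltgtP x p) => // h.
  apply: filterS (lt_nbhsl h) => y yp.
  by rewrite /Hstep yp h.
apply: filterS (lt_nbhsr h) => y yp.
by rewrite /Hstep yp h (lt_gtF yp) (lt_gtF h).
Qed.

(** Partial sums are constant near [p], and the remainders are small uniformly in the point. *)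
Lemma rho_sal_continuous p : (forall k, le_onat k.+1 N -> o k.+1 <> p) ->
  {for p, continuous (rho_sal f c rho)}.
Proof.
move=> hp; have [V V0 hV] := salt_bound.
apply/cvgrPdist_le => e e0.
have /cvgrPdist_le /(_ (e / 2) ltac:(by rewrite divr_gt0)) [m _ /(_ m (leqnn m))] := stail_cvg hV.
rewrite sub0r normrN => hm.
have lc : \forall y \near p, series (fun k => salt k * Hstep (o k.+1) y) m =
    series (fun k => salt k * Hstep (o k.+1) p) m.
  elim: m {hm} => [|m IH].
    by apply: (@filterE _ (nbhs p)) => y; rewrite /series /= !big_geq.
  have hm : \forall y \near p, salt m * Hstep (o m.+1) y = salt m * Hstep (o m.+1) p.
    rewrite /salt; case: ifP => h; last by apply: (@filterE _ (nbhs p)) => y; rewrite !mul0r.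
    have := Hstep_locally_constant (fun e' => hp m h (esym e')).
    by apply: filterS => y ->.
  move: IH hm; apply: filterS2 => y h1 h2.
  by move: h1; rewrite /series /= !big_nat_recr//= => ->; rewrite h2.
apply: filterS lc => y E; rewrite !rho_salE /sigma.
have h1 := weighted_series_tail m hV (fun k => Hstep_norm (o k.+1) y).
have h2 := weighted_series_tail m hV (fun k => Hstep_norm (o k.+1) p).
rewrite E in h1; have h3 := ler_norm (stail salt m).
move: h1 h2; rewrite !mul1r !ler_norml => /andP[h4 h5] /andP[h6 h7].
by apply/andP; split; linear.
Qed.

(** Continuity of [rho_reg] enters here: it confines the jumps of [rho] to the critical orbit. *)
Lemma jump_off_orbit p : (forall k, le_onat k.+1 N -> o k.+1 <> p) -> jump rho p = 0.
Proof.
move=> hp; apply: jump_continuous.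
have -> : rho = (fun x => rho_sal f c rho x + rho_reg x).
  by apply/funext => x; exact: (dd_decomp H).
by apply: cvgD; [exact: rho_sal_continuous|exact: (dd_cont H)].
Qed.

Lemma f_eq_d x : a <= x -> x <= b -> f x = d -> x = c.
Proof.
move=> ax xb e; have [xc|/ltW cx] := leP x c.
  by rewrite -(br_gf (sy_p S) ax xc) e (br_gf (sy_p S) (ltW ac) (lexx c)).
by rewrite -(br_gf (sy_m S) cx xb) e (br_gf (sy_m S) (lexx c) (ltW cb)).
Qed.

Lemma preimage_lt z : a <= z -> z < d ->
  [/\ a <= gp z, gp z < c, c < gm z & gm z <= b].
Proof.
move=> az zd; have /andP[p1 p2] := br_g (sy_p S) z; have /andP[m1 m2] := br_g (sy_m S) z.
have fp := br_fg (sy_p S) az (ltW zd); have fm := br_fg (sy_m S) az (ltW zd).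
split => //; rewrite lt_neqAle ?p2 ?m1 andbT; apply/eqP => e.
  by move: zd; rewrite -fp e ltxx.
by move: zd; rewrite -fm -e ltxx.
Qed.

(* Dual to pushing jumps forward along the critical orbit; orbits are cut when
   they return to [c], which produces the truncation at [M_f]. *)
Definition Tst (Y : R -> R) p : R := if p == c then 0 else Y (f p) / dmap a b f p.

Lemma Tst_bound Y B : (forall x, a <= x -> x <= d -> `|Y x| <= B) ->
  forall x, a <= x -> x <= d -> `|Tst Y x| <= r * B.
Proof.
move=> hB x ax xd; have B0 : 0 <= B by exact: le_trans (normr_ge0 _) (hB d (ltW ad) (lexx _)).
have r0 := br_r0 (sy_p S); have xb := le_trans xd db.
rewrite /Tst; case: eqP => [_|ne]; first by rewrite normr0 mulr_ge0// ltW.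
rewrite normrM mulrC ler_pM//; first exact: (md_dr D).
by have /andP[h1 h2] := sy_f_in S ax xb; exact: hB.
Qed.

Lemma sigma_cvg Y B : (forall x, a <= x -> x <= d -> `|Y x| <= B) ->
  series (fun k => salt k * Y (o k.+1)) m @[m --> \oo] --> sigma Y.
Proof.
move=> hB; have [V V0 hV] := salt_bound.
apply: (@weighted_series_cvg _ salt (fun k => Y (o k.+1)) V B hV) => k.
by have /andP[h1 h2] := orbit_in k; exact: hB.
Qed.

Lemma sigma_bound : exists2 V, 0 <= V &
  forall Y B, (forall x, a <= x -> x <= d -> `|Y x| <= B) -> `|sigma Y| <= B * V.
Proof.
have [V V0 hV] := salt_bound; exists V => // Y B hB.
apply: weighted_series_bound hV _ => k.
by have /andP[h1 h2] := orbit_in k; exact: hB.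
Qed.

Lemma fiber_sum n p : N = Some n -> (0 < n)%N ->
  \sum_(k < n | o k.+1 == p) (s k.+1 / dmap a b f (o k.+1)) = jump rho p / dmap a b f p.
Proof.
move=> E n0; have [ex|nex] := pselect (exists k : 'I_n, o k.+1 = p).
  have [k0 e0] := ex.
  rewrite (bigD1 k0) ?e0 ?eqxx//= [X in _ + X]big1 ?addr0 /s_coef ?e0// => k /andP[/eqP ek nk].
  exfalso; move/negP: nk; apply; apply/eqP/val_inj.
  have hk (i : 'I_n) : le_onat i.+1 N by rewrite E /=.
  exact: (orbit_inj (hk k) (hk k0) (etrans ek (esym e0))).
rewrite (jump_off_orbit (p := p)) ?mul0r.
  by apply: big1 => k /eqP ek; exfalso; apply: nex; exists k.
by move=> k; rewrite E /= => kn ek; apply: nex; exists (Ordinal kn).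
Qed.

(** The jump relation summed over the orbit: each jump beyond the first comes from jumps at
    preimages. The jump at the critical value [d] falls outside that relation and splits off. *)
Lemma sigma_relation Y B : (forall x, a <= x -> x <= d -> `|Y x| <= B) ->
  sigma Y = s 1 * Y (o 1) + sigma (Tst Y).
Proof.
move=> hB; case E : (N_of f c) => [n|].
  have [n0 inj [m /andP[m0 mn] em]] := N_of_Some E.
  have finE Z : sigma Z = \sum_(k < n) s k.+1 * Z (o k.+1).
    have C : forall j, (n <= j)%N -> series (fun k => salt k * Z (o k.+1)) j =
        \sum_(k < n) s k.+1 * Z (o k.+1).
      move=> j nj; rewrite /series /= big_mkord (big_ord_widen _ (fun k => s k.+1 * Z (o k.+1)) nj).
      rewrite [RHS]big_mkcond; apply: eq_bigr => k _; rewrite /salt E /=.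
      by case: ifP => _ //; rewrite mul0r.
    apply: lim_near_cst => //; exists n => // j nj; exact: C.
  rewrite !finE; case: n n0 inj mn em E finE => // n _ inj mn em E finE.
  rewrite big_ord_recl /=; congr (_ + _).
  pose z (i : 'I_n) := o i.+2.
  have zin i : a <= z i /\ z i < d.
    have /andP[h1 h2] := orbit_in i.+1; split; first exact: h1.
    rewrite lt_neqAle h2 andbT; apply/eqP => e.
    have := inj 1%N i.+2 isT; rewrite /= ltnS ltn_ord => /(_ isT (esym e)) => -[].
    done.
  (* In the preperiodic case one orbit point has two preimages in the list, so jumps are grouped by
     fibres of [f]. *)
  have step (i : 'I_n) : s i.+2 = \sum_(k < n.+1 | f (o k.+1) == z i)
      (s k.+1 / dmap a b f (o k.+1)).
    have [z1 z2] := zin i; have [p1 p2 p3 p4] := preimage_lt z1 z2.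
    have fp := br_fg (sy_p S) z1 (ltW z2); have fm := br_fg (sy_m S) z1 (ltW z2).
    rewrite [LHS](jump_relation D A z1 z2) -(fiber_sum (gp (z i)) E isT) -(fiber_sum (gm (z i)) E isT).
    rewrite [RHS](bigID (fun k : 'I_n.+1 => o k.+1 == gp (z i))) /=; congr (_ + _).
      apply: eq_bigl => k; apply/idP/idP => [/eqP e|/andP[_ ->]//].
      by rewrite e fp !eqxx.
    apply: eq_bigl => k; apply/idP/idP => [/eqP e|/andP[/eqP e ne]].
      by rewrite e fm eqxx /= gt_eqF// (lt_trans p2).
    have /andP[h1 h2] := orbit_in k.
    have [e'|e'] := preimage_cases D h1 (le_trans h2 db) e; last exact/eqP.
    by move/eqP: ne; case.
  transitivity (\sum_(i < n) \sum_(k < n.+1 | f (o k.+1) == z i)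
      (s k.+1 / dmap a b f (o k.+1) * Y (z i))).
    by apply: eq_bigr => i _; transitivity (s i.+2 * Y (z i)) => //; rewrite step mulr_suml.
  rewrite (exchange_big_dep xpredT) //=; apply: eq_bigr => k _.
  (* A term at [c] is sent to [d], which is none of the [z i]; this is the case in which [Tst] is
     set to [0]. *)
  rewrite /Tst; case: eqP => [ec|nc].
    rewrite mulr0 big1// => i /eqP e; exfalso.
    by have [_] := zin i; rewrite -e ec ltxx.
  have [i0 ei0] : exists i : 'I_n, z i = f (o k.+1).
    have [kn|nk] := ltnP k n; first by exists (Ordinal kn).
    have kE : (k : nat) = n by apply/eqP; rewrite eqn_leq nk -ltnS ltn_ord.
    case: m m0 mn em => // -[|m] _ mn em; last first.
      exists (Ordinal (mn : (m < n)%N)); rewrite kE; exact: esym em.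
    exfalso; apply: nc; have /andP[h1 h2] := orbit_in k.
    by apply: f_eq_d => //; [exact: le_trans h2 db|rewrite kE; exact: em].
  rewrite (bigD1 i0) ?ei0 ?eqxx//= [X in _ + X]big1 ?addr0.
    by rewrite mulrAC -mulrA.
  move=> i /andP[/eqP e ne]; exfalso; move/negP: ne; apply; apply/eqP/val_inj.
  have := inj i.+2 i0.+2; rewrite /= !ltnS !ltn_ord => /(_ isT isT).
  have ez : z i = z i0 by rewrite -e ei0.
  by move=> /(_ ez) => -[].
have saltE k : salt k = s k.+1 by rewrite /salt E.
have noc k : o k.+1 <> c by move=> e; have := N_of_None (i := k.+1) (j := 0%N) E e.
have zin k : a <= o k.+2 /\ o k.+2 < d.
  have /andP[h1 h2] := orbit_in k.+1; split; first exact: h1.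
  rewrite lt_neqAle h2 andbT; apply/eqP => e.
  by have := N_of_None (i := k.+2) (j := 1%N) E e.
have step k : s k.+2 = s k.+1 / dmap a b f (o k.+1).
  have [z1 z2] := zin k; have [p1 p2 p3 p4] := preimage_lt z1 z2.
  have fp := br_fg (sy_p S) z1 (ltW z2); have fm := br_fg (sy_m S) z1 (ltW z2).
  have /andP[h1 h2] := orbit_in k.
  (* On an infinite orbit the second preimage is not an orbit point, so a single term of the jump
     relation survives. *)
  have off p : f p = o k.+2 -> p <> o k.+1 -> jump rho p = 0.
    move=> fpE ne; apply: jump_off_orbit => j _ ej; apply: ne; rewrite -ej.
    have ee : o j.+2 = o k.+2 by rewrite -fpE -ej.
    by have [->] := N_of_None E ee.
  rewrite {1}/s_coef (jump_relation D A z1 z2).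
  have [e|e] := preimage_cases D h1 (le_trans h2 db) (erefl (f (o k.+1))).
    have e' : gp (o k.+2) = o k.+1 by rewrite [RHS]e.
    rewrite e' (off (gm (o k.+2))) ?mul0r ?addr0// => e2.
    by move: (lt_trans p2 p3); rewrite e2 e' ltxx.
  have e' : gm (o k.+2) = o k.+1 by rewrite [RHS]e.
  rewrite e' (off (gp (o k.+2))) ?mul0r ?add0r// => e2.
  by move: (lt_trans p2 p3); rewrite e2 e' ltxx.
have c1 := sigma_cvg hB; have c2 := sigma_cvg (Tst_bound hB).
have rec m : series (fun k => salt k * Y (o k.+1)) m.+1 =
    s 1 * Y (o 1) + series (fun k => salt k * Tst Y (o k.+1)) m.
  rewrite /series /= big_nat_recl//= saltE; congr (_ + _); apply: eq_bigr => k _.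
  rewrite !saltE step /Tst; case: eqP => [/noc //|_].
  by rewrite -iterS; ring.
have c3 : series (fun k => salt k * Y (o k.+1)) m.+1 @[m --> \oo] --> sigma Y.
  by rewrite (cvg_shiftS (series (fun k => salt k * Y (o k.+1)))).
have c4 : series (fun k => salt k * Y (o k.+1)) m.+1 @[m --> \oo] -->
    s 1 * Y (o 1) + sigma (Tst Y).
  have -> : (fun m => series (fun k => salt k * Y (o k.+1)) m.+1) =
    (fun m => s 1 * Y (o 1) + series (fun k => salt k * Tst Y (o k.+1)) m).
    by apply/funext => m; exact: rec.
  by apply: cvgD => //; exact: cvg_cst.
exact: (cvg_unique (@Rhausdorff R) c3 c4).
Qed.

Lemma iter_Tst_bound Y B j : (forall x, a <= x -> x <= d -> `|Y x| <= B) ->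
  forall x, a <= x -> x <= d -> `|iter j Tst Y x| <= r ^+ j * B.
Proof.
move=> hB; elim: j => [|j IH]; first by move=> x h1 h2; rewrite expr0 mul1r; exact: hB.
by move=> x h1 h2; rewrite iterS exprS -mulrA; exact: (Tst_bound IH).
Qed.

Lemma sigma_iter Y B j : (forall x, a <= x -> x <= d -> `|Y x| <= B) ->
  sigma Y = \sum_(i < j) s 1 * iter i Tst Y (o 1) + sigma (iter j Tst Y).
Proof.
move=> hB; elim: j => [|j IH]; first by rewrite big_ord0 add0r.
rewrite big_ord_recr /= IH -addrA; congr (_ + _).
exact: (sigma_relation (iter_Tst_bound j hB)).
Qed.

Lemma iter_TstE Y i p : iter i Tst Y p =
  if [forall u : 'I_i, iter u f p != c] then Y (iter i f p) / diter a b f i p else 0.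
Proof.
elim: i p => [|i IH] p.
  rewrite ifT; last by apply/forallP => -[].
  by rewrite /diter big_ord0 divr1.
rewrite iterS /Tst IH /diter big_ord_recl /=.
have E : [forall u : 'I_i.+1, iter u f p != c] =
    (p != c) && [forall u : 'I_i, iter u f (f p) != c].
  apply/forallP/andP => [h|[h1 /forallP h2] u].
    split; first by have := h ord0.
    by apply/forallP => u; have := h (lift ord0 u); rewrite lift0 iterSr.
  case: (unliftP ord0 u) => [j ->|->] //.
  by rewrite lift0 iterSr; exact: h2.
rewrite E; case: (p =P c) => [//|_] /=; case: ifP => _; last by rewrite mul0r.
rewrite -iterSr -mulrA -invfM [_ * dmap _ _ _ _]mulrC /=; congr (_ / (_ * _)).
by apply: eq_bigr => u _; rewrite -iterSr -iterS.
Qed.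

(** The index [k] corresponds to [i = k - 1]. Once the orbit has returned to [c], at time [M_f], all
    further iterates of [Tst] vanish at [c_1]. *)
Lemma orbit_sumE Y j :
  \sum_(1 <= k < (min_onat j (M_of f c)).+1) (s 1 * Y (o k) / diter a b f k.-1 (o 1)) =
  \sum_(i < j) s 1 * iter i Tst Y (o 1).
Proof.
rewrite big_add1 /= big_mkord.
have mj : (min_onat j (M_of f c) <= j)%N.
  by rewrite /min_onat; case: (M_of f c) => // m; exact: geq_minl.
rewrite (big_ord_widen _ (fun i => s 1 * Y (o i.+1) / diter a b f i (o 1)) mj) big_mkcond.
apply: eq_bigr => i _; rewrite iter_TstE -iterSr.
case: ifPn => [hi|hi].
  rewrite ifT ?mulrA//; apply/forallP => u; rewrite -iterSr; apply/eqP.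
  move: hi; rewrite /min_onat; case E : (M_of f c) => [m|] hi.
    have [_ _ h] := M_of_Some E; apply: h => /=.
    by apply: leq_ltn_trans (ltn_ord u) _; rewrite (leq_trans hi)// geq_minr.
  exact: (M_of_None E).
rewrite ifF ?mulr0//; apply/negbTE/negP => /forallP h.
move: hi; rewrite /min_onat; case E : (M_of f c) => [m|]; last by rewrite ltn_ord.
have [m0 em _] := M_of_Some E; rewrite -leqNgt geq_min leqNgt ltn_ord /= => mi.
have mi' : (m.-1 < i)%N by rewrite prednK.
by have := h (Ordinal mi'); rewrite /= -iterSr prednK// em eqxx.
Qed.

(** By [sigma_iter] the sum differs from [sigma Y] by [sigma (iter j Tst Y)], which is of order
    [r ^+ j]. *)
Lemma orbit_sum_cvg Y B : (forall x, a <= x -> x <= d -> `|Y x| <= B) ->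
  \sum_(1 <= k < (min_onat j (M_of f c)).+1) (s 1 * Y (o k) / diter a b f k.-1 (o 1))
    @[j --> \oo] --> sigma Y.
Proof.
move=> hB; have [V V0 hV] := sigma_bound.
have B0 : 0 <= B by exact: le_trans (normr_ge0 _) (hB d (ltW ad) (lexx _)).
have r0 := br_r0 (sy_p S); have r1 := br_r (sy_p S).
have bd j : `|sigma (iter j Tst Y)| <= r ^+ j * (B * V).
  by rewrite mulrA; exact: hV (iter_Tst_bound j hB).
have z : sigma (iter j Tst Y) @[j --> \oo] --> (0 : R).
  apply/cvgrPdist_le => e e0.
  have := @cvg_geometric R (B * V) r; rewrite gtr0_norm// => /(_ r1).
  move=> /cvgrPdist_le /(_ e e0) [m _ Hm]; exists m => // j mj.
  rewrite sub0r normrN (le_trans (bd j))//; have := Hm j mj.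
  by rewrite /= sub0r normrN mulrC; exact: le_trans (ler_norm _).
have -> : (fun j => \sum_(1 <= k < (min_onat j (M_of f c)).+1)
    (s 1 * Y (o k) / diter a b f k.-1 (o 1))) = (fun j => sigma Y - sigma (iter j Tst Y)).
  apply/funext => j; rewrite orbit_sumE [X in X - _](sigma_iter j hB); ring.
rewrite -[X in _ --> X]subr0; apply: cvgB => //; exact: cvg_cst.
Qed.

End Saltus.

(** * The derivative of the regular part *)

Section GeometricSeries.
Context {R : realType}.
Implicit Types (p : nat -> R -> R).

Lemma geometric_dominated_cvg (u : nat -> R) (C k : R) : 0 <= C -> 0 < k -> k < 1 ->
  (forall j, `|u j| <= C * k ^+ j) -> cvgn (series u).
Proof.
move=> C0 k0 k1 hu; apply: normed_cvg.
apply: (@series_le_cvg _ _ (geometric C k)) => //.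
- by move=> j /=.
- by move=> j /=; rewrite mulr_ge0// exprn_ge0// ltW.
- by apply: is_cvg_geometric_series; rewrite gtr0_norm.
Qed.

Lemma varle_series p (C k a : R) : 0 <= C -> 0 < k -> k < 1 ->
  (forall j, varle (p j) (C * k ^+ j)) -> (forall j, p j a = 0) ->
  (forall x, cvgn (series (fun j => p j x))) /\
  varle (fun x => limn (series (fun j => p j x))) (C / (1 - k)).
Proof.
move=> C0 k0 k1 vp pa.
have pb j x : `|p j x| <= C * k ^+ j.
  by have := varle_osc a x (vp j); rewrite pa subr0.
have pc x : cvgn (series (fun j => p j x)).
  by apply: geometric_dominated_cvg C0 k0 k1 _ => j; exact: pb.
split => //.
have ex j : exists F : R -> R, gctrl (p j) F /\ forall x y, F y - F x <= C * k ^+ j.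
  by have [F cF bF] := vp j; exists F.
have [F HF] := choice ex.
(* Controls matter up to constants; normalised at [a] they are dominated by a geometric sequence. *)
pose G j x := F j x - F j a.
have Gb j x : `|G j x| <= C * k ^+ j.
  have [_ bF] := HF j; rewrite /G ler_norml; apply/andP; split; last exact: bF.
  by rewrite lerNl opprB; exact: bF.
have Gc x : cvgn (series (fun j => G j x)).
  by apply: geometric_dominated_cvg C0 k0 k1 _ => j; exact: Gb.
exists (fun x => limn (series (fun j => G j x))) => [x y xy|x y].
  have h1 : `|series (fun j => p j y) m - series (fun j => p j x) m| @[m --> \oo] -->
      `|limn (series (fun j => p j y)) - limn (series (fun j => p j x))|.
    by apply: cvg_norm; apply: cvgB; [exact: pc|exact: pc].
  have h2 : series (fun j => G j y) m - series (fun j => G j x) m @[m --> \oo] -->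
      limn (series (fun j => G j y)) - limn (series (fun j => G j x)).
    by apply: cvgB; [exact: Gc|exact: Gc].
  rewrite -(cvg_lim (@Rhausdorff R) h1) -(cvg_lim (@Rhausdorff R) h2).
  apply: ler_lim; [by apply/cvg_ex; eexists; exact: h1|by apply/cvg_ex; eexists; exact: h2|].
  apply: (@filterE _ \oo) => m; rewrite /series /= -!sumrB (le_trans (ler_norm_sum _ _ _))//.
  apply: ler_sum => j _; have [cF _] := HF j.
  by rewrite /G opprB addrA subrK; exact: cF.
have h2 : series (fun j => G j y) m - series (fun j => G j x) m @[m --> \oo] -->
    limn (series (fun j => G j y)) - limn (series (fun j => G j x)).
  by apply: cvgB; [exact: Gc|exact: Gc].
have h3 : series (geometric C k) m @[m --> \oo] --> C / (1 - k).
  by apply: cvg_geometric_series; rewrite gtr0_norm.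
rewrite -(cvg_lim (@Rhausdorff R) h2) -(cvg_lim (@Rhausdorff R) h3).
apply: ler_lim; [by apply/cvg_ex; eexists; exact: h2|by apply/cvg_ex; eexists; exact: h3|].
apply: (@filterE _ \oo) => m; rewrite /series /= -sumrB.
apply: ler_sum => j _; have [_ bF] := HF j.
by rewrite /G opprB addrA subrK; exact: bF.
Qed.

End GeometricSeries.

(** * The formal derivative and integration by parts *)

Section RegularPart.
Context {R : realType}.
Context {a b c l r K M : R} {f gp gm v q : R -> R}.
Hypothesis D : model a b c f gp gm v q l r K M.
Notation d := (f c).
Notation op := (@op _ a d gp gm).
Let S := md_sys D.
Let ac := sy_ac S.
Let cb := sy_cb S.
Let ab := sy_ab S.
Let ad := sy_ad S.
Let db := sy_d S.
Context {rho : R -> R}.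
Hypothesis A : acim_density a b f rho.

(** Neumann series of the operator with weight [w2], applied to [G = op w3 rho]; [variation_decay]
    gives convergence in variation. *)
Lemma regular_density_exists : exists DD : R -> R, [/\ exists V, varle DD V,
  (forall x, ~~ (a < x < d) -> DD x = 0) &
  forall x, DD x = op (@w2 _ c v) DD x + op (@w3 _ c v q) rho x].
Proof.
have [V vV] := rho_varle D A; have [V1 vG] := varle_iter S 1 (weight_w3 D) vV.
set G := iter 1 _ _ in vG.
have Gout x : ~~ (a < x < b) -> G x = 0.
  by move=> nx; apply: op_out; apply: contra nx => /andP[-> /= xd]; exact: lt_le_trans db.
have rr := md_r D.
have r2 : r * r < 1 by nra.
have [C [k [C0 k0 k1 HV]]] := variation_decay S (weight_w2 D) r2 ltac:(linear).
have V10 := varle_ge0 vG.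
pose p j := iter j (op (@w2 _ c v)) G.
have vp j : varle (p j) (C * V1 * k ^+ j) by rewrite mulrAC; exact: HV.
have pa j : p j a = 0 by apply: (iter_op_out S) => //; rewrite ltxx.
have [pc vD] := varle_series (mulr_ge0 C0 V10) k0 k1 vp pa.
have pout j x : ~~ (a < x < d) -> p j x = 0 by by move=> nx; case: j => [|j]; exact: op_out.
exists (fun x => limn (series (fun j => p j x))); split; first by eexists; exact: vD.
  move=> x nx; rewrite (_ : series _ = cst 0) ?lim_cst//.
  by apply/funext => m; rewrite /series /= big1// => j _; exact: pout.
move=> x; have [/andP[ax xd]|nx] := boolP (a < x < d); last first.
  rewrite !op_out// addr0 (_ : series _ = cst 0) ?lim_cst//.
  by apply/funext => m; rewrite /series /= big1// => j _; exact: pout.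
have h1 : series (fun j => p j x) m.+1 @[m --> \oo] --> limn (series (fun j => p j x)).
  by rewrite (cvg_shiftS (series (fun j => p j x))); exact: pc.
apply: (cvg_unique (@Rhausdorff R) h1).
have -> : (fun m => series (fun j => p j x) m.+1) = (fun m =>
    (@w2 _ c v (gp x) * series (fun j => p j (gp x)) m +
     @w2 _ c v (gm x) * series (fun j => p j (gm x)) m) + op (@w3 _ c v q) rho x).
  apply/funext => m; rewrite /series /= big_nat_recl// addrC; congr (_ + _).
  rewrite !mulr_sumr -big_split /=; apply: eq_bigr => j _.
  exact: op_in.
apply: cvgD; last exact: cvg_cst.
rewrite op_in//; apply: cvgD; apply: cvgM; try exact: cvg_cst; exact: pc.
Qed.

(* The sign of [f'] carried by [sgc] cancels the reversal of orientation on the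
   decreasing branch. *)
Lemma prim_signed (u h : R -> R) U V x y : varle u U -> varle h V ->
  a < x -> x <= y -> y < d ->
  prim a (op (fun z => sgc c z * (v z * u z)) h) y -
  prim a (op (fun z => sgc c z * (v z * u z)) h) x =
  (prim a (fun z => u z * h z) (gp y) - prim a (fun z => u z * h z) (gp x)) +
  (prim a (fun z => u z * h z) (gm y) - prim a (fun z => u z * h z) (gm x)).
Proof.
move=> vu vh ax xy yd; have nu := varle_nice vu; have nh := varle_nice vh.
have [Mu _ hMu] := nice_bound nu; have [Mh _ hMh] := nice_bound nh.
have nv := sy_v S.
have ns := @sgc_nice _ c.
have vuh := varleM hMu hMh vu vh.
have nuh := varle_nice vuh.
have vnuh := varleZ (-1) vuh.
have nw : nice (fun z => sgc c z * (v z * u z)) by apply: niceM => //; exact: niceM.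
have ay := lt_le_trans ax xy; have xd := le_lt_trans xy yd.
have /andP[px1 px2] := br_in (sy_p S) ax xd; have /andP[py1 py2] := br_in (sy_p S) ay yd.
have /andP[mx1 mx2] := br_in (sy_m S) ax xd; have /andP[my1 my2] := br_in (sy_m S) ay yd.
have fpx := br_fg (sy_p S) (ltW ax) (ltW xd); have fpy := br_fg (sy_p S) (ltW ay) (ltW yd).
have fmx := br_fg (sy_m S) (ltW ax) (ltW xd); have fmy := br_fg (sy_m S) (ltW ay) (ltW yd).
have gpxy : gp x <= gp y by have := br_gmono (sy_p S) xy; rewrite !mul1r.
have gmxy : gm y <= gm x by have := br_gmono (sy_m S) xy; rewrite !mulN1r lerN2.
have h1 := transfer_prim (sy_p S) nv vuh (ltW px1) gpxy (ltW py2).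
have h2 := transfer_prim (sy_m S) nv vnuh (ltW my1) gmxy (ltW mx2).
rewrite fpx fpy mul1r in h1; rewrite fmx fmy !primZ// in h2.
have e1 : @transfer _ a d gp (fun z => sgc c z * (v z * u z) * h z) =
    @transfer _ a d gp (fun y => v y * (u y * h y)).
  apply/funext => z; rewrite /transfer; case: ifP => // /andP[az zd].
  by have /andP[_ zc] := br_in (sy_p S) az zd; rewrite /sgc zc; ring.
have e2 : @transfer _ a d gm (fun z => sgc c z * (v z * u z) * h z) =
    @transfer _ a d gm (fun y => v y * (-1 * (u y * h y))).
  apply/funext => z; rewrite /transfer; case: ifP => // /andP[az zd].
  by have /andP[cz _] := br_in (sy_m S) az zd; rewrite /sgc (lt_gtF cz); ring.
have n1 : nice (@transfer _ a d gp (fun z => sgc c z * (v z * u z) * h z)).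
  by apply: (transfer_nice (sy_p S)); exact: niceM.
have n2 : nice (@transfer _ a d gm (fun z => sgc c z * (v z * u z) * h z)).
  by apply: (transfer_nice (sy_m S)); exact: niceM.
rewrite (primD _ y n1 n2) (primD _ x n1 n2).
rewrite e1 e2; linear.
Qed.

(* On a branch, [Omega w] is a primitive of [v w'] when [w] is differentiable. *)
Definition Omega (w : R -> R) t : R := w t * v t - prim a (fun z => w z * q z) t.

Definition same_branch (u t : R) := (a < u /\ t < c) \/ (c < u /\ t < b).

Lemma v_ftc u t : same_branch u t -> u <= t -> v t - v u = prim a q t - prim a q u.
Proof. by case=> -[h1 h2] ut; [exact: (md_ftcp D)|exact: (md_ftcm D)]. Qed.

Lemma v_lip u t : same_branch u t -> u <= t -> `|v t - v u| <= K * (t - u).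
Proof.
by case=> -[h1 h2] ut; [exact: (wt_p (md_w1 D))|exact: (wt_m (md_w1 D))].
Qed.

Lemma same_branch_sub u t x y : same_branch u t -> u <= x -> y <= t -> same_branch x y.
Proof. by case=> -[h1 h2] ux yt; [left|right]; split; linear. Qed.

Lemma same_branch_a u t : same_branch u t -> a < u.
Proof. by case=> -[h1 h2]; [|exact: lt_trans h1]. Qed.

Lemma nice_q : nice q.
Proof. by have [V hV] := md_vq D; exact: varle_nice hV. Qed.

(** Over a short interval the increment of [Omega w] is [v y * (w y - w x)] plus a second-order
    integral; the first term contracts by [r], the second fits into [kap - r]. *)
Lemma Omega_contract w F kap u t : nice w -> {homo F : x y / x <= y} -> r < kap ->
  same_branch u t -> u <= t ->
  (forall x y, u <= x -> x <= y -> y <= t -> `|w y - w x| <= F y - F x) ->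
  `|Omega w t - Omega w u| <= kap * (F t - F u).
Proof.
move=> nw hF rk sb ut cF; have M0 := md_M0 D; have nq := nice_q.
have nwq := niceM nw nq.
pose e := (kap - r) / (M + 1).
have e0 : 0 < e by rewrite divr_gt0// ?subr_gt0//; linear.
rewrite mulrBr; apply: (@subdivision _ (Omega w) (fun x => kap * F x) u t e) => //.
move=> x y ux xy yt yxe; rewrite -mulrBr.
have ax : a <= x by have := same_branch_a sb; linear.
have sbxy := same_branch_sub sb ux yt.
have dF : 0 <= F y - F x by rewrite subr_ge0 hF.
have -> : Omega w y - Omega w x = v y * (w y - w x) +
    (prim a (fun z => w x * q z - w z * q z) y - prim a (fun z => w x * q z - w z * q z) x).
  rewrite !primB//; try exact: niceZ.
  rewrite !primZ// /Omega; have := v_ftc sbxy xy => h.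
  have h' : w x * (v y - v x) = w x * (prim a q y - prim a q x) by rewrite h.
  linear.
have h1 : `|prim a (fun z => w x * q z - w z * q z) y -
    prim a (fun z => w x * q z - w z * q z) x| <= (F y - F x) * M * (y - x).
  apply: prim_lip => //; first by apply: niceB => //; exact: niceZ.
  move=> z xz zy; rewrite -mulrBl normrM; apply: ler_pM => //; last exact: (md_qM D).
  rewrite distrC (le_trans (cF x z ux (ltW xz) _))//; first linear.
  by rewrite lerD2r hF// ltW.
have h2 : (F y - F x) * M * (y - x) <= (F y - F x) * (kap - r).
  rewrite -mulrA ler_wpM2l// (le_trans (ler_wpM2l M0 yxe))//.
  have : M / (M + 1) <= 1 by rewrite ler_pdivrMr; linear.
  move=> h; rewrite /e mulrCA -[leRHS]mulr1 ler_wpM2l//; linear.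
have h3 : `|v y * (w y - w x)| <= r * (F y - F x).
  by rewrite normrM ler_pM ?(wt_le (md_w1 D))//; exact: cF.
rewrite (le_trans (ler_normD _ _))//; linear.
Qed.

(** Integration by parts, with [q] as the derivative of [v] on a branch. *)
Lemma Omega_prim DD V u t : varle DD V -> same_branch u t -> u <= t ->
  Omega (prim a DD) t - Omega (prim a DD) u =
  prim a (fun z => v z * DD z) t - prim a (fun z => v z * DD z) u.
Proof.
move=> vD sb ut; have nD := varle_nice vD; have [B B0 hB] := nice_bound nD.
have nq := nice_q; have nv := sy_v S; have M0 := md_M0 D; have K0 := md_K0 D.
have au := same_branch_a sb.
(* [prim a DD] itself need not be bounded *)
pose E x := prim a DD (clamp a b x).
have El x y : a <= x -> x <= y -> `|prim a DD y - prim a DD x| <= B * (y - x).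
  by move=> ax xy; apply: prim_lip.
have nE : nice E.
  apply: (@varle_nice _ _ (B * (b - a))); exists (fun x => B * clamp a b x).
    move=> x y xy; have /andP[h1 h2] := clamp_in x (ltW ab).
    by rewrite -mulrBr; apply: El => //; exact: clamp_homo.
  move=> x y; have /andP[h1 h2] := clamp_in x (ltW ab); have /andP[h3 h4] := clamp_in y (ltW ab).
  by rewrite -mulrBr ler_wpM2l ?(ltW B0)//; linear.
have tb : t <= b by case: sb => -[_ h]; [exact: ltW (lt_trans h cb)|exact: ltW].
have EE x : a <= x -> x <= b -> E x = prim a DD x by move=> h1 h2; rewrite /E clamp_id.
clearbody E.
have nEq := niceM nE nq; have nvD := niceM nv nD.
have OE x y : u <= x -> x <= y -> y <= t ->
    prim a (fun z => prim a DD z * q z) y - prim a (fun z => prim a DD z * q z) x =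
    prim a (fun z => E z * q z) y - prim a (fun z => E z * q z) x.
  move=> ux xy yt; rewrite /prim.
  have key z : a <= z -> z <= b -> \int[lebesgue_measure]_(x in `[a, z[) (prim a DD x * q x) =
     \int[lebesgue_measure]_(x in `[a, z[) (E x * q x).
    move=> az zb; apply: eq_Rintegral => w; rewrite inE/= in_itv/= => /andP[aw wz].
    by rewrite EE// (le_trans (ltW wz)).
  by rewrite !key//; linear.
suff H : Omega (prim a DD) t - prim a (fun z => v z * DD z) t =
   Omega (prim a DD) u - prim a (fun z => v z * DD z) u by linear.
apply: (@subdivision_quadratic _
  (fun x => Omega (prim a DD) x - prim a (fun z => v z * DD z) x)
  (fun x => (K * B + B * M) * x)) => // x y ux xy yt.
have ax : a <= x by linear.
have sbxy := same_branch_sub sb ux yt.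
have xb : x <= b by linear.
have yb : y <= b by linear.
have -> : Omega (prim a DD) y - prim a (fun z => v z * DD z) y -
    (Omega (prim a DD) x - prim a (fun z => v z * DD z) x) =
    (prim a (fun z => v y * DD z - v z * DD z) y - prim a (fun z => v y * DD z - v z * DD z) x) +
    (prim a (fun z => E x * q z - E z * q z) y - prim a (fun z => E x * q z - E z * q z) x).
  rewrite !primB//; try exact: niceZ.
  rewrite !primZ// (EE x)//; have h := v_ftc sbxy xy.
  have h' : prim a DD x * (v y - v x) = prim a DD x * (prim a q y - prim a q x) by rewrite h.
  rewrite /Omega; have e3 := OE x y ux xy yt; linear.
have h1 : `|prim a (fun z => v y * DD z - v z * DD z) y -
    prim a (fun z => v y * DD z - v z * DD z) x| <= K * (y - x) * B * (y - x).
  apply: prim_lip => //; first by apply: niceB => //; exact: niceZ.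
  move=> z xz zy; rewrite -mulrBl normrM; apply: ler_pM => //.
  have sbz := same_branch_sub sbxy (ltW xz) (lexx y).
  rewrite (le_trans (v_lip sbz (ltW zy)))// ler_wpM2l//; linear.
have h2 : `|prim a (fun z => E x * q z - E z * q z) y -
    prim a (fun z => E x * q z - E z * q z) x| <= B * (y - x) * M * (y - x).
  apply: prim_lip => //; first by apply: niceB => //; exact: niceZ.
  move=> z xz zy; rewrite -mulrBl normrM; apply: ler_pM => //; last exact: (md_qM D).
  rewrite !EE//; try linear.
  rewrite distrC (le_trans (El x z ax (ltW xz)))// ler_wpM2l ?(ltW B0)//; linear.
rewrite (le_trans (ler_normD _ _))//; linear.
Qed.

End RegularPart.

Section Hsteps.
Context {R : realType}.

Lemma Hstep_lt (p x : R) : x < p -> Hstep p x = -1.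
Proof. by rewrite /Hstep => ->. Qed.

Lemma Hstep_gt (p x : R) : p < x -> Hstep p x = 0.
Proof. by move=> h; rewrite /Hstep h (lt_gtF h). Qed.

Lemma Hstep_in (p x : R) : -1 <= Hstep p x <= 0.
Proof. by rewrite /Hstep; do 2?case: ifP => _; apply/andP; split; linear. Qed.

Lemma Hstep_homo (p : R) : {homo Hstep p : x y / x <= y}.
Proof.
move=> x y; rewrite le_eqVlt => /orP[/eqP->//|xy].
have [xp|px] := ltP x p; first by rewrite (Hstep_lt xp); have /andP[] := Hstep_in p y.
by rewrite (Hstep_gt (le_lt_trans px xy)); have /andP[] := Hstep_in p x.
Qed.

Lemma varle_Hstep (p : R) : varle (Hstep p) 1.
Proof.
exists (Hstep p) => [x y xy|x y]; first by rewrite ger0_norm// subr_ge0 Hstep_homo.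
by have /andP[h1 h2] := Hstep_in p x; have /andP[h3 h4] := Hstep_in p y; linear.
Qed.

End Hsteps.

(** * Interchanging the saltus sum with integrals *)

Section Interchange.
Context {R : realType}.
Context {a b c l r K M : R} {f gp gm v q : R -> R}.
Hypothesis D : model a b c f gp gm v q l r K M.
Notation d := (f c).
Notation op := (@op _ a d gp gm).
Let S := md_sys D.
Let ac := sy_ac S.
Let cb := sy_cb S.
Let ab := sy_ab S.
Let ad := sy_ad S.
Let db := sy_d S.
Context {rho rho_reg : R -> R}.
Hypothesis H : decomposed_density a b c f rho rho_reg.
Let A := dd_acim H.
Notation o n := (iter n f c).
Notation sigma := (@sigma _ c f rho).
Notation salt := (@salt _ c f rho).
Notation rhos := (rho_sal f c rho).

Definition bounded_ad (Y : R -> R) := exists B, forall x, a <= x -> x <= d -> `|Y x| <= B.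

Lemma sigma_eq Y Z : (forall k, Y (o k.+1) = Z (o k.+1)) -> sigma Y = sigma Z.
Proof.
by move=> e; rewrite /sigma; congr (limn (series _)); apply/funext => k; rewrite e.
Qed.

Lemma sigmaB Y Z : bounded_ad Y -> bounded_ad Z ->
  sigma (fun p => Y p - Z p) = sigma Y - sigma Z.
Proof.
move=> [B hB] [C hC]; have h1 := sigma_cvg D H hB; have h2 := sigma_cvg D H hC.
have h3 : forall x, a <= x -> x <= d -> `|Y x - Z x| <= B + C.
  by move=> x ax xd; rewrite (le_trans (ler_normB _ _))// lerD ?hB ?hC.
have h4 := sigma_cvg D H h3; apply: (cvg_unique (@Rhausdorff R) h4).
have -> : series (fun k => salt k * (Y (o k.+1) - Z (o k.+1))) =
    (fun m => series (fun k => salt k * Y (o k.+1)) m - series (fun k => salt k * Z (o k.+1)) m).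
  by apply/funext => m; rewrite /series /= -sumrB; apply: eq_bigr => k _; rewrite mulrBr.
by apply: cvgB.
Qed.

Lemma sigmaZ k Y : bounded_ad Y -> sigma (fun p => k * Y p) = k * sigma Y.
Proof.
move=> [B hB]; have h1 := sigma_cvg D H hB.
have h3 : forall x, a <= x -> x <= d -> `|k * Y x| <= `|k| * B.
  by move=> x ax xd; rewrite normrM ler_wpM2l ?hB.
have h4 := sigma_cvg D H h3; apply: (cvg_unique (@Rhausdorff R) h4).
have -> : series (fun j => salt j * (k * Y (o j.+1))) =
    (fun m => k * series (fun k => salt k * Y (o k.+1)) m).
  by apply/funext => m; rewrite /series /= mulr_sumr; apply: eq_bigr => j _; rewrite mulrCA.
by apply: cvgM => //; exact: cvg_cst.
Qed.

Lemma bounded_Hstep x : bounded_ad (fun p => Hstep p x).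
Proof. by exists 1 => p _ _; exact: Hstep_norm. Qed.

Lemma bounded_adB Y Z : bounded_ad Y -> bounded_ad Z -> bounded_ad (fun p => Y p - Z p).
Proof.
move=> [B hB] [C hC]; exists (B + C) => x ax xd.
by rewrite (le_trans (ler_normB _ _))// lerD ?hB ?hC.
Qed.

Lemma bounded_adZ k Y : bounded_ad Y -> bounded_ad (fun p => k * Y p).
Proof. by move=> [B hB]; exists (`|k| * B) => x ax xd; rewrite normrM ler_wpM2l ?hB. Qed.

Lemma varle_rho_sal : exists V, varle rhos V.
Proof.
have [V V0 hV] := salt_bound D H.
have Hb z k : `|Hstep (o k.+1) z| <= 1 by exact: Hstep_norm.
have hV' m : series (fun k => `| `|salt k| |) m <= V.
  rewrite (_ : series _ = series (fun k => `|salt k|)) //.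
  by congr series; apply/funext => k; rewrite normr_id.
have c1 z := weighted_series_cvg hV (Hb z).
have c2 z := weighted_series_cvg hV' (Hb z).
pose G z := limn (series (fun k => `|salt k| * Hstep (o k.+1) z)).
have cG x y : \sum_(0 <= k < m) (`|salt k| * (Hstep (o k.+1) y - Hstep (o k.+1) x)) @[m --> \oo] -->
    G y - G x.
  have -> : (fun m => \sum_(0 <= k < m) (`|salt k| * (Hstep (o k.+1) y - Hstep (o k.+1) x))) =
     (fun m => series (fun k => `|salt k| * Hstep (o k.+1) y) m -
       series (fun k => `|salt k| * Hstep (o k.+1) x) m).
    by apply/funext => m; rewrite /series /= -sumrB; apply: eq_bigr => k _; rewrite mulrBr.
  by apply: cvgB; exact: c2.
exists V; exists G => [x y xy|x y].
  have h1 : `|series (fun k => salt k * Hstep (o k.+1) y) m -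
        series (fun k => salt k * Hstep (o k.+1) x) m| @[m --> \oo] --> `|rhos y - rhos x|.
    by rewrite !(rho_salE (f := f)); apply: cvg_norm; apply: cvgB; exact: c1.
  have h2 := cG x y.
  rewrite -(cvg_lim (@Rhausdorff R) h1) -(cvg_lim (@Rhausdorff R) h2).
  apply: ler_lim; [by apply/cvg_ex; eexists; exact: h1|by apply/cvg_ex; eexists; exact: h2|].
  apply: (@filterE _ \oo) => m; rewrite /series /= -sumrB (le_trans (ler_norm_sum _ _ _))//.
  apply: ler_sum => k _; rewrite -mulrBr normrM ler_wpM2l//.
  by rewrite ger0_norm// subr_ge0 Hstep_homo.
have h2 := cG x y.
rewrite -(cvg_lim (@Rhausdorff R) h2).
apply: limr_le; first by apply/cvg_ex; eexists; exact: h2.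
apply: (@filterE _ \oo) => m; rewrite (le_trans _ (hV m))//.
rewrite /series /=.
apply: ler_sum => k _; rewrite -[leRHS]mulr1 ler_wpM2l//.
by rewrite (le_trans (ler_norm _))// (varle_osc _ _ (varle_Hstep _)).
Qed.

(** The partial sums of [rho_sal] converge uniformly, with error [stail]. *)
Lemma prim_sigma h t : nice h -> a <= t ->
  prim a (fun z => rhos z * h z) t = sigma (fun p => prim a (fun z => Hstep p z * h z) t).
Proof.
move=> nh at_; have [B B0 hB] := nice_bound nh; have [V V0 hV] := salt_bound D H.
have [W vW] := varle_rho_sal; have ns := varle_nice vW.
have nH p : nice (fun z => Hstep p z * h z).
  by apply: niceM => //; exact: varle_nice (varle_Hstep p).
have bY : bounded_ad (fun p => prim a (fun z => Hstep p z * h z) t).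
  exists (B * (t - a)) => p _ _.
  have := @prim_lip _ a _ a t B (nH p) (lexx a) at_; rewrite prim_base subr0; apply=> z _ _.
  by rewrite normrM -[leRHS]mul1r ler_pM// Hstep_norm.
have [C hC] := bY; have c1 := sigma_cvg D H hC.
apply: (cvg_unique (@Rhausdorff R) _ c1).
pose u m z := series (fun k => salt k * Hstep (o k.+1) z) m.
have uE m : nice (fun z => u m z * h z) /\ prim a (fun z => u m z * h z) t =
   series (fun k => salt k * prim a (fun z => Hstep (o k.+1) z * h z) t) m.
  elim: m => [|m [n1 IH]].
    have -> : (fun z => u 0%N z * h z) = cst 0.
      by apply/funext => z; rewrite /u /series /= big_geq// mul0r.
    split; first exact: nice_cst.
    have := prim_cst 0 (lexx a) at_; rewrite prim_base subr0 mul0r => ->.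
    by rewrite /series /= big_geq.
  have E : (fun z => u m.+1 z * h z) =
     (fun z => u m z * h z + salt m * (Hstep (o m.+1) z * h z)).
    by apply/funext => z; rewrite /u /series /= big_nat_recr//= mulrDl mulrA.
  rewrite E; split; first by apply: niceD => //; exact: niceZ.
  rewrite primD//; last exact: niceZ.
  by rewrite primZ// IH /series /= [RHS]big_nat_recr.
have bd m : `|prim a (fun z => rhos z * h z) t -
   series (fun k => salt k * prim a (fun z => Hstep (o k.+1) z * h z) t) m| <=
   stail salt m * (B * (t - a)).
  have [n1 <-] := uE m; rewrite -primB//; last exact: niceM.
  have nd : nice (fun z => rhos z * h z - u m z * h z) by apply: niceB => //; exact: niceM.
  have := @prim_lip _ a _ a t (stail salt m * B) nd (lexx a) at_.
  rewrite prim_base subr0 -mulrA; apply => z _ _.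
  rewrite -mulrBl normrM ler_pM// rho_salE.
  rewrite -[leRHS]mul1r; apply: weighted_series_tail hV _ => k; exact: Hstep_norm.
apply/cvgrPdist_le => e e0.
have B1 : 0 < B * (t - a) + 1.
  by rewrite ltr_pwDr// mulr_ge0 ?subr_ge0// ltW.
have /cvgrPdist_le /(_ (e / (B * (t - a) + 1)) ltac:(by rewrite divr_gt0)) := stail_cvg hV.
apply: filterS => m; rewrite sub0r normrN => hm.
rewrite (le_trans (bd m))//.
have Bt : 0 <= B * (t - a) by rewrite mulr_ge0 ?subr_ge0// ltW.
rewrite (le_trans (ler_wpM2r Bt (le_trans (ler_norm _) hm)))//.
by rewrite mulrAC ler_pdivrMr// ler_wpM2l ?ltW// ltrDl.
Qed.

End Interchange.

Section Derivative.
Context {R : realType}.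
Context {a b c l r K M : R} {f gp gm v q : R -> R}.
Hypothesis D : model a b c f gp gm v q l r K M.
Notation d := (f c).
Notation op := (@op _ a d gp gm).
Notation L := (op v).
Notation Omega := (@Omega _ a v q).
Notation same_branch := (@same_branch _ a b c).
Let S := md_sys D.
Let ac := sy_ac S.
Let cb := sy_cb S.
Let ab := sy_ab S.
Let ad := sy_ad S.
Let db := sy_d S.
Let nq := nice_q D.
Let nv := sy_v S.

Lemma OmegaB w1 w2 t : nice w1 -> nice w2 ->
  Omega (fun z => w1 z - w2 z) t = Omega w1 t - Omega w2 t.
Proof.
move=> n1 n2; rewrite /Omega.
have -> : (fun z => (w1 z - w2 z) * q z) = (fun z => w1 z * q z - w2 z * q z).
  by apply/funext => z; rewrite mulrBl.
rewrite primB; [ring|exact: niceM|exact: niceM].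
Qed.

(** The Stieltjes integral of [v] against a unit mass at [p]. *)
Lemma Omega_Hstep p u t : same_branch u t -> u <= t -> p <> u -> p <> t ->
  Omega (Hstep p) t - Omega (Hstep p) u = if u < p < t then v p else 0.
Proof.
move=> sb ut pu pt; have au := ltW (same_branch_a D sb).
have nH := varle_nice (varle_Hstep p); have nHq := niceM nH nq.
have z1 x y : a <= x -> x <= y -> p <= x ->
    prim a (fun z => Hstep p z * q z) y - prim a (fun z => Hstep p z * q z) x = 0.
  move=> ax xy px; have <- : 0 * (y - x) = 0 by rewrite mul0r.
  rewrite -(prim_cst 0 ax xy); apply: prim_eq => //; first exact: nice_cst.
  by move=> z xz _; rewrite Hstep_gt ?mul0r//; exact: le_lt_trans xz.
have z2 x y : a <= x -> x <= y -> y <= p ->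
    prim a (fun z => Hstep p z * q z) y - prim a (fun z => Hstep p z * q z) x =
    - (prim a q y - prim a q x).
  move=> ax xy yp.
  have e := @prim_eq _ a (fun z => Hstep p z * q z) (fun z => -1 * q z) x y nHq (niceZ (-1) nq) ax xy.
  rewrite e ?primZ//; first ring.
  by move=> z _ zy; rewrite Hstep_lt//; exact: lt_le_trans yp.
have vt := v_ftc D sb ut.
case: (ltgtP p u) => [p_u|u_p|//].
  have pt' := lt_le_trans p_u ut.
  by rewrite /Omega (Hstep_gt p_u) (Hstep_gt pt') /=; have := z1 u t au ut (ltW p_u); linear.
case: (ltgtP p t) => [p_t|t_p|//] /=.
  have sb1 : same_branch u p by apply: same_branch_sub sb _ (ltW p_t).
  have v1 := v_ftc D sb1 (ltW u_p).
  rewrite /Omega (Hstep_lt u_p) (Hstep_gt p_t).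
  have := z1 p t (le_trans au (ltW u_p)) (ltW p_t) (lexx p).
  by have := z2 u p au (ltW u_p) (lexx p); linear.
rewrite /Omega (Hstep_lt u_p) (Hstep_lt t_p).
by have := z2 u t au ut (ltW t_p); linear.
Qed.

Context {rho rho_reg : R -> R}.
Hypothesis H : decomposed_density a b c f rho rho_reg.
Let A := dd_acim H.
Notation o n := (iter n f c).
Notation sigma := (@sigma _ c f rho).
Notation rhos := (rho_sal f c rho).

(** For differentiable [w] this is the integral over [[x, y]] of the operator of weight [w2] applied
    to [w']; in this form it makes sense for every bounded measurable [w]. *)
Definition branch_diff w x y : R :=
  (Omega w (gp y) - Omega w (gp x)) + (Omega w (gm y) - Omega w (gm x)).

Definition regular_point x := rho x = L rho x /\ forall k, o k.+1 <> x.

Lemma irregular_countable : countable [set x | ~ regular_point x].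
Proof.
have h1 := rho_fixed D A.
have h2 : countable (range (fun k => o k.+1)) by exact: card_image_le.
apply: countableS (countableU h1 h2) => x /= nx.
have [e|e] := pselect (rho x = L rho x); last by left.
right; apply: contrapT => no; apply: nx; split => // k ek.
by apply: no; exists k.
Qed.

Lemma branches x y : a < x -> x <= y -> y < d ->
  [/\ same_branch (gp x) (gp y), gp x <= gp y, same_branch (gm y) (gm x) & gm y <= gm x].
Proof.
move=> ax xy yd; have ay := lt_le_trans ax xy; have xd := le_lt_trans xy yd.
have /andP[px1 px2] := br_in (sy_p S) ax xd; have /andP[py1 py2] := br_in (sy_p S) ay yd.
have /andP[mx1 mx2] := br_in (sy_m S) ax xd; have /andP[my1 my2] := br_in (sy_m S) ay yd.
split; [by left|by have := br_gmono (sy_p S) xy; rewrite !mul1r|by right|].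
by have := br_gmono (sy_m S) xy; rewrite !mulN1r lerN2.
Qed.

Lemma Tst_Hstep x y p : a < x -> x < y -> y < d -> a <= p -> p <= d ->
  f p <> x -> f p <> y ->
  @Tst _ a b c f (fun z => Hstep z y - Hstep z x) p = branch_diff (Hstep p) x y.
Proof.
move=> ax xy yd ap pd fx fy; have ay := lt_trans ax xy; have xd := lt_trans xy yd.
have pb := le_trans pd db.
have [sb1 le1 sb2 le2] := branches ax (ltW xy) yd.
have gpx := br_fg (sy_p S) (ltW ax) (ltW xd); have gpy := br_fg (sy_p S) (ltW ay) (ltW yd).
have gmx := br_fg (sy_m S) (ltW ax) (ltW xd); have gmy := br_fg (sy_m S) (ltW ay) (ltW yd).
have ne1 : p <> gp x by move=> e; apply: fx; rewrite e.
have ne2 : p <> gp y by move=> e; apply: fy; rewrite e.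
have ne3 : p <> gm x by move=> e; apply: fx; rewrite e.
have ne4 : p <> gm y by move=> e; apply: fy; rewrite e.
have h1 := Omega_Hstep sb1 le1 ne1 ne2; have h2 := Omega_Hstep sb2 le2 ne4 ne3.
have -> : branch_diff (Hstep p) x y =
  (if gp x < p < gp y then v p else 0) - (if gm y < p < gm x then v p else 0).
  by rewrite -h1 -h2 /branch_diff; ring.
have Yz z : z <> x -> z <> y -> Hstep z y - Hstep z x = if x < z < y then 1 else 0.
  move=> zx zy; case: (ltgtP z x) => [zx'|xz|//].
    by rewrite (Hstep_gt zx') (Hstep_gt (lt_trans zx' xy)) subrr.
  case: (ltgtP z y) => [zy'|yz|//] /=.
    by rewrite (Hstep_gt zy') (Hstep_lt xz) sub0r opprK.
  by rewrite (Hstep_lt xz) (Hstep_lt yz) subrr.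
have /andP[p1 p2] := br_in (sy_p S) ax xd; have /andP[p3 p4] := br_in (sy_p S) ay yd.
have /andP[m1 m2] := br_in (sy_m S) ax xd; have /andP[m3 m4] := br_in (sy_m S) ay yd.
rewrite /Tst Yz//; case: (ltgtP p c) => [pc|cp|->].
- have -> : gm y < p < gm x = false by rewrite ltNge (ltW (lt_trans pc m3)).
  have -> : (gp x < p < gp y) = (x < f p < y).
    have ef := br_gf (sy_p S) ap (ltW pc).
    have /andP[f1 f2] := br_f (sy_p S) ap (ltW pc).
    apply/andP/andP => -[h3 h4]; split.
    + rewrite ltNge; apply/negP => h; have := br_gmono (sy_p S) h.
      by rewrite !mul1r ef leNgt h3.
    + rewrite ltNge; apply/negP => h; have := br_gmono (sy_p S) h.
      by rewrite !mul1r ef leNgt h4.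
    + by have := br_gstrict (sy_p S) (ltW ax) h3 f2; rewrite !mul1r ef.
    + by have := br_gstrict (sy_p S) f1 h4 (ltW yd); rewrite !mul1r ef.
  case: ifP => [/andP[h3 h4]|_]; last by rewrite mul0r subr0.
  have ap' : a < p.
    rewrite lt_neqAle ap andbT; apply/eqP => e; have [fa _ _] := sy_fE S.
    by move: h3; rewrite -e fa; move/(lt_trans ax); rewrite ltxx.
  by rewrite (md_dp D ap' pc) invrK mul1r subr0.
- have -> : gp x < p < gp y = false.
    by rewrite [p < _]ltNge (ltW (lt_trans p4 cp)) andbF.
  have -> : (gm y < p < gm x) = (x < f p < y).
    have ef := br_gf (sy_m S) (ltW cp) pb.
    have /andP[f1 f2] := br_f (sy_m S) (ltW cp) pb.
    apply/andP/andP => -[h3 h4]; split.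
    + rewrite ltNge; apply/negP => h; have := br_gmono (sy_m S) h.
      by rewrite !mulN1r lerN2 ef leNgt h4.
    + rewrite ltNge; apply/negP => h; have := br_gmono (sy_m S) h.
      by rewrite !mulN1r lerN2 ef leNgt h3.
    + by have := br_gstrict (sy_m S) f1 h4 (ltW yd); rewrite !mulN1r ltrN2 ef.
    + by have := br_gstrict (sy_m S) (ltW ax) h3 f2; rewrite !mulN1r ltrN2 ef.
  case: ifP => [/andP[h3 h4]|_]; last by rewrite mul0r subr0.
  have pb' : p < b.
    rewrite lt_neqAle pb andbT; apply/eqP => e; have [_ _ fb] := sy_fE S.
    by move: h3; rewrite e fb; move/(lt_trans ax); rewrite ltxx.
  by rewrite (md_dm D cp pb') invrN invrK mul1r sub0r.
- by rewrite [c < gp y]ltNge (ltW p4) andbF [gm y < c]ltNge (ltW m3) subr0.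
Qed.

(** [sigma_relation] for the difference of two step functions: the term at [c_1 = d] vanishes
    because [x] and [y] lie left of [d], so the saltus part solves the homogeneous equation. *)
Lemma rho_sal_branch_diff x y : a < x -> x < y -> y < d ->
  regular_point x -> regular_point y -> rhos y - rhos x = branch_diff rhos x y.
Proof.
move=> ax xy yd [_ ox] [_ oy]; have xd := lt_trans xy yd; have ay := lt_trans ax xy.
have bH := @bounded_Hstep _ a c f.
have OE t : a <= t -> Omega rhos t =
    sigma (fun p => Omega (Hstep p) t) /\ @bounded_ad _ a c f (fun p => Omega (Hstep p) t).
  move=> at_.
  have bp : @bounded_ad _ a c f (fun p => prim a (fun z => Hstep p z * q z) t).
    have [B B0 hB] := nice_bound nq; exists (B * (t - a)) => p _ _.
    have nH : nice (fun z => Hstep p z * q z).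
      by apply: niceM => //; exact: varle_nice (varle_Hstep p).
    have := @prim_lip _ a _ a t B nH (lexx a) at_; rewrite prim_base subr0; apply=> z _ _.
    by rewrite normrM -[leRHS]mul1r ler_pM// Hstep_norm.
  have bv : @bounded_ad _ a c f (fun p => v t * Hstep p t) by apply: bounded_adZ; exact: bH.
  have E : (fun p => Omega (Hstep p) t) = (fun p => v t * Hstep p t - prim a (fun z => Hstep p z * q z) t).
    by apply/funext => p; rewrite /Omega mulrC.
  rewrite E; split; last exact: bounded_adB.
  rewrite (sigmaB D H)// (sigmaZ D H)//.
  by rewrite /Omega (prim_sigma D H)// mulrC (rho_salE (f := f)).
have bY : @bounded_ad _ a c f (fun z => Hstep z y - Hstep z x) by apply: bounded_adB; exact: bH.
have [B hB] := bY.
have -> : rhos y - rhos x = sigma (fun z => Hstep z y - Hstep z x).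
  by rewrite (sigmaB D H)// !rho_salE.
rewrite (sigma_relation D H hB) /= (Hstep_lt yd) (Hstep_lt xd) subrr mulr0 add0r.
have [sb1 le1 sb2 le2] := branches ax (ltW xy) yd.
have g1 : a <= gp x by exact: ltW (same_branch_a D sb1).
have g2 := le_trans g1 le1.
have g3 : a <= gm y by exact: ltW (same_branch_a D sb2).
have g4 := le_trans g3 le2.
have [e1 b1] := OE _ g1; have [e2 b2] := OE _ g2; have [e3 b3] := OE _ g3; have [e4 b4] := OE _ g4.
rewrite /branch_diff e1 e2 e3 e4.
have -> : sigma (fun p => Omega (Hstep p) (gp y)) - sigma (fun p => Omega (Hstep p) (gp x)) +
  (sigma (fun p => Omega (Hstep p) (gm y)) - sigma (fun p => Omega (Hstep p) (gm x))) =
  sigma (fun p => (Omega (Hstep p) (gp y) - Omega (Hstep p) (gp x)) -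
    (Omega (Hstep p) (gm x) - Omega (Hstep p) (gm y))).
  have E3 := sigmaB D H (bounded_adB b2 b1) (bounded_adB b4 b3).
  have E1 := sigmaB D H b2 b1; have E2 := sigmaB D H b4 b3.
  by rewrite [RHS]E3 E1 E2 opprB.
apply: sigma_eq => k; have /andP[h1 h2] := orbit_in D k.
have ex : f (o k.+1) <> x by exact: (ox k.+1).
have ey : f (o k.+1) <> y by exact: (oy k.+1).
rewrite (Tst_Hstep ax xy yd h1 h2 ex ey) /branch_diff; ring.
Qed.

End Derivative.

Section NearbyPoints.
Context {R : realType}.

Lemma clamp_lip (p q x y : R) : p <= q -> x <= y -> clamp p q y - clamp p q x <= y - x.
Proof.
move=> pq xy; have [yp|py] := leP y p.
  by rewrite !clamp_l ?subrr ?subr_ge0//; exact: le_trans yp.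
have [qx|xq] := leP q x.
  by rewrite !clamp_r ?subrr ?subr_ge0//; exact: le_trans xy.
apply: lerB.
  have [yq|qy] := leP y q; first by rewrite clamp_id// ltW.
  by rewrite clamp_r ?(ltW qy)// ltW.
have [xp|px] := leP x p; first by rewrite clamp_l.
by rewrite clamp_id// ltW.
Qed.

Lemma near_right_point (B : set R) (h : R -> R) (x y e : R) : {for x, continuous h} -> countable B ->
  x < y -> 0 < e -> exists x', [/\ x < x', x' < y, ~ B x' & `|h x' - h x| <= e].
Proof.
move=> ch cB xy e0.
have /cvgrPdist_le /(_ e e0) /near_rightP [t t0 Ht] : h z @[z --> x^'+] --> h x.
  exact: cvg_at_right_filter ch.
have xm : x < Num.min y (x + t) by rewrite lt_min xy ltrDl.
have [z /andP[xz]] := exists_off_countable xm cB.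
rewrite lt_min => /andP[zy zt] nB; exists z; split => //.
by rewrite distrC; exact: Ht.
Qed.

Lemma near_left_point (B : set R) (h : R -> R) (x y e : R) : {for y, continuous h} -> countable B ->
  x < y -> 0 < e -> exists y', [/\ x < y', y' < y, ~ B y' & `|h y' - h y| <= e].
Proof.
move=> ch cB xy e0.
have /cvgrPdist_le /(_ e e0) /near_leftP [t t0 Ht] : h z @[z --> y^'-] --> h y.
  exact: cvg_at_left_filter ch.
have xm : Num.max x (y - t) < y by rewrite gt_max xy ltrBlDr ltrDl.
have [z /andP[+ zy]] := exists_off_countable xm cB.
rewrite gt_max => /andP[xz tz] nB; exists z; split => //.
by rewrite distrC; exact: Ht.
Qed.

End NearbyPoints.

(** * Identification of the derivative of the regular part *)

Section RegularDerivative.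
Context {R : realType}.
Context {a b c l r K M : R} {f gp gm v q : R -> R}.
Hypothesis D : model a b c f gp gm v q l r K M.
Notation d := (f c).
Notation op := (@op _ a d gp gm).
Notation L := (op v).
Notation Omega := (@Omega _ a v q).
Notation branch_diff := (@branch_diff _ a gp gm v q).
Let S := md_sys D.
Let ac := sy_ac S.
Let cb := sy_cb S.
Let ab := sy_ab S.
Let ad := sy_ad S.
Let db := sy_d S.
Let nq := nice_q D.
Let nv := sy_v S.

Lemma prim_supported DD t : nice DD -> (forall x, ~~ (a < x < d) -> DD x = 0) ->
  prim a DD t = prim a DD (clamp a d t).
Proof.
move=> nD D0; have [ta|at_] := leP t a.
  by rewrite clamp_l ?(ltW ad)// prim_base prim_out.
have [td|dt] := leP t d; first by rewrite clamp_id// ltW.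
rewrite clamp_r ?(ltW ad) ?(ltW dt)//; apply/eqP; rewrite -subr_eq0; apply/eqP.
have <- : 0 * (t - d) = 0 by rewrite mul0r.
rewrite -(prim_cst 0 (ltW ad) (ltW dt)).
apply: prim_eq (ltW ad) (ltW dt) _ => //; first exact: nice_cst.
by move=> x dx _; apply: D0; rewrite [x < _]ltNge (ltW dx) andbF.
Qed.

Lemma varle_prim DD : nice DD -> (forall x, ~~ (a < x < d) -> DD x = 0) ->
  exists V, varle (prim a DD) V.
Proof.
move=> nD D0; have [B B0 hB] := nice_bound nD.
exists (B * (d - a)); exists (fun x => B * clamp a d x) => [x y xy|x y].
  rewrite (prim_supported y nD D0) (prim_supported x nD D0) -mulrBr.
  have /andP[h1 _] := clamp_in x (ltW ad).
  by apply: prim_lip => //; exact: clamp_homo.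
have /andP[h1 h2] := clamp_in x (ltW ad); have /andP[h3 h4] := clamp_in y (ltW ad).
by rewrite -mulrBr (ler_wpM2l (ltW B0))//; linear.
Qed.

Lemma prim_continuous psi x : nice psi ->
  (forall x, ~~ (a < x < d) -> psi x = 0) -> {for x, continuous (prim a psi)}.
Proof.
move=> nD D0; have [B B0 hB] := nice_bound nD.
apply: (@continuous_of_lipschitz _ (prim a psi) (x - 1) (x + 1) B x); [exact: ltW| |linear|linear].
move=> z y _ zy _; rewrite (prim_supported y nD D0) (prim_supported z nD D0).
have /andP[h1 _] := clamp_in z (ltW ad).
have h := @prim_lip _ a psi _ _ B nD h1 (clamp_homo a d zy) (fun w _ _ => hB w).
by rewrite (le_trans h)// (ler_wpM2l (ltW B0))// clamp_lip// ltW.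
Qed.

Context {rho rho_reg : R -> R}.
Hypothesis H : decomposed_density a b c f rho rho_reg.
Let A := dd_acim H.
Notation rhos := (rho_sal f c rho).
Notation regular_point := (@regular_point _ a c f gp gm v rho).

Lemma branch_diffB w1 w2 x y : nice w1 -> nice w2 ->
  branch_diff (fun z => w1 z - w2 z) x y = branch_diff w1 x y - branch_diff w2 x y.
Proof. by move=> n1 n2; rewrite /branch_diff !(OmegaB D)//; ring. Qed.

Definition increment_of (h : R -> R) x y : R :=
  (prim a h (gp y) - prim a h (gp x)) + (prim a h (gm y) - prim a h (gm x)).

(** By definition of [Omega], [v * rho] is [Omega rho] plus the primitive of [rho * q]. *)
Lemma rho_branch_diff x y : a < x -> x < y -> y < d -> regular_point x -> regular_point y ->
  rho y - rho x = branch_diff rho x y + increment_of (fun z => rho z * q z) x y.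
Proof.
move=> ax xy yd [ex _] [ey _]; rewrite ex ey !op_in//; try by [exact: lt_trans yd|exact: lt_trans xy].
rewrite /branch_diff /increment_of /Omega; ring.
Qed.

Lemma prim_branch_diff DD V x y : varle DD V -> (forall x, ~~ (a < x < d) -> DD x = 0) ->
  (forall x, DD x = op (@w2 _ c v) DD x + op (@w3 _ c v q) rho x) ->
  a < x -> x < y -> y < d ->
  prim a DD y - prim a DD x =
    branch_diff (prim a DD) x y + increment_of (fun z => rho z * q z) x y.
Proof.
move=> vD D0 DE ax xy yd; have nD := varle_nice vD; have [W vW] := rho_varle D A.
have nr := varle_nice vW; have [V1 vv] := md_vv D; have [V2 vq] := md_vq D.
have n1 : nice (op (@w2 _ c v) DD) by apply: (op_nice S) => //; exact: wt_nice (weight_w2 D).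
have n2 : nice (op (@w3 _ c v q) rho) by apply: (op_nice S) => //; exact: wt_nice (weight_w3 D).
have key t : prim a DD t = prim a (op (@w2 _ c v) DD) t + prim a (op (@w3 _ c v q) rho) t.
  by rewrite -primD//; congr (prim a _ t); exact: funext.
have e1 := prim_signed D vv vD ax (ltW xy) yd.
have e2 := prim_signed D vq vW ax (ltW xy) yd.
have [sb1 le1 sb2 le2] := branches D ax (ltW xy) yd.
have o1 := Omega_prim D vD sb1 le1; have o2 := Omega_prim D vD sb2 le2.
have -> : increment_of (fun z => rho z * q z) x y = increment_of (fun z => q z * rho z) x y.
  by congr (increment_of _ x y); apply/funext => z; rewrite mulrC.
rewrite [in LHS](key y) [X in _ - X](key x) /branch_diff /increment_of.
move: e1 e2 o1 o2; rewrite -/(@w2 _ c v) -/(@w3 _ c v q) => e1 e2 o1 o2.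
rewrite o1 -(opprB (Omega _ (gm x))) o2 opprB -e1 -e2.
by rewrite opprD addrACA.
Qed.

(** Right of [d] all step functions vanish, and so does [rho] off a countable set; continuity of
    [rho_reg] does the rest, [d] included. *)
Lemma rho_reg_right x : d <= x -> rho_reg x = 0.
Proof.
have z y : d < y -> rho y = L rho y -> rho_reg y = 0.
  move=> dy e; have := dd_decomp H y; rewrite (rho_salE (f := f)).
  have -> : @sigma _ c f rho (fun p => Hstep p y) = @sigma _ c f rho (fun p => 0 * Hstep p y).
    apply: sigma_eq => k; have /andP[_ h] := orbit_in D k.
    by rewrite Hstep_gt ?mulr0//; exact: le_lt_trans dy.
  rewrite (sigmaZ D H); last exact: bounded_Hstep.
  by rewrite mul0r add0r => <-; rewrite e op_out// [y < _]ltNge (ltW dy) andbF.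
move=> dx; apply/eqP; rewrite -normr_eq0 -normr_le0; apply/ler_addgt0Pr => e e0.
rewrite add0r; have [y [xy _ ny hy]] := near_right_point (@dd_cont _ _ _ _ _ _ _ H x)
  (rho_fixed D A) (ltr_pwDr ltr01 (lexx x)) e0.
by move: hy; rewrite (z y (le_lt_trans dx xy) (contrapT ny)) sub0r normrN normr_id.
Qed.

(* [rho_reg - prim a DD] satisfies a homogeneous equation whose right-hand side
   contracts variation by the factor [kap], hence it is constant. *)
Lemma regular_part_primitive : exists DD, [/\ exists V, varle DD V,
  (forall x, ~~ (a < x < d) -> DD x = 0) &
  forall x, a <= x -> x <= b -> rho_reg x = rho_reg a + prim a DD x].
Proof.
have [DD [[V vD] D0 DE]] := regular_density_exists D A; exists DD; split => //; first by exists V.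
have nD := varle_nice vD; have [VE vE] := varle_prim nD D0; have nE := varle_nice vE.
have [Vr vr] := rho_varle D A; have [Vs vs] := varle_rho_sal D H.
have nr := varle_nice vr; have ns := varle_nice vs.
pose w z := rho z - rhos z - prim a DD z.
have nrs := niceB nr ns.
have nw : nice w by exact: niceB.
have wE z : w z = rho_reg z - prim a DD z by rewrite /w (dd_decomp H z) [rhos z + _]addrC addrK.
have wd x y : a < x -> x < y -> y < d -> regular_point x -> regular_point y ->
    w y - w x = branch_diff w x y.
  move=> ax xy yd gx gy; rewrite !branch_diffB//.
  have e1 := rho_branch_diff ax xy yd gx gy.
  have e2 := prim_branch_diff vD D0 DE ax xy yd.
  have e3 := rho_sal_branch_diff D H ax xy yd gx gy.
  have -> : w y - w x = (rho y - rho x) - (rhos y - rhos x) - (prim a DD y - prim a DD x).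
    by rewrite /w; ring.
  rewrite e1 e2 e3; ring.
have /andP[r0 r1] := md_r D.
pose kap := (1 + r) / 2.
have rk : r < kap by rewrite /kap; linear.

have k1 : kap < 1 by rewrite /kap; linear.
have k0 : 0 <= kap by rewrite /kap; linear.
have wc x : {for x, continuous w}.
  have -> : w = (fun z => rho_reg z - prim a DD z) by apply/funext.
  by apply: continuousB; [exact: (dd_cont H)|exact: prim_continuous].
have wr x : d <= x -> w x = w d.
  move=> dx; rewrite !wE (rho_reg_right dx) (rho_reg_right (lexx d)).
  by rewrite (prim_supported x nD D0) clamp_r// ltW.
(* [P W] bounds the variation of [w] on [[a, b]] by [W]. *)
pose P (W : R) := exists F, [/\ {homo F : x y / x <= y}, F b - F a <= W &
  forall x y, a <= x -> x <= y -> y <= b -> `|w y - w x| <= F y - F x].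
have P0 : exists W, P W.
  have [F cF bF] := varleD (varleD vr (varleZ (-1) vs)) (varleZ (-1) vE).
  exists (Vr + `|-1| * Vs + `|-1| * VE); exists F; split; [exact: gctrl_homo cF|exact: bF|].
  by move=> x y _ xy _; have := cF x y xy; rewrite !mulN1r.
have Pk W : P W -> P (kap * W).
  (* Nondecreasing because [gp] increases and [gm] decreases. The two branch domains do not overlap,
     so its total increment is at most [kap] times that of [F]. *)
  move=> [F [hF bF cF]]; pose F2 x := kap * (F (gp x) - F (gm x)).
  have gph x y : x <= y -> gp x <= gp y by move=> xy; have := br_gmono (sy_p S) xy; rewrite !mul1r.
  have gmh x y : x <= y -> gm y <= gm x.
    by move=> xy; have := br_gmono (sy_m S) xy; rewrite !mulN1r lerN2.
  have hF2 : {homo F2 : x y / x <= y}.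
    by move=> x y xy; rewrite /F2 ler_wpM2l// lerB// hF// ?gph ?gmh.
  have good x y : a < x -> x < y -> y < d -> regular_point x -> regular_point y ->
      `|w y - w x| <= F2 y - F2 x.
    move=> ax xy yd gx gy; rewrite (wd x y ax xy yd gx gy) /branch_diff.
    have [sb1 le1 sb2 le2] := branches D ax (ltW xy) yd.
    have c1 := Omega_contract D nw hF rk sb1 le1; have c2 := Omega_contract D nw hF rk sb2 le2.
    have in1 : a <= gp x /\ gp y <= b.
      have /andP[h1 _] := br_g (sy_p S) x; have /andP[_ h2] := br_g (sy_p S) y.
      by split=> //; exact: le_trans h2 (ltW cb).
    have in2 : a <= gm y /\ gm x <= b.
      have /andP[h1 _] := br_g (sy_m S) y; have /andP[_ h2] := br_g (sy_m S) x.
      by split=> //; exact: le_trans (ltW ac) h1.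
    have {}c1 := c1 (fun z t uz zt tt => cF z t (le_trans in1.1 uz) zt (le_trans tt in1.2)).
    have {}c2 := c2 (fun z t uz zt tt => cF z t (le_trans in2.1 uz) zt (le_trans tt in2.2)).
    rewrite (le_trans (ler_normD _ _))// [X in _ + X]distrC (le_trans (lerD c1 c2))//.
    by rewrite /F2 le_eqVlt; apply/orP; left; apply/eqP; ring.
  (* The equation is available off a countable set; continuity of [w] extends the estimate to all
     points. *)
  have mid x y : a <= x -> x < y -> y <= d -> `|w y - w x| <= F2 y - F2 x.
    move=> ax xy yd; apply/ler_addgt0Pr => e e0.
    have e2 : 0 < e / 2 by rewrite divr_gt0.
    have cI := @irregular_countable _ a b c l r K M f gp gm v q D rho rho_reg H.
    have [y' [xy' yy' ny hy]] := near_left_point (wc y) cI xy e2.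
    have [x' [xx' xy'' nx hx]] := near_right_point (wc x) cI xy' e2.
    have g := good x' y' (le_lt_trans ax xx') xy'' (lt_le_trans yy' yd) (contrapT nx) (contrapT ny).
    have m1 := hF2 _ _ (ltW xx'); have m2 := hF2 _ _ (ltW yy').
    move: hx hy g; rewrite !ler_norml => /andP[a1 a2] /andP[a3 a4] /andP[a5 a6].
    by apply/andP; split; linear.
  exists F2; split => //.
    have gpa := gp_a D; have gma := gm_a D.
    rewrite /F2 -mulrBr ler_wpM2l// gpa gma.
    have /andP[_ h1] := br_g (sy_p S) b; have /andP[h2 _] := br_g (sy_m S) b.
    have := hF _ _ (le_trans h1 h2); linear.
  move=> x y ax; rewrite le_eqVlt => /orP[/eqP->|xy] yb; first by rewrite !subrr normr0.
  have [yd|dy] := leP y d; first exact: mid.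
  have [dx|xd] := leP d x.
    by rewrite (wr x)// (wr y) ?(ltW dy)// subrr normr0 subr_ge0 (hF2 _ _ (ltW xy)).
  by rewrite (wr y) ?(ltW dy)// (le_trans (mid x d ax xd (lexx d)))// lerD2r (hF2 _ _ (ltW dy)).
have [W PW] := P0.
have Pn n : P (kap ^+ n * W) by elim: n => [|n IH]; rewrite ?expr0 ?mul1r// exprS -mulrA; exact: Pk.
have W0 : 0 <= W by have [F [hF bF _]] := PW; rewrite (le_trans _ bF)// subr_ge0 hF// ltW.
move=> x ax xb.
have e : w x = w a.
  apply/eqP; rewrite -subr_eq0 -normr_le0.
  have c0 := @cvg_geometric R W kap; rewrite ger0_norm// in c0.
  have {}c0 := c0 k1; have -> : (0 : R) = limn (geometric W kap) by rewrite (cvg_lim _ c0).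
  apply: limr_ge; first by apply/cvg_ex; eexists; exact: c0.
  apply: (@filterE _ \oo) => n; have [F [hF bF cF]] := Pn n.
  rewrite (le_trans (cF a x (lexx a) ax xb))//= mulrC (le_trans _ bF)// lerD2r hF//.
by move: e; rewrite !wE prim_base subr0 => <-; rewrite subrK.
Qed.

End RegularDerivative.

(** * The two series *)

Section SmoothFactor.
Context {R : realType}.

Lemma prim_is_derive (a : R) psi x : nice psi -> a < x -> {for x, continuous psi} ->
  is_derive x 1 (prim a psi) (psi x).
Proof.
move=> np ax cp.
have q : (t^-1 *: (prim a psi (t *: 1 + x) - prim a psi x)) @[t --> 0^'] --> psi x.
  apply/cvgrPdist_le => e e0.
  have /cvgrPdist_le /(_ e e0) /nbhs_ballP[t /= t0 Ht] := cp.
  have m0 : 0 < Num.min t (x - a) by rewrite lt_min t0 subr_gt0.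
  apply/nbhs_ballP; exists (Num.min t (x - a)) => // s /=.
  rewrite /ball /= sub0r normrN lt_min => /andP[st sa] s0.
  have hs : s%:A + x = x + s by rewrite addrC /GRing.scale /= mulr1.
  have sa' : a <= x + s by move: sa; rewrite ltr_norml => /andP[]; linear.
  have near z : Num.min x (x + s) < z -> z < Num.max x (x + s) -> `|psi z - psi x| <= e.
    move=> z1 z2; rewrite distrC; apply: Ht; rewrite /ball /= ltr_norml.
    move: st z1 z2; rewrite ltr_norml gt_min lt_max => /andP[s1 s2] /orP[]z1 /orP[]z2;
    apply/andP; split; linear.
  have := prim_near_sym np (ltW ax) sa' near.
  rewrite (addrC x s) addrK => h; rewrite hs (addrC x).
  have sn : 0 < `|s| by rewrite normr_gt0.
  rewrite -(ler_pM2l sn) -normrM mulrBr /GRing.scale /= mulVKf// distrC [`|s| * _]mulrC.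
  by rewrite [s * _]mulrC.
apply: DeriveDef; first by apply/cvg_ex; exists (psi x); exact: q.
exact: cvg_lim q.
Qed.

Lemma varle_lip_clamp (p t K : R) h : p <= t -> 0 <= K ->
  (forall x y, p <= x -> x <= y -> y <= t -> `|h y - h x| <= K * (y - x)) ->
  varle (fun x => h (clamp p t x)) (K * (t - p)).
Proof.
move=> pt K0 hl; exists (fun x => K * clamp p t x) => [x y xy|x y].
  have /andP[h1 _] := clamp_in x pt; have /andP[_ h2] := clamp_in y pt.
  by rewrite -mulrBr hl// clamp_homo.
have /andP[h1 h2] := clamp_in x pt; have /andP[h3 h4] := clamp_in y pt.
by rewrite -mulrBr (ler_wpM2l K0)// lerB.
Qed.

Lemma prim_derivative (p t K : R) V Q : p <= t -> 0 <= K ->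
  (forall x, p <= x -> x <= t -> is_derive x 1 V (Q x)) ->
  (forall x y, p <= x -> x <= y -> y <= t -> `|Q y - Q x| <= K * (y - x)) ->
  forall w, p <= w -> w <= t -> prim p (fun x => Q (clamp p t x)) w = V w - V p.
Proof.
move=> pt K0 dV QL w pw wt; pose q x := Q (clamp p t x).
have nq : nice q by apply: varle_nice; exact: varle_lip_clamp pt K0 QL.
pose Phi x := V x - prim p q x.
suff : Phi w = Phi p by rewrite /Phi prim_base -/q; linear.
apply: (@subdivision_quadratic _ Phi (fun x => K * x)) => // x y px.
rewrite le_eqVlt => /orP[/eqP->|xy] yw; first by rewrite !subrr normr0 mul0r.
have yt := le_trans yw wt.
have [z zx zy|xi /andP[x1 x2] e] := @mvt_derive _ x y V Q xy.
  by apply: dV; [exact: le_trans zx|exact: le_trans yt].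
have near z : x < z -> z < y -> `|q z - Q xi| <= K * (y - x).
  move=> xz zy; rewrite /q clamp_id; last 2 first.
  - by linear.
  - by linear.
  have [h|/ltW h] := leP z xi.
    rewrite distrC (le_trans (QL z xi _ h _))//; try linear.
    by rewrite ler_wpM2l//; linear.
  rewrite (le_trans (QL xi z _ h _))//; try linear.
  by rewrite ler_wpM2l//; linear.
have H := @prim_near _ p q x y (Q xi) _ nq px (ltW xy) near.
have -> : Phi y - Phi x = - (prim p q y - prim p q x - Q xi * (y - x)).
  by rewrite /Phi -e; ring.
rewrite normrN (le_trans H)// le_eqVlt; apply/orP; left; apply/eqP; ring.
Qed.

Record C2_on (p t : R) (X X0 X1 : R -> R) (K : R) : Prop := C2On {
  c2_0 : forall x, p <= x -> x <= t -> X0 x = X x;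
  c2_K : 0 <= K;
  c2_d : forall x, p <= x -> x <= t -> is_derive x 1 X0 (X1 x);
  c2_L0 : forall x y, p <= x -> x <= y -> y <= t -> `|X0 y - X0 x| <= K * (y - x);
  c2_L1 : forall x y, p <= x -> x <= y -> y <= t -> `|X1 y - X1 x| <= K * (y - x)
}.

Lemma C2_on_exists p t X : p <= t -> Cr_ext 2 `[p, t] X -> exists X0 X1 K, C2_on p t X X0 X1 K.
Proof.
move=> pt [U [g [oU sU gX Cg]]].
have inU x : p <= x -> x <= t -> U x by move=> h1 h2; apply: sU; rewrite /= in_itv /= h1 h2.
have cont k : (k <= 2)%N -> exists2 B, 0 <= B &
    forall x, p <= x -> x <= t -> `|derive1n k g x| <= B.
  move=> k2; apply: bounded_on_segment => // x px xt; apply: Cg.1 => //; exact: inU.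
have [B1 B10 h1] := cont 1%N isT; have [B2 B20 h2] := cont 2%N isT.
have d0 x : p <= x -> x <= t -> is_derive x 1 g (derive1n 1 g x).
  by move=> px xt; exact: (@Cr_is_derive _ 2 U g 0 Cg isT x (inU x px xt)).
have d1 x : p <= x -> x <= t -> is_derive x 1 (derive1n 1 g) (derive1n 2 g x).
  by move=> px xt; exact: (@Cr_is_derive _ 2 U g 1 Cg isT x (inU x px xt)).
exists g, (derive1n 1 g), (B1 + B2); split.
- by move=> x px xt; apply: gX; rewrite /= in_itv /= px xt.
- exact: addr_ge0.
- exact: d0.
- move=> x y px xy yt; rewrite (le_trans (lipschitz_derive d0 h1 px xy yt))//.
  by rewrite ler_wpM2r ?subr_ge0// lerDl.
- move=> x y px xy yt; rewrite (le_trans (lipschitz_derive d1 h2 px xy yt))//.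
  by rewrite ler_wpM2r ?subr_ge0// lerDr.
Qed.

End SmoothFactor.

Section TwoDensities.
Context {R : realType}.
Context {a b c l r K M : R} {f gp gm v q : R -> R}.
Hypothesis D : model a b c f gp gm v q l r K M.
Notation d := (f c).
Let S := md_sys D.
Let ac := sy_ac S.
Let cb := sy_cb S.
Let ab := sy_ab S.
Let ad := sy_ad S.
Let db := sy_d S.
Context {rho rho_reg : R -> R}.
Hypothesis H : decomposed_density a b c f rho rho_reg.
Let A := dd_acim H.
Notation rhos := (rho_sal f c rho).
Notation o n := (iter n f c).

Lemma model_image : f @` `[a, b] = `[a, d]%classic.
Proof.
apply/seteqP; split => x /=; rewrite !in_itv/=.
  by move=> [y] /=; rewrite in_itv/= => /andP[ay yb] <-; exact: (sy_f_in S).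
move=> /andP[ax xd]; have /andP[h1 h2] := br_g (sy_p S) x.
exists (gp x); last by rewrite (br_fg (sy_p S) ax xd).
by rewrite /= in_itv/= h1 (le_trans h2)// ltW.
Qed.

Context {X X0 X1 : R -> R} {KX : R}.
Hypothesis C : C2_on a d X X0 X1 KX.
Hypothesis Xa : X a = 0.
Let x0 z := X0 (clamp a d z).
Let x1 z := X1 (clamp a d z).

Let v0 : varle x0 (KX * (d - a)).
Proof. exact: varle_lip_clamp (ltW ad) (c2_K C) (c2_L0 C). Qed.

Let v1 : varle x1 (KX * (d - a)).
Proof. exact: varle_lip_clamp (ltW ad) (c2_K C) (c2_L1 C). Qed.

Let ftc w : a <= w -> w <= d -> prim a x1 w = X w.
Proof.
move=> aw wd; rewrite /x1 (prim_derivative (ltW ad) (c2_K C) (c2_d C) (c2_L1 C) aw wd).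
by rewrite !(c2_0 C)// ?(ltW ad)// Xa subr0.
Qed.

Let X0a : X0 a = 0.
Proof. by rewrite (c2_0 C)// ltW. Qed.

Let clampE z : a < z -> z < d -> clamp a d z = z.
Proof. by move=> h1 h2; rewrite clamp_id// ltW. Qed.

Lemma varle_mul p p' V V' : varle p V -> varle p' V' ->
  exists W : R, varle (fun z => p z * p' z) W.
Proof.
move=> h h'; have [B _ hB] := nice_bound (varle_nice h); have [B' _ hB'] := nice_bound (varle_nice h').
by eexists; exact: varleM hB hB' h h'.
Qed.

Lemma prim_cut p : nice p -> prim a (fun z => if a < z < d then p z else 0) b = prim a p d.
Proof.
move=> np; have nc := nice_cut a d np.
rewrite (prim_supported D)//; last by move=> x /negbTE ->.
rewrite clamp_r ?(ltW ad)//.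
have := @prim_eq _ a _ p a d nc np (lexx a) (ltW ad); rewrite !prim_base !subr0; apply=> x ax xd.
by rewrite ax xd.
Qed.

Lemma cut_out x : ~~ (a < x < b) -> (a < x < d) = false.
Proof.
by move=> nx; apply: contraNF nx => /andP[-> xd]; exact: lt_le_trans db.
Qed.

(** For an atom at [p], the integral of the step function times [X'] is [- (X p - X a) = - X p]; the
    saltus sum of these is [- J]. *)
Lemma saltus_density : exists psi, [/\ eqc (dX_rho_sal a c f rho X) psi,
  exists V, varle psi V, forall x, ~~ (a < x < b) -> psi x = 0 &
  prim a psi b = - J_of f c rho X].
Proof.
have [Vs vs] := varle_rho_sal D H; have [V vV] := varle_mul vs v1.
have nV := varle_nice vV; have [B _ hB] := nice_bound nV; have n1 := varle_nice v1.
exists (fun z => if a < z < d then rhos z * x1 z else 0); split.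
- apply: (@countableS _ _ [set a; d]); last by apply: countableU; exact: countable1.
  move=> x /= ne; apply: contrapT => nad; apply: ne.
  have xa : x <> a by move=> e; apply: nad; left.
  have xd : x <> d by move=> e; apply: nad; right.
  rewrite /dX_rho_sal in_itv/= !le_eqVlt; move/eqP/negbTE: (nesym xa) => ->; move/eqP/negbTE: xd => -> /=.
  case: ifP => // /andP[ax xd].
  rewrite mulrC /x1 clampE//; congr (_ * _).
  apply: (@deriv_in_segment _ a d x (X1 x) X X0) => //; try exact: ltW.
  + by apply: (c2_d C); exact: ltW.
  + by rewrite (c2_0 C)// ltW.
  + apply: (@filterE _ (nbhs x)) => y; rewrite /= in_itv/= => /andP[h1 h2].
    by rewrite (c2_0 C).
- by eexists; exact: varle_cutoff ad hB vV.
- by move=> x /cut_out ->.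
rewrite prim_cut// (prim_sigma D H n1 (ltW ad)).
have bX : @bounded_ad _ a c f X.
  exists (KX * (d - a)) => x ax xd; rewrite -(c2_0 C)//.
  have := c2_L0 C (lexx a) ax xd; rewrite X0a subr0 => h; rewrite (le_trans h)//.
  by rewrite ler_wpM2l ?(c2_K C)// lerD2r.
rewrite J_ofE -mulN1r -(sigmaZ D H)//; apply: sigma_eq => k.
have /andP[h1 h2] := orbit_in D k; set p := iter k.+1 f c in h1 h2 *.
have nH : nice (fun z => Hstep p z * x1 z).
  by apply: niceM => //; exact: varle_nice (varle_Hstep p).
have e1 := @prim_eq _ a _ _ a p nH (niceZ (-1) n1) (lexx a) h1.
have e2 := @prim_eq _ a _ _ p d nH (nice_cst 0) h1 h2.
rewrite prim_cst// mul0r in e2; rewrite !prim_base !subr0 primZ// ftc// in e1.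
rewrite -e1; last by move=> z _ zp; rewrite Hstep_lt.
apply/eqP; rewrite -subr_eq0 e2// => z pz _.
by rewrite Hstep_gt// mul0r.
Qed.

(** The product rule holds wherever [DD] is continuous, hence off a countable set. The integral is
    the boundary term, which vanishes as [rho_reg d = 0] and [X a = 0]. *)
Lemma regular_density : exists psi, [/\ eqc (d_X_rho_reg a c f rho_reg X) psi,
  exists V, varle psi V, forall x, ~~ (a < x < b) -> psi x = 0 & prim a psi b = 0].
Proof.
have [DD [[VD vD] D0 DE]] := regular_part_primitive D H.
have nD := varle_nice vD; have [VE vE] := varle_prim D nD D0.
pose rr z := rho_reg a + prim a DD z.
have vrr : varle rr (0 + VE).
  apply: varleD vE; exists (cst 0) => [x y _|x y]; last by rewrite subrr.
  by rewrite !subrr normr0.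
have nrr := varle_nice vrr.
have [V2 w2] := varle_mul v1 vrr; have [V3 w3] := varle_mul v0 vD.
have vV := varleD w2 w3; have nV := varle_nice vV.
have [B _ hB] := nice_bound nV; have n1 := varle_nice v1; have n0 := varle_nice v0.
exists (fun z => if a < z < d then x1 z * rr z + x0 z * DD z else 0); split.
- apply: (@countableS _ _ ([set a; d] `|` [set x | ~ {for x, continuous DD}])); last first.
    apply: countableU; last exact: varle_countable_discontinuity vD.
    by apply: countableU; exact: countable1.
  move=> x /= ne; apply: contrapT => nad; apply: ne.
  have xa : x <> a by move=> e; apply: nad; left; left.
  have xd : x <> d by move=> e; apply: nad; left; right.
  have cD : {for x, continuous DD} by apply: contrapT => nc; apply: nad; right.
  rewrite /d_X_rho_reg derive1E.
  set g := fun _ => _ * _.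
  suff [dg] : is_derive x 1 g (if a < x < d then x1 x * rr x + x0 x * DD x else 0) by [].
  case: ifPn => [/andP[ax xd']|nx].
    have near_in : \forall y \near x, a < y /\ y < d.
      by near=> y; split; near: y; [exact: lt_nbhsr|exact: lt_nbhsl].
    apply: (@near_eq_is_derive _ _ _ (fun z => X0 z * rr z)).
      apply: filterS near_in => y [ay yd]; rewrite /g in_itv/= (ltW ay) (ltW yd) /=.
      by rewrite (c2_0 C (ltW ay) (ltW yd)) (DE y (ltW ay) (ltW (lt_le_trans yd db))).
    have d1 := c2_d C (ltW ax) (ltW xd').
    have d2 : is_derive x 1 rr (DD x).
      have h := prim_is_derive nD ax cD.
      apply: is_derive_conv (is_deriveD (is_derive_cst (rho_reg a) x 1) h) => //.
      by rewrite add0r.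
    apply: is_derive_conv (is_deriveM d1 d2) => //.
    by rewrite /x0 /x1 clampE// /GRing.scale /= addrC mulrC [in X in _ + X]mulrC mulrC.
  have near_out : \forall y \near x, ~~ (a <= y <= d).
    case: (ltgtP x a) => [xlt|agt|e]; last by case: xa.
      by apply: filterS (lt_nbhsl xlt) => y ya; rewrite leNgt ya.
    case: (ltgtP x d) => [xlt|dgt|e]; last by case: xd.
      by move: nx; rewrite agt xlt.
    by apply: filterS (lt_nbhsr dgt) => y yd; rewrite [y <= _]leNgt yd andbF.
  apply: (@near_eq_is_derive _ _ _ (cst 0)).
  by apply: filterS near_out => y /negbTE ny; rewrite /g in_itv/= ny mul0r.
- by eexists; exact: varle_cutoff ad hB vV.
- by move=> x /cut_out ->.
rewrite prim_cut//.
have [B1 B10 hB1] := nice_bound n1; have [BD BD0 hBD] := nice_bound nD.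
have rrl x y : a <= x -> x <= y -> `|rr y - rr x| <= BD * (y - x).
  by move=> ax xy; rewrite /rr opprD addrACA subrr add0r; exact: prim_lip.
pose Phi t := x0 t * rr t - prim a (fun z => x1 z * rr z + x0 z * DD z) t.
have PhiE : Phi d = Phi a.
  apply: (@subdivision_quadratic _ Phi (fun t => (B1 * BD + KX * BD) * t)) => [x y ax xy yd|]; last exact: ltW.
  have xd := le_trans xy yd; have ay := le_trans ax xy.
  have n2 := varle_nice w2; have n3 := varle_nice w3.
  have -> : Phi y - Phi x =
     (prim a (fun z => rr y * x1 z - x1 z * rr z) y - prim a (fun z => rr y * x1 z - x1 z * rr z) x) +
     (prim a (fun z => x0 x * DD z - x0 z * DD z) y - prim a (fun z => x0 x * DD z - x0 z * DD z) x).
    have E1 t : prim a (fun z => x1 z * rr z + x0 z * DD z) t =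
      prim a (fun z => x1 z * rr z) t + prim a (fun z => x0 z * DD z) t by exact: primD.
    have E2 t : prim a (fun z => rr y * x1 z - x1 z * rr z) t =
      rr y * prim a x1 t - prim a (fun z => x1 z * rr z) t.
      by rewrite primB ?primZ//; exact: niceZ.
    have E3 t : prim a (fun z => x0 x * DD z - x0 z * DD z) t =
      x0 x * prim a DD t - prim a (fun z => x0 z * DD z) t.
      by rewrite primB ?primZ//; exact: niceZ.
    rewrite /Phi !E1 !E2 !E3 !ftc// -!(c2_0 C)//.
    have -> : x0 x = X0 x by rewrite /x0 clamp_id.
    have -> : x0 y = X0 y by rewrite /x0 clamp_id.
    have er t : rr t = rho_reg a + prim a DD t by [].
    rewrite (er x) (er y); ring.
  have h1 : `|prim a (fun z => rr y * x1 z - x1 z * rr z) y -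
      prim a (fun z => rr y * x1 z - x1 z * rr z) x| <= B1 * (BD * (y - x)) * (y - x).
    apply: prim_lip => //; first by apply: niceB => //; exact: niceZ.
    move=> z xz zy; rewrite [rr y * _]mulrC -mulrBr normrM ler_pM//.
    have az := le_trans ax (ltW xz).
    rewrite (le_trans (rrl z y az (ltW zy)))// (ler_wpM2l (ltW BD0))// lerD2l lerN2 ltW//.
  have h2 : `|prim a (fun z => x0 x * DD z - x0 z * DD z) y -
      prim a (fun z => x0 x * DD z - x0 z * DD z) x| <= KX * (y - x) * BD * (y - x).
    apply: prim_lip => //; first by apply: niceB => //; exact: niceZ.
    move=> z xz zy; rewrite -mulrBl normrM ler_pM//.
    have zd := le_trans (ltW zy) yd.
    rewrite distrC /x0 !clamp_id//; last by rewrite (le_trans ax)// ltW.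
    rewrite (le_trans (c2_L0 C ax (ltW xz) zd))// (ler_wpM2l (c2_K C))// lerD2r ltW//.
  rewrite (le_trans (ler_normD _ _))//.
  have -> : (y - x) * ((B1 * BD + KX * BD) * y - (B1 * BD + KX * BD) * x) =
    B1 * (BD * (y - x)) * (y - x) + KX * (y - x) * BD * (y - x) by ring.
  exact: lerD.
have rd : rr d = 0 by rewrite /rr -DE ?(ltW ad)// (rho_reg_right D H).
move: PhiE; rewrite /Phi rd mulr0 prim_base subr0 /x0 clamp_l ?(ltW ad)// X0a mul0r.
by rewrite sub0r => /eqP; rewrite oppr_eq0 => /eqP.
Unshelve. all: by end_near.
Qed.

End TwoDensities.

(** * Limits of the pairings with iterates *)

Section Pairing.
Context {R : realType}.
Notation mu := (@lebesgue_measure R).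
Context {a b c l r K M : R} {f gp gm v q : R -> R}.
Hypothesis D : model a b c f gp gm v q l r K M.
Notation d := (f c).
Notation L := (@op _ a d gp gm v).
Let S := md_sys D.
Let ac := sy_ac S.
Let cb := sy_cb S.
Let ab := sy_ab S.
Let ad := sy_ad S.
Let db := sy_d S.

Lemma continuous_nice (phi : R -> R) : {within `[a, b], continuous phi} ->
  nice (phi \_ `[a, b]).
Proof.
move=> cp; split.
  apply/(measurable_restrictT phi (measurable_itv `[a, b])).
  exact: subspace_continuous_measurable_fun.
have [x _ hx] := EVT_max (ltW ab) cp; have [y _ hy] := EVT_min (ltW ab) cp.
exists (`|phi x| + `|phi y|) => z; rewrite patchE; case: ifPn => [|_]; last first.
  by rewrite normr0 addr_ge0.
rewrite inE/= => zab; have h1 := hx z zab; have h2 := hy z zab.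
have := ler_norm (phi x); have := ler_norm (- phi y); rewrite normrN => h3 h4.
have h5 := normr_ge0 (phi x); have h6 := normr_ge0 (phi y).
by rewrite ler_norml; apply/andP; split; linear.
Qed.

Lemma L1_pairingE psi psi' V phi j : eqc psi psi' -> varle psi' V ->
  nice (phi \_ `[a, b]) ->
  L1_pairing a b f psi phi j = prim a (fun x => iter j L psi' x * (phi \_ `[a, b]) x) b.
Proof.
move=> e vp np; rewrite /L1_pairing.
have [W vW] := varle_iter S j (md_w1 D) vp.
have nw := niceM (varle_nice vW) np.
transitivity (\int[mu]_(x in `[a, b]) (iter j (L1 a b f) psi x * (phi \_ `[a, b]) x)).
  by apply: eq_Rintegral => x xab; rewrite patchE xab.
rewrite -(@eqc_Rintegral _ _ (fun x => iter j L psi' x * (phi \_ `[a, b]) x)).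
- by rewrite /prim Rintegral_itv_bndo_bndc//; exact: nice_integrable nw.
- exact: measurable_itv.
- by have [] := nw.
apply: (countableS _ (eqc_sym (iter_L1_eqc D j e))) => x /= ne e'.
by apply: ne; rewrite e'.
Qed.

Lemma prim_pairing_bound w phi B : nice w -> nice phi -> (forall x, `|phi x| <= B) ->
  `|prim a (fun x => w x * phi x) b| <= B * prim a (fun x => `|w x|) b.
Proof.
move=> nw np hB; have nwp := niceM nw np.
have h1 := prim_norm nwp (lexx a) (ltW ab); rewrite !prim_base !subr0 in h1.
rewrite (le_trans h1)// -primZ; last exact: nice_norm.
have := @prim_le _ a _ _ a b (nice_norm nwp) (niceZ B (nice_norm nw)) (lexx a) (ltW ab).
rewrite !prim_base !subr0; apply => x _ _.
by rewrite normrM mulrC ler_wpM2r.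
Qed.

Context {rho : R -> R}.
Hypothesis A : acim_density a b f rho.
Context {q1 q2 : R}.
Hypothesis aq1 : a < q1.
Hypothesis q12 : q1 < q2.
Hypothesis q2d : q2 < d.
Hypothesis cov : @covers _ a b f q1 q2.

(** Subtracting the integral of [psi'] times the fixed point [rho] leaves a function of mean zero,
    to which the spectral gap applies. *)
Lemma L1_pairing_limit psi psi' V phi : eqc psi psi' -> varle psi' V ->
  (forall x, ~~ (a < x < b) -> psi' x = 0) -> nice (phi \_ `[a, b]) ->
  exists C k, [/\ 0 <= C, 0 < k, k < 1 & forall j,
    `|L1_pairing a b f psi phi j -
      prim a psi' b * prim a (fun x => rho x * (phi \_ `[a, b]) x) b| <= C * k ^+ j].
Proof.
move=> e vp out np.
have [C [k [C0 k0 k1 HC]]] := spectral_gap S (md_w1 D) aq1 q12 q2d cov.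
have [Vr vr] := rho_varle D A; have nr := varle_nice vr; have [Mr _ hMr] := nice_bound nr.
have [B B0 hB] := nice_bound np.
(* The spectral gap asks for functions vanishing at [a] and [b]; the cut changes [rho] at two points
   at most. *)
pose rc x := if a < x < b then rho x else 0.
have vrc : varle rc (Vr + 2 * Mr) by exact: varle_cutoff ab hMr vr.
have nrc := varle_nice vrc.
have erc : eqc rc rho.
  apply: (@countableS _ _ [set a; b]); last by apply: countableU; exact: countable1.
  move=> x /= ne; apply: contrapT => nab; apply: ne.
  rewrite /rc; case: ifPn => // nx; apply/esym/(acim_supp A) => /=; rewrite in_itv/=.
  move=> /andP[]; rewrite !le_eqVlt => /orP[/eqP ea|ax] /orP[/eqP eb|xb].
  - by apply: nab; left.
  - by apply: nab; left.
  - by apply: nab; right.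
  - by move: nx; rewrite ax xb.
have mrc : prim a rc b = 1 by rewrite (prim_eqc a b nrc erc) (rho_mass D A).
set m := prim a psi' b.
pose w x := psi' x + (- m) * rc x.
have vw := varleD vp (varleZ (- m) vrc).
have wout x : ~~ (a < x < b) -> w x = 0.
  by move=> nx; rewrite /w out// /rc (negbTE nx) mulr0 addr0.
have w0 : prim a w b = 0.
  have np' := varle_nice vp.
  by rewrite /w primD ?primZ ?mrc ?mulr1 ?subrr//; exact: niceZ.
exists (B * (C * (V + `|- m| * (Vr + 2 * Mr)))), k; split=> //.
  by rewrite mulr_ge0 ?(ltW B0)// mulr_ge0// (varle_ge0 vw).
move=> j; rewrite (L1_pairingE j e vp np).
have [W1 vW1] := varle_iter S j (md_w1 D) vw.
have [W2 vW2] := varle_iter S j (md_w1 D) vrc.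
have E : (fun x => iter j L psi' x * (phi \_ `[a, b]) x) =
    (fun x => iter j L w x * (phi \_ `[a, b]) x + m * (iter j L rc x * (phi \_ `[a, b]) x)).
  apply/funext => x; rewrite /w iter_opD iter_opZ; ring.
have n1 := niceM (varle_nice vW1) np; have n2 := niceM (varle_nice vW2) np.
rewrite E primD//; last exact: niceZ.
rewrite primZ//.
have -> : prim a (fun x => iter j L rc x * (phi \_ `[a, b]) x) b =
    prim a (fun x => rho x * (phi \_ `[a, b]) x) b.
  apply: (prim_eqc a b n2).
  have h1 := @op_eqc _ a b c l r K M f gp gm v q D.
  have fr : eqc rc (L rc).
    by apply: eqc_trans erc (eqc_trans (rho_fixed D A) (h1 _ _ (eqc_sym erc))).
  apply: (countableS _ (eqc_trans (iter_op_fixed D j fr) erc)) => x /= ne e'.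
  by apply: ne; rewrite e'.
rewrite addrK (le_trans (prim_pairing_bound (varle_nice vW1) np hB))//.
have h := HC _ _ vw wout w0 j.
rewrite -!mulrA (ler_wpM2l (ltW B0))// (le_trans h)//.
by rewrite -mulrA [_ ^+ _ * _]mulrC mulrA.
Qed.

End Pairing.

(** * Divergence and the test function *)

Section Divergence.
Context {R : realType}.

Lemma neg_series_terms (u : nat -> R) : neg_series_cvg u -> u j.+1 @[j --> \oo] --> (0 : R).
Proof.
rewrite /neg_series_cvg; set s := fun n => _ => cs.
have h1 : s n.+1 @[n --> \oo] --> limn s by rewrite (cvg_shiftS s).
have -> : (fun j => u j.+1) = (fun n => s n - s n.+1).
  by apply/funext => n; rewrite /s [X in _ - - X]big_nat_recr//= opprK addKr.
rewrite -(subrr (limn s)); exact: cvgB.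
Qed.

Lemma neg_series_geometric (u : nat -> R) (C k : R) : 0 <= C -> 0 < k -> k < 1 ->
  (forall j, `|u j| <= C * k ^+ j) -> neg_series_cvg u.
Proof.
move=> C0 k0 k1 hu; have hu' j : `|u j.+1| <= C * k ^+ j.
  rewrite (le_trans (hu _))// ler_wpM2l// exprS ler_piMl ?exprn_ge0 ?(ltW k0)// ltW//.
have := geometric_dominated_cvg C0 k0 k1 hu'.
rewrite /neg_series_cvg => h; apply: is_cvgN.
rewrite (_ : (fun n => _) = series (fun j => u j.+1))//.
by apply/funext => n; rewrite /series /= big_add1.
Qed.

Lemma accumulation_point (a b : R) (x : nat -> R) : (forall j, a <= x j <= b) ->
  exists2 p, a <= p <= b & forall e n, 0 < e -> exists2 j, (n <= j)%N & `|x j - p| < e.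
Proof.
move=> hx; have [p [pab cl]] : exists p, `[a, b]%classic p /\ cluster (x j @[j --> \oo]) p.
  have [|p] := @segment_compact _ a b (x j @[j --> \oo]) _; last by exists p.
  by apply: (@filterE _ \oo) => j; rewrite /= in_itv/= hx.
exists p; first by move: pab; rewrite /= in_itv.
move=> e n e0; have [] := cl (x @` [set j | (n <= j)%N]) (ball p e).
- by exists n => // j nj; exists j.
- exact: nbhsx_ballx.
by move=> _ [[j nj <-]]; rewrite /ball /= distrC => h; exists j.
Qed.

Lemma Cinfty_horner (A : set R) (P : {poly R}) : Cinfty_ext A (horner P).
Proof.
exists setT, (horner P); split => //; first exact: openT.
have E k : exists Q : {poly R}, derive1n k (horner P) = horner Q.
  elim: k => [|k [Q e]]; first by exists P.
  by exists Q^`(); rewrite derive1nS e derivE.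
move=> r; split => k _ x _; have [Q ->] := E k.
  exact: continuous_horner.
exact: derivable_horner.
Qed.

End Divergence.

Section TestFunction.
Context {R : realType}.
Context {a b c l r K M : R} {f gp gm v q : R -> R}.
Hypothesis D : model a b c f gp gm v q l r K M.
Let ab := sy_ab (md_sys D).
Context {rho : R -> R}.
Hypothesis A : acim_density a b f rho.

(** A density bounded by [B] puts at most half of its mass within distance [1 / (4 * B)] of [p]; the
    other half contributes at least [e ^+ 2 / 2] to the excess over [1]. *)
Lemma quadratic_mean p phi : a <= p -> p <= b -> nice phi ->
  (forall x, a <= x -> x <= b -> phi x = 1 + (x - p) ^+ 2) ->
  1 < prim a (fun x => rho x * phi x) b.
Proof.
move=> ap pb np hp; have nr := rho_nice D A; have [B B0 hB] := nice_bound nr.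
have n1 := niceM nr np; pose s x := rho x * (phi x - 1).
have ns : nice s by apply: niceM => //; apply: niceB => //; exact: nice_cst.
have s0 x : a <= x -> x <= b -> 0 <= s x.
  by move=> ax xb; rewrite mulr_ge0 ?(acim_ge0 A)// hp// addrC addKr sqr_ge0.
have -> : prim a (fun x => rho x * phi x) b = 1 + prim a s b.
  rewrite -(rho_mass D A) -primD//; congr (prim a _ b); apply/funext => x.
  by rewrite /s; ring.
rewrite ltrDl; pose e := (4 * B)^-1.
have e0 : 0 < e by rewrite invr_gt0 mulr_gt0.
set u := clamp a b (p - e); set t := clamp a b (p + e).
have /andP[au ub] := clamp_in (p - e) (ltW ab); have /andP[at_ tb] := clamp_in (p + e) (ltW ab).
have ut : u <= t by apply: clamp_homo; linear.
have tu : t - u <= 2 * e.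
  by have := clamp_lip (ltW ab) (_ : p - e <= p + e); rewrite -/u -/t => /(_ ltac:(linear)); linear.
have far x : a < x -> x < b -> x < u \/ t < x -> e ^+ 2 * rho x <= s x.
  move=> ax xb h; rewrite mulrC /s ler_wpM2l ?(acim_ge0 A)// (hp _ (ltW ax) (ltW xb)) [1 + _]addrC addrK.
  case: h => h.
    have : x < p - e.
      by rewrite ltNge; apply/negP => h'; move: h; rewrite ltNge /u -(clamp_id (ltW ax) (ltW xb)) clamp_homo.
    by move=> h'; rewrite -[leRHS]sqrrN !expr2; apply: ler_pM; linear.
  have : p + e < x.
    by rewrite ltNge; apply/negP => h'; move: h; rewrite ltNge /t -(clamp_id (ltW ax) (ltW xb)) clamp_homo.
  by move=> h'; rewrite !expr2; apply: ler_pM; linear.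
have nz := niceZ (e ^+ 2) nr.
have i1 := @prim_le _ a _ s a u nz ns (lexx a) au
  (fun x h1 h2 => far x h1 (lt_le_trans h2 ub) (or_introl h2)).
have i2 := @prim_le _ a _ s t b nz ns at_ tb
  (fun x h1 h2 => far x (le_lt_trans at_ h1) h2 (or_intror h1)).
have i3 := @prim_ge0 _ a s u t ns au ut
  (fun x h1 h2 => s0 x (le_trans au (ltW h1)) (le_trans (ltW h2) tb)).
have i4 := @prim_lip _ a rho u t B nr au ut (fun x _ _ => hB x).
have i5 : B * (t - u) <= 1 / 2.
  rewrite (le_trans (ler_wpM2l (ltW B0) tu))// /e invfM.
  have -> : B * (2 * (4^-1 * B^-1)) = B / B * (2 / 4) by ring.
  by rewrite divff ?gt_eqF//; linear.
have i6 := le_trans (ler_norm _) i4.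
rewrite !primZ// !prim_base in i1 i2; have m := rho_mass D A.
have e2 : 0 < e ^+ 2 by rewrite exprn_gt0.
have i7 : e ^+ 2 * (1 / 2) <= e ^+ 2 * (prim a rho u + (prim a rho b - prim a rho t)).
  by rewrite ler_wpM2l ?(ltW e2)//; linear.
have : 0 < e ^+ 2 * (1 / 2) by rewrite mulr_gt0.
linear.
Qed.

End TestFunction.

Theorem proposition4p5 (R : realType) (a b c : R) (f : R -> R)
    (hf : unimodal 3 a b c f) (hmix : mixing c f)
    (rho rho_reg : R -> R) (hrho : decomposed_density a b c f rho rho_reg)
    (X : R -> R) (hX : Cr_ext 2 (f @` `[a, b]) X) (hXa : X a = 0) :
  (forall phi : R -> R, {within `[a, b], continuous phi} ->
     neg_series_cvg (L1_pairing a b f (d_X_rho_reg a c f rho_reg X) phi)) /\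
  (J_of f c rho X != 0 ->
   exists phi : R -> R,
     [/\ Cinfty_ext `[a, b] phi,
         ~ neg_series_cvg (orbit_term a b c f rho X phi),
         ~ neg_series_cvg (L1_pairing a b f (dX_rho_sal a c f rho X) phi) &
         ~ neg_series_cvg (fun j => orbit_term a b c f rho X phi j +
             L1_pairing a b f (dX_rho_sal a c f rho X) phi j)]).
Proof.
have [gp [gm [v [q [l [r [K [M D]]]]]]]] := model_exists hf.
have S := md_sys D; have ab := sy_ab S; have ad := sy_ad S; have db := sy_d S.
have [q1 [q2 [aq1 q12 q2d cov]]] := mixing_covers S (uni_cont hf) hmix.
have A := dd_acim hrho.
rewrite (model_image D) in hX.
have [X0 [X1 [KX C2]]] := C2_on_exists (ltW ad) hX.
split.
  move=> phi cphi; have np := continuous_nice D cphi.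
  have [psi [e [V vV] out m0]] := regular_density D hrho C2 hXa.
  have [C [k [C0 k0 k1 HC]]] := L1_pairing_limit D A aq1 q12 q2d cov e vV out np.
  apply: neg_series_geometric C0 k0 k1 _ => j.
  by have := HC j; rewrite m0 mul0r subr0.
move=> J0; set J := J_of f c rho X in J0 *.
have oin j : a <= iter j f c <= b.
  by apply: (sy_iter_in S); apply: ltW; [exact: sy_ac S|exact: sy_cb S].
(* The orbit is shifted by one to match series that start at index [1]. *)
have [p /andP[ap pb] acc] := accumulation_point (fun j => oin j.+1).
pose P : {poly R} := 1 + ('X - p%:P) ^+ 2.
pose phi := horner P.
have phiE x : phi x = 1 + (x - p) ^+ 2 by rewrite /phi /P !hornerE.
(* The restriction is essential: a polynomial is unbounded on the line. *)
have np : nice (phi \_ `[a, b]).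
  apply: (continuous_nice D); apply: continuous_subspaceT; exact: continuous_horner.
set I := prim a (fun x => rho x * (phi \_ `[a, b]) x) b.
have I1 : 1 < I.
  apply: (quadratic_mean D A ap pb np) => x ax xb.
  by rewrite patchE ifT ?phiE// inE /= in_itv/= ax xb.
have [psi [e [V vV] out m0]] := saltus_density D hrho C2 hXa.
have [C [k [C0 k0 k1 HC]]] := L1_pairing_limit D A aq1 q12 q2d cov e vV out np.
set pr := L1_pairing a b f (dX_rho_sal a c f rho X) phi in HC *.
have pr_cvg : pr j.+1 @[j --> \oo] --> - J * I.
  have : pr j @[j --> \oo] --> - J * I.
    apply/cvgrPdist_le => e' e'0.
    have := @cvg_geometric R C k; rewrite gtr0_norm// => /(_ k1).
    move=> /cvgrPdist_le /(_ e' e'0); apply: filterS => j; rewrite sub0r normrN => h.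
    rewrite distrC; have := HC j; rewrite m0 -/J -/I => h'.
    exact: le_trans h' (le_trans (ler_norm _) h).
  by rewrite -(cvg_shiftS pr).
pose B j : R := \sum_(1 <= k < (min_onat j (M_of f c)).+1)
  (s_coef f c rho 1 * X (iter k f c) / diter a b f k.-1 (f c)).
have B_cvg : B j.+1 @[j --> \oo] --> J.
  have bX : forall x, a <= x -> x <= f c -> `|X x| <= KX * (f c - a).
    move=> x ax xd; rewrite -(c2_0 C2)//.
    have := c2_L0 C2 (lexx a) ax xd; rewrite (c2_0 C2 (lexx a) (ltW ad)) hXa subr0 => h.
    by rewrite (le_trans h)// ler_wpM2l ?(c2_K C2)// lerD2r.
  have := orbit_sum_cvg D hrho bX; rewrite -J_ofE -/J => h.
  by rewrite (cvg_shiftS B); exact: h.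
have phi1 x : 1 <= phi x by rewrite phiE lerDl sqr_ge0.
have otE j : orbit_term a b c f rho X phi j = phi (iter j f c) * B j by [].
exists phi; split; first exact: Cinfty_horner.
(* As [phi] is at least [1], terms tending to [0] would force the inner sums to [0], whereas they
   tend to [J]. *)
- move=> /neg_series_terms h; move/eqP: J0; apply.
  apply: (cvg_unique (@Rhausdorff R) B_cvg).
  apply/cvgrPdist_le => e' e'0; move/cvgrPdist_le: h => /(_ e' e'0).
  apply: filterS => j; rewrite !sub0r !normrN otE normrM; apply: le_trans.
  by apply: ler_peMl => //; exact: le_trans (phi1 _) (ler_norm _).
- move=> /neg_series_terms h.
  have /eqP : - J * I = 0 by exact: (cvg_unique (@Rhausdorff R) pr_cvg h).
  rewrite mulf_eq0 oppr_eq0 (negbTE J0) /= => /eqP I0.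
  by move: I1; rewrite I0 ltr10.
move=> /neg_series_terms h.
have h1 : phi (iter j.+1 f c) * B j.+1 @[j --> \oo] --> J * I.
  have -> : J * I = 0 - (- J * I) by rewrite sub0r mulNr opprK.
  have -> : (fun j => phi (iter j.+1 f c) * B j.+1) =
    (fun j => (orbit_term a b c f rho X phi j.+1 + pr j.+1) - pr j.+1).
    by apply/funext => j; rewrite addrK otE.
  exact: cvgB.
(* Half the gap between the minimum of [phi] and its mean. Convergence would force
   [(phi (c_j) - I) * B j] to [0], yet at infinitely many [j] it is at least [g * (|J| / 2)] in
   absolute value, against the threshold [g * (|J| / 4)]. *)
pose g := (I - 1) / 2.
have g0 : 0 < g by rewrite divr_gt0// subr_gt0.
have h2 : phi (iter j.+1 f c) * B j.+1 - I * B j.+1 @[j --> \oo] --> (0 : R).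
  rewrite -[X in _ --> X](subrr (J * I)) [X in _ - X]mulrC.
  apply: cvgB => //; apply: cvgM => //; exact: cvg_cst.
have J1 : 0 < `|J| by rewrite normr_gt0.
have e1 : 0 < `|J| / 2 by rewrite divr_gt0.
have e2 : 0 < g * (`|J| / 4) by rewrite mulr_gt0// divr_gt0.
have e3 : 0 < Num.min 1 g by rewrite lt_min ltr01.
move/cvgrPdist_le: h2 => /(_ _ e2) [n1 _ H1].
move/cvgrPdist_le: B_cvg => /(_ _ e1) [n2 _ H2].
(* A distance below [1] and below [g] has its square below [g]. *)
have [j nj hj] := acc (Num.min 1 g) (maxn n1 n2) e3.
have {}H1 := H1 j (leq_trans (leq_maxl _ _) nj).
have {}H2 := H2 j (leq_trans (leq_maxr _ _) nj).
rewrite /= sub0r normrN -mulrBl normrM in H1.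
have Bj : `|J| / 2 <= `|B j.+1|.
  have := lerB_dist J (B j.+1) => h'.
  have := le_trans h' H2; linear.
have pj : phi (iter j.+1 f c) <= 1 + g.
  rewrite phiE lerD2l; move: hj; rewrite lt_min => /andP[j1 j2].
  rewrite -real_normK ?num_real// expr2 (le_trans _ (ltW j2))//.
  by rewrite ler_piMl// ltW.
have pI : g <= `|phi (iter j.+1 f c) - I|.
  by rewrite distrC (le_trans _ (ler_norm _))// /g; move: pj; rewrite /g; linear.
have := ler_pM (ltW g0) (ltW e1) pI Bj.
move/le_trans => /(_ _ H1).
rewrite ler_pM2l//; linear.
Qed.
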